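(* Let $1/2<\sigma<1$ and $0<\delta\leq \sigma$. If the asymptotic formula $$\frac{1}{T}\int_{T}^{2T}|\zeta(\sigma+it)|^{2k}dt= (1+o(1))\sum_{n=1}^{\infty}\frac{d_k(n)^2}{n^{2\sigma}}\qquad (T\to\infty)\qquad (\ast)$$ holds for all positive integers $k\leq (\log T)^{\delta}$, then $L_T(\sigma)\ll (\log T)^{1-\delta}$. Conversely, if $L_T(\beta)\ll (\log T)^{1-\delta}$ for all $\beta \geq \sigma-1/\log_2 T$, then $(\ast)$ holds for all positive integers $k\leq c(\log T)^{\delta}/\log_2 T$, where $c>0$ is a suitably small constant.
   Context: $L_T(\sigma):=\max_{t\in [T,2T]}\log |\zeta(\sigma+it)|$. $d_k(n)$ is the $k$-fold divisor function, i.e. the multiplicative function with $d_k(p^a)=\Gamma(k+a)/(\Gamma(k)a!)$. $\log_2=\log\log$. *)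

(* Defs.v *)
From mathcomp Require Import ssreflect ssrbool ssrnat seq prime binomial bigop.

(* k-fold divisor function: multiplicative with d_k(p^a) = Gamma(k+a)/(Gamma(k) a!)
   = binom(k+a-1, a) for k a positive integer. *)
Definition dk (k n : nat) : nat :=
  \prod_(p <- primes n) 'C(k + logn p n - 1, logn p n).

From Stdlib Require Import Reals.
From Coquelicot Require Import Coquelicot.
Open Scope R_scope.

Definition cpow (x : R) (w : C) : C :=
  (exp (fst w * ln x) * cos (snd w * ln x), exp (fst w * ln x) * sin (snd w * ln x)).

Fixpoint zsum (N : nat) (s : C) : C :=
  match N with
  | O => RtoC 0
  | S m => Cplus (zsum m s) (cpow (INR (S m)) (Copp s))
  end.

(* sum_{n<=N} n^{-s} - N^{1-s}/(1-s); converges to zeta(s) for Re s > 0, s <> 1 *)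
Definition zeta_approx (N : nat) (s : C) : C :=
  Cminus (zsum N s) (Cdiv (cpow (INR N) (Cminus (RtoC 1) s)) (Cminus (RtoC 1) s)).

(* Riemann zeta function on Re s > 0, s <> 1 (analytic continuation) *)
Definition zeta (s : C) : C :=
  (real (Lim_seq (fun N => fst (zeta_approx N s))),
   real (Lim_seq (fun N => snd (zeta_approx N s)))).

(* "L_T(sigma) <= B", where L_T(sigma) = max_{t in [T,2T]} log |zeta(sigma+it)| *)
Definition LT_le (sigma T B : R) : Prop :=
  forall t, T <= t <= 2 * T -> ln (Cmod (zeta (sigma, t))) <= B.

Definition Dsum (k : nat) (sigma : R) : R :=
  Series (fun n => (INR (dk k (S n))) ^ 2 / Rpower (INR (S n)) (2 * sigma)).

Definition moment (k : nat) (sigma T : R) : R :=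
  RInt (fun t => Cmod (zeta (sigma, t)) ^ (2 * k)) T (2 * T) / T.

Definition moment_asymp (sigma : R) (K : R -> R) : Prop :=
  forall eps, 0 < eps -> exists T0, forall T, T0 <= T ->
    forall k : nat, (1 <= k)%nat -> INR k <= K T ->
      Rabs (moment k sigma T / Dsum k sigma - 1) <= eps.

(* Main.v *)
(** Splitting the Euler product of
    [D_k(s) = sum_n d_k(n)^2 n^(-2s)] at the primes of size [k^(1/s)] gives [log D_k(s) << k^(1/s)].

    From moments to the maximum: zeta varies by [O(1)] on intervals of length a negative power of [T], so a
    value [M] at one point of [[T, 2T]] forces the [2k]-th moment to be at least [T^(-A) (M/2)^(2k)]. With
    [k] of size [(log T)^delta] the bound for [D_k] turns this into [log M << (log T)^(1 - delta)].

    From the maximum to moments: let [P] be the partial sum of length [N = X^2], [X = T^(1/16)], of the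
    Dirichlet series of [zeta^k]. Cauchy's formula with kernel [X^w / w] on the rectangle
    [[-eta, 4 - sigma] x [-T/2, T/2]], [eta = 1 / (2 log log T)], is applied to [zeta^k - P] around
    [sigma + it]. On the right side the integrand is a tail of an absolutely convergent series, on the
    horizontal sides [1 / w] is small, and on the left side [zeta^k] is controlled by the hypothesis and gains
    [X^(-eta)]. What [P] contributes on the left is a Dirichlet polynomial whose coefficients do not depend
    on [t], hence is small in mean square by the mean value theorem. So [zeta^k] is close to [P] in mean square,
    and the mean square of [P] is asymptotic to [D_k]. *)

Require Import Defs.
From HB Require structures.
From mathcomp Require ssreflect ssrfun ssrbool eqtype ssrnat seq div choice fintype path bigop prime binomial.
From Stdlib Require Import Reals Lra Lia.
From Coquelicot Require Import Coquelicot.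
Open Scope R_scope.

(** The loss of [log log T] in the range of [k] comes from the left side of the contour. Put
    [l = log T] and [y = l / log l]. Moving left by [eta] gains only [X^(-eta) = exp (- y / 32)], so
    [zeta^k] and [D_k (sigma - eta)] have to stay below [exp (y / 64)]. Since the hypothesis allows
    [|zeta|^k] to reach [exp (O(k l^(1 - delta)))], this forces [k <= c l^delta / log l] with small
    [c]. A much larger [eta] is excluded, because the hypothesis reaches only [1 / log log T] to the
    left of [sigma]; half of that is used since heights below and above [[T, 2T]] also occur.

    The contour argument is run on [zeta_approx M], an explicit finite expression whose only
    singularity [s = 1] lies outside the region. The resulting estimate does not depend on [M], so
    locally uniform convergence carries it over to [zeta], whose holomorphy is never established.

    Since [D_k >= 1], absolute errors give the relative asymptotic formula, uniformly in [k]. *)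

(* The sum starts at index 1. *)
Fixpoint rsum (f : nat -> R) (N : nat) : R :=
  match N with O => 0 | S m => rsum f m + f (S m) end.

(** * The divisor function *)

Module DivisorSums.
Import HB.structures ssreflect ssrfun ssrbool eqtype ssrnat seq div choice fintype path bigop prime binomial.
Open Scope nat_scope.

(** This is the convolution [d_(k+1) = d_k * 1] at the prime power [p^a]; the induction step is
    Pascal's rule. *)
Lemma bin_hockey k a : \sum_(0 <= j < a.+1) 'C(k + j - 1, j) = 'C(k + a, a).
Proof.
elim: a => [|a IH]; first by rewrite big_nat1 addn0 !bin0.
rewrite big_nat_recr //= IH addnS subn1 /= addnC; by rewrite binS.
Qed.

Lemma dk_pfactor_mul k p j d : prime p -> 0 < d -> ~~ (p %| d) ->
  dk k (p ^ j * d) = 'C(k + j - 1, j) * dk k d.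
Proof.
move=> pp d0 npd.
have lpd : logn p d = 0 by apply/eqP; rewrite -leqn0 -ltnS -[_ < 1]/(_ <= 0) leqNgt logn_gt0 mem_primes pp d0.
(* The case [j = 0] is separate because [p] is then absent from [primes (p ^ j * d)]. *)
case: j => [|j]; first by rewrite expn0 mul1n bin0 mul1n.
have pj0 : 0 < p ^ j.+1 by rewrite expn_gt0 prime_gt0.
have E : perm_eq (primes (p ^ j.+1 * d)) (p :: primes d).
  apply: uniq_perm; first exact: primes_uniq.
    by rewrite /= primes_uniq mem_primes (negbTE npd) !andbF.
  by move=> q; rewrite primesM // primesX // primes_prime // !inE.
rewrite /dk (perm_big _ E) /= big_cons lognM // lognX logn_prime // eqxx muln1 lpd addn0.
congr (_ * _); apply: eq_big_seq => q qd.
rewrite lognM // lognX logn_prime //.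
case: eqP qd => [->|_] qd; last by rewrite muln0.
by move: qd npd; rewrite mem_primes => /and3P[_ _ ->].
Qed.

(** Strong induction that splits off the full power of the smallest prime factor: the divisors of
    [p^a * m] are the products [p^j * d] with [j <= a] and [d] dividing [m], and the sum over [j] is
    [bin_hockey]. *)
Lemma dkS_sum_divisors k n : 0 < n -> dk k.+1 n = \sum_(d <- divisors n) dk k d.
Proof.
elim/ltn_ind: n => n IH n0.
case: (ltnP 1 n) => n1; last first.
  have -> : n = 1 by apply/eqP; rewrite eqn_leq n1 n0.
  by rewrite /dk /= !big_cons !big_nil.
have pp := pdiv_prime n1; set p := pdiv n in pp.
have [m cpm nE] := pfactor_coprime pp n0.
set a := logn p n in nE.
have pm : ~~ (p %| m) by rewrite -prime_coprime.
have m0 : 0 < m by move: n0; rewrite nE muln_gt0 => /andP[].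
have a0 : 0 < a by rewrite /a logn_gt0 mem_primes pp n0 pdiv_dvd.
have mn : m < n by rewrite nE ltn_Pmulr // -(exp1n a) ltn_exp2r // prime_gt1.
have lm : logn p m = 0 by rewrite logn_coprime.
have E : perm_eq (divisors n) [seq p ^ j * d | j <- index_iota 0 a.+1, d <- divisors m].
  apply: uniq_perm; first exact: divisors_uniq.
    apply: allpairs_uniq; [exact: iota_uniq|exact: divisors_uniq|].
    move=> [i d] [j e] H1 H2 /= eq.
    have {H1}[[i' d'] /= [_ dm [Ei Ed]]] := allpairsP H1; subst i' d'.
    have {H2}[[j' e'] /= [_ em [Ej Ee]]] := allpairsP H2; subst j' e'.
    rewrite -dvdn_divisors // in dm; rewrite -dvdn_divisors // in em.
    have d0 := dvdn_gt0 m0 dm; have e0 := dvdn_gt0 m0 em.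
    have ld : forall x, x %| m -> logn p x = 0.
      by move=> x xm; apply/eqP; rewrite -leqn0 -lm; apply: dvdn_leq_log.
    have px x : 0 < p ^ x by rewrite expn_gt0 prime_gt0.
    have ij : i = j.
      have /(congr1 (logn p)) := eq.
      by rewrite !lognM // !pfactorK // !ld // !addn0.
    move: eq; rewrite ij => /eqP; rewrite eqn_pmul2l // => /eqP ->.
    by [].
  move=> x; rewrite -dvdn_divisors //; apply/idP/allpairsP.
    move=> xn; have x0 := dvdn_gt0 n0 xn.
    have [y cpy xE] := pfactor_coprime pp x0.
    exists (logn p x, y); split => /=.
    - by rewrite mem_index_iota /= ltnS dvdn_leq_log.
    - rewrite -dvdn_divisors // -(@Gauss_dvdl y m (p ^ a)) ?coprimeXr //; last by rewrite coprime_sym.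
      by rewrite -nE; apply: dvdn_trans xn; rewrite [X in _ %| X]xE dvdn_mulr.
    - by rewrite mulnC.
  move=> [[j d] /= [ja dm ->]]; rewrite -dvdn_divisors // in dm.
  rewrite nE mulnC dvdn_mul // dvdn_exp2l //.
  by move: ja; rewrite mem_index_iota ltnS.
rewrite (perm_big _ E) big_allpairs_dep {1}nE mulnC dk_pfactor_mul // IH //.
rewrite addSn subn1 /= -bin_hockey big_distrl /=; apply: eq_bigr => j _.
rewrite big_distrr /=; apply: eq_big_seq => d; rewrite -dvdn_divisors // => dm.
rewrite dk_pfactor_mul //; first exact: dvdn_gt0 dm.
by apply: contra pm => pd; apply: dvdn_trans dm.
Qed.

(** * Real sums as iterated operators, and Dirichlet convolution *)

HB.instance Definition _ := Monoid.isComLaw.Build R 0%R Rplus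
  (fun x y z => esym (Rplus_assoc x y z)) Rplus_comm Rplus_0_l.

Lemma rsum_big (f : nat -> R) N : rsum f N = \big[Rplus/0%R]_(1 <= n < N.+1) f n.
Proof.
elim: N => [|N IH]; first by rewrite big_geq.
by rewrite big_nat_recr //= IH.
Qed.

Lemma Rsum_ge0 (I : eqType) (s : seq I) (P : pred I) (F : I -> R) :
  (forall i, i \in s -> P i -> (0 <= F i)%R) -> (0 <= \big[Rplus/0%R]_(i <- s | P i) F i)%R.
Proof.
move=> H; rewrite big_seq_cond; apply: big_ind => //; first exact: Rle_refl.
  by move=> x y; apply: Rplus_le_le_0_compat.
by move=> i /andP[]; apply: H.
Qed.

Lemma Rsum_le (I : eqType) (s : seq I) (P : pred I) (F G : I -> R) :
  (forall i, i \in s -> P i -> (F i <= G i)%R) ->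
  (\big[Rplus/0%R]_(i <- s | P i) F i <= \big[Rplus/0%R]_(i <- s | P i) G i)%R.
Proof.
move=> H; rewrite big_seq_cond [X in (_ <= X)%R]big_seq_cond.
apply: (big_ind2 (fun x y => (x <= y)%R)) => //; first exact: Rle_refl.
  by move=> x1 y1 x2 y2; apply: Rplus_le_compat.
by move=> i /andP[]; apply: H.
Qed.

Lemma Rsum_distrl (I : Type) (s : seq I) (P : pred I) (F : I -> R) c :
  \big[Rplus/0%R]_(i <- s | P i) (c * F i)%R = (c * \big[Rplus/0%R]_(i <- s | P i) F i)%R.
Proof.
apply: (big_ind2 (fun x y => x = c * y)%R) => //; first by rewrite Rmult_0_r.
by move=> x1 y1 x2 y2 -> ->; rewrite Rmult_plus_distr_l.
Qed.

Lemma Rsum_sub (I : eqType) (s t : seq I) (F : I -> R) :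
  uniq s -> {subset s <= t} -> (forall i, i \in t -> (0 <= F i)%R) ->
  (\big[Rplus/0%R]_(i <- s) F i <= \big[Rplus/0%R]_(i <- t) F i)%R.
Proof.
elim: s t => [|x s IH] t /=; first by move=> _ _ H; rewrite big_nil; apply: Rsum_ge0 => i /H.
move=> /andP[xs us] st F0.
have xt : x \in t by apply: st; rewrite inE eqxx.
rewrite big_cons (perm_big _ (perm_to_rem xt)) /= big_cons.
apply: Rplus_le_compat_l; apply: IH => //.
  move=> y ys; have yt : y \in t by apply: st; rewrite inE ys orbT.
  have := perm_mem (perm_to_rem xt) y; rewrite yt inE.
  by case: eqP => [yx|_] //=; move: xs; rewrite -yx ys.
by move=> i /mem_rem; apply: F0.
Qed.

Lemma INR_sum (s : seq nat) (F : nat -> nat) :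
  INR (\sum_(i <- s) F i) = \big[Rplus/0%R]_(i <- s) INR (F i).
Proof.
elim: s => [|x s IH]; first by rewrite !big_nil.
by rewrite !big_cons -IH -plus_INR.
Qed.

Lemma divisors_perm N n : 0 < n <= N ->
  perm_eq (divisors n) [seq d <- index_iota 1 N.+1 | d %| n].
Proof.
move=> /andP[n0 nN]; apply: uniq_perm; first exact: divisors_uniq.
  by rewrite filter_uniq // iota_uniq.
move=> d; rewrite -dvdn_divisors // mem_filter mem_index_iota.
case dn: (d %| n) => //=; rewrite (dvdn_gt0 n0 dn) ltnS.
by rewrite (leq_trans (dvdn_leq n0 dn) nN).
Qed.

(** The convolution [d_(k+1) = d_k * 1] summed over [n = d m], with [m] outermost so that [d] runs
    up to [N / m]. Because [G] is arbitrary, every later induction on [k] rests on this identity. *)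
Lemma rsum_dkS k (G : nat -> R) N :
  rsum (fun n => (INR (dk k.+1 n) * G n)%R) N =
  rsum (fun m => rsum (fun d => (INR (dk k d) * G (d * m)%nat)%R) (Nat.div N m)) N.
Proof.
rewrite rsum_big.
transitivity (\big[Rplus/0%R]_(1 <= n < N.+1) \big[Rplus/0%R]_(1 <= d < N.+1 | d %| n) (INR (dk k d) * G n)%R).
  apply: eq_big_nat => n /andP[n0 nN]; rewrite dkS_sum_divisors // INR_sum.
  rewrite (perm_big _ (divisors_perm N n _)) /=; last by rewrite n0.
  rewrite big_filter Rmult_comm -Rsum_distrl; apply: eq_bigr => d _; exact: Rmult_comm.
rewrite rsum_big.
transitivity (\big[Rplus/0%R]_(1 <= d < N.+1) \big[Rplus/0%R]_(1 <= m < N.+1 | d * m <= N) (INR (dk k d) * G (d * m)%nat)%R).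
  rewrite (exchange_big_dep xpredT) //=.
  apply: eq_big_nat => d /andP[d0 dN].
  rewrite -big_filter -[RHS]big_filter.
  rewrite -[RHS](big_map (fun m => d * m) xpredT (fun n => (INR (dk k d) * G n)%R)).
  apply: perm_big; apply: uniq_perm.
  - by rewrite filter_uniq // iota_uniq.
  - rewrite map_inj_uniq; first by rewrite filter_uniq // iota_uniq.
    by move=> x y /eqP; rewrite eqn_pmul2l // => /eqP.
  move=> n; rewrite mem_filter mem_index_iota; apply/idP/mapP.
    move=> /and3P[dn n0 nN]; exists (n %/ d); last by rewrite mulnC divnK.
    rewrite mem_filter mem_index_iota mulnC divnK // -ltnS nN /=.
    by rewrite divn_gt0 // (dvdn_leq n0 dn) ltnS (leq_trans (leq_div _ _)).
  move=> [m]; rewrite mem_filter mem_index_iota => /and3P[dmN m0 mN] ->.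
  by rewrite dvdn_mulr //= muln_gt0 d0 m0 ltnS.
rewrite (exchange_big_dep xpredT) //=.
apply: eq_big_nat => m /andP[m0 mN]; rewrite rsum_big.
rewrite -big_filter; apply: perm_big; apply: uniq_perm.
- by rewrite filter_uniq // iota_uniq.
- exact: iota_uniq.
move=> d; rewrite mem_filter !mem_index_iota !ltnS.
have -> : Nat.div N m = N %/ m.
  apply/esym; apply: Nat.div_unique; last first.
    rewrite {1}(divn_eq N m) mulnC; reflexivity.
  by apply/ltP; rewrite ltn_mod.
rewrite leq_divRL //.
case: (leqP (d * m) N) => H; rewrite ?andbF //= ?andbT.
by rewrite (leq_trans _ H) ?andbT // leq_pmulr.
Qed.

(* Induction on the largest admissible prime factor. *)
Lemma rsum_euler_bound (f B : nat -> R) N :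
  (forall n, 0 < n -> (0 <= f n)%R) -> f 1 = 1%R ->
  (forall p j d, prime p -> 0 < d -> ~~ (p %| d) -> f (p ^ j * d) = (f (p ^ j)%nat * f d)%R) ->
  (forall m, 0 < m -> (0 <= B m)%R) ->
  (forall p A, prime p -> (\big[Rplus/0%R]_(0 <= a < A.+1) f (p ^ a)%nat <= exp (B p))%R) ->
  (rsum f N <= exp (rsum B N))%R.
Proof.
move=> f0 f1 fM B0 fB.
pose sm q n := all (fun p => p <= q) (primes n).
(* [sm q n] means that all prime factors of [n] are at most [q]. For [q = N] this holds for every
   [n] up to [N], so the restricted sum is the whole one. *)
suff H q : (\big[Rplus/0%R]_(1 <= n < N.+1 | sm q n) f n <= exp (rsum B q))%R.
  apply: Rle_trans (H N); rewrite rsum_big; apply: Req_le.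
  rewrite big_nat_cond [RHS]big_nat_cond; apply: eq_bigl => n.
  case nN: (1 <= n < N.+1) => //=; apply/esym/allP => p.
  rewrite mem_primes => /and3P[_ n0 pn]; apply: leq_trans (dvdn_leq n0 pn) _.
  by case/andP: nN.
elim: q => [|q IH].
  rewrite /= exp_0 -f1 -[X in (_ <= X)%R](big_seq1 Rplus).
  rewrite -big_filter; apply: Rsum_sub.
  - by rewrite filter_uniq // iota_uniq.
  - move=> n; rewrite mem_filter mem_index_iota inE => /and3P[sn n0 _].
    rewrite eqn_leq n0 andbT leqNgt; apply/negP => n1.
    have pp := pdiv_prime n1.
    have pn : pdiv n \in primes n by rewrite mem_primes pp n0 pdiv_dvd.
    by move: (allP sn _ pn) pp; rewrite leqn0 => /eqP ->.
  - by move=> n; rewrite inE => /eqP ->; apply: f0.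
rewrite /= exp_plus Rmult_comm.
(* If [q + 1] is composite or 1, the set of smooth numbers does not change and the new factor
   [exp (B (q + 1))] is at least 1. *)
case pp: (prime q.+1); last first.
  apply: Rle_trans (_ : (1 * exp (rsum B q) <= _)%R); last first.
    apply: Rmult_le_compat_r; first exact: Rlt_le (exp_pos _).
    rewrite -exp_0; case: (Rle_lt_or_eq_dec _ _ (B0 q.+1 isT)) => [lt|<-]; last exact: Rle_refl.
    exact: Rlt_le (exp_increasing _ _ lt).
  rewrite Rmult_1_l; apply: Rle_trans IH; apply: Req_le; apply: eq_bigl => n.
  apply: eq_in_all => p; rewrite mem_primes => /and3P[pr _ _].
  rewrite leq_eqVlt ltnS; case: eqP => // pq; move: pr; by rewrite pq pp.
set p := q.+1 in pp *.
(* Classes by the exponent [a] of [p], which is at most [N]: division by [p ^ a] maps each class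
   injectively into the [q]-smooth numbers up to [N]. *)
rewrite (partition_big (fun n : nat => inord (logn p n) : 'I_N.+1) xpredT) //=.
apply: Rle_trans (_ : (\big[Rplus/0%R]_(0 <= a < N.+1) (f (p ^ a)%nat * exp (rsum B q)) <= _)%R); last first.
  rewrite (eq_bigr (fun a => exp (rsum B q) * f (p ^ a)%nat)%R); last by move=> a _; rewrite Rmult_comm.
  rewrite Rsum_distrl Rmult_comm; apply: Rmult_le_compat_r; first exact: Rlt_le (exp_pos _).
  exact: fB.
rewrite big_mkord; apply: Rsum_le => a _ _.
apply: Rle_trans (Rmult_le_compat_l _ _ _ (f0 _ _) IH); last by rewrite expn_gt0.
rewrite -Rsum_distrl -big_filter -[X in (_ <= X)%R]big_filter.
set s := filter _ _.
have sP n : n \in s -> [/\ 0 < n, n <= N, sm p n & logn p n = a].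
  rewrite mem_filter mem_index_iota ltnS => /and3P[/andP[sn /eqP La] n0 nN]; split => //.
  by rewrite -La inordK // ltnS; apply: ltnW; apply: leq_trans (ltn_logl p n0) nN.
have px x : 0 < p ^ x by rewrite expn_gt0.
have sE n : n \in s -> [/\ n = p ^ a * (n %/ p ^ a), 0 < n %/ p ^ a & ~~ (p %| n %/ p ^ a)].
  move=> /sP[n0 _ _ La].
  have an : p ^ a %| n by rewrite pfactor_dvdn // La.
  have nE : n = p ^ a * (n %/ p ^ a) by rewrite mulnC divnK.
  have q0 : 0 < n %/ p ^ a by rewrite divn_gt0 // dvdn_leq.
  split => //; apply/negP => pd.
  have : 0 < logn p (n %/ p ^ a) by rewrite logn_gt0 mem_primes pp q0 pd.
  move: La; rewrite {1}nE lognM // pfactorK //.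
  by case: (logn p (n %/ p ^ a)) => // x /eqP; rewrite -{2}[nat_of_ord a]addn0 eqn_add2l.
rewrite (eq_big_seq (fun n => f (p ^ a)%nat * f (n %/ p ^ a))%R); last first.
  by move=> n /sE[nE q0 pq]; rewrite {1}nE fM.
rewrite -(big_map (fun n => n %/ p ^ a) xpredT (fun d => f (p ^ a)%nat * f d)%R).
apply: Rsum_sub.
- rewrite map_inj_in_uniq ?filter_uniq ?iota_uniq //.
  by move=> x y /sE[xE _ _] /sE[yE _ _] E; rewrite xE yE E.
- move=> d /mapP[n ns ->]; have [n0 nN sn _] := sP n ns; have [nE q0 pq] := sE n ns.
  rewrite mem_filter mem_index_iota q0 ltnS (leq_trans (leq_div _ _) nN) !andbT.
  apply/allP => r; rewrite mem_primes => /and3P[rp _ rd].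
  have : r <= p.
    apply: (allP sn); rewrite mem_primes rp n0 nE; exact: dvdn_mull.
  rewrite leq_eqVlt ltnS => /orP[/eqP rE|//].
  by move: pq rd; rewrite rE => /negP.
- move=> d; rewrite mem_filter mem_index_iota => /and3P[_ d0 _].
  by apply: Rmult_le_pos; apply: f0.
Qed.

(** * Local factors at a prime *)

Lemma bin_diag_shift k a : 0 < k ->
  a.+1 * 'C(k + a.+1 - 1, a.+1) = (k + a) * 'C(k + a - 1, a).
Proof. by case: k => // k _; rewrite addnS !addSn !subn1 /= mul_bin_diag. Qed.

(** Both sides are 1 at [a = 0], and ratios of consecutive terms compare:
    [(k + a)^2 <= (a + 1) (k^2 + a)], the difference being [a (k - 1)^2]. On prime powers this says
    [d_k^2 <= d_(k^2)]. *)
Lemma bin_sqr_le k a : 0 < k -> 'C(k + a - 1, a) ^ 2 <= 'C(k * k + a - 1, a).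
Proof.
move=> k0; elim: a => [|a IH]; first by rewrite !bin0.
have kk0 : 0 < k * k by rewrite muln_gt0 k0.
rewrite -(leq_pmul2l (_ : 0 < a.+1 ^ 2)) // -expnMn bin_diag_shift //.
rewrite [a.+1 ^ 2]expnS expn1 -mulnA bin_diag_shift // expnMn mulnA.
apply: leq_mul => //.
case: k {IH kk0} k0 => // k _.
rewrite (_ : a.+1 * (k.+1 * k.+1 + a) = (k.+1 + a) ^ 2 + a * (k * k)) ?leq_addr //.
rewrite expnS expn1 -?plusE -?multE; ring.
Qed.

(** The full series is [(1 - y)^(-k)]. By Pascal's rule the truncated sum [S] for [k + 1] is at most
    the one for [k] plus [y S], and solving for [S] produces the next factor [1 / (1 - y)]. *)
Lemma bin_series_le k A y : (0 <= y < 1)%R ->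
  (\big[Rplus/0%R]_(0 <= a < A.+1) (INR 'C(k + a - 1, a) * y ^ a) <= (/ (1 - y)) ^ k)%R.
Proof.
move=> [y0 y1]; elim: k A => [|k IH] A.
  rewrite big_nat_recl //= big1_seq; first by rewrite Rplus_0_r !Rmult_1_r; apply: Rle_refl.
  by move=> a _; rewrite add0n subn1 bin_small //= Rmult_0_l.
set S := (X in (X <= _)%R).
have SA : (S <= (/ (1 - y)) ^ k + y * S)%R.
  apply: Rle_trans (Rplus_le_compat_r _ _ _ (IH A)).
  rewrite /S -Rsum_distrl.
  rewrite big_nat_recl //= [X in (_ <= X + _)%R]big_nat_recl //= !bin0.
  rewrite [X in (_ <= _ + X)%R]big_nat_recr //=.
  set r := (X in (_ <= _ + (_ + X))%R).
  have r0 : (0 <= r)%R.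
    rewrite /r; repeat apply: Rmult_le_pos => //; [exact: pos_INR|exact: pow_le].
  have -> : \big[Rplus/0%R]_(0 <= i < A) (INR 'C(k.+1 + i.+1 - 1, i.+1) * (y * y ^ i))%R =
    (\big[Rplus/0%R]_(0 <= i < A) (INR 'C(k + i.+1 - 1, i.+1) * (y * y ^ i)) +
     \big[Rplus/0%R]_(0 <= i < A) (y * (INR 'C(k.+1 + i - 1, i) * y ^ i)))%R.
    rewrite -big_split /=; apply: eq_bigr => i _.
    rewrite addSn addnS !addSn !subn1 /= binS plus_INR; ring.
  lra.
have -> : ((/ (1 - y)) ^ k.+1 = (/ (1 - y)) ^ k / (1 - y))%R by rewrite /= /Rdiv Rmult_comm.
apply: (Rmult_le_reg_r (1 - y)%R); first lra.
rewrite /Rdiv Rmult_assoc Rinv_l; lra.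
Qed.

Open Scope R_scope.

Lemma INR_expn p a : INR (p ^ a) = INR p ^ a.
Proof. by elim: a => [|a IH] //=; rewrite expnS mult_INR IH. Qed.

Lemma Rpower_pow_l x a y : 0 < x -> Rpower (x ^ a) y = Rpower x y ^ a.
Proof.
move=> x0; rewrite -!Rpower_pow //; last exact: exp_pos.
by rewrite !Rpower_mult Rmult_comm.
Qed.

Lemma Rpower_pos x y : 0 < Rpower x y.
Proof. exact: exp_pos. Qed.

Lemma dk_prime_pow k p a : prime p -> dk k (p ^ a) = 'C(k + a - 1, a).
Proof.
move=> pp; rewrite -[(p ^ a)%nat]muln1 dk_pfactor_mul //; last first.
  by rewrite dvdn1; case: eqP pp => // ->.
by rewrite /dk big_nil muln1.
Qed.

Lemma inv_one_minus_le y : 0 <= y < 1 -> / (1 - y) <= exp (y / (1 - y)).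
Proof.
move=> [y0 y1]; apply: Rle_trans (exp_ineq1_le _).
apply: Req_le; field; lra.
Qed.

Lemma exp_le x y : x <= y -> exp x <= exp y.
Proof. case=> [/exp_increasing|->]; lra. Qed.

Lemma pow_exp x n : exp x ^ n = exp (INR n * x).
Proof.
elim: n => [|n IH]; first by rewrite /= Rmult_0_l exp_0.
by rewrite S_INR /= IH -exp_plus; congr exp; ring.
Qed.

Lemma Rsum_sqr_le (I : eqType) (s : seq I) (F : I -> R) :
  (forall i, i \in s -> 0 <= F i) ->
  \big[Rplus/0]_(i <- s) (F i ^ 2) <= (\big[Rplus/0]_(i <- s) F i) ^ 2.
Proof.
elim: s => [|x s IH] H; first by rewrite !big_nil; lra.
rewrite !big_cons.
have Fx : 0 <= F x by apply: H; rewrite inE eqxx.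
have Hs i : i \in s -> 0 <= F i by move=> si; apply: H; rewrite inE si orbT.
have S0 : 0 <= \big[Rplus/0]_(i <- s) F i by apply: Rsum_ge0 => i /Hs.
have := IH Hs; nra.
Qed.

Definition dksq (k : nat) (s : R) (n : nat) : R := INR (dk k n) ^ 2 / Rpower (INR n) (2 * s).

Lemma dksq_ge0 k s n : 0 <= dksq k s n.
Proof.
apply: Rmult_le_pos; first exact: pow2_ge_0.
exact: Rlt_le (Rinv_0_lt_compat _ (Rpower_pos _ _)).
Qed.

Lemma dk_1 k : dk k 1 = 1%nat.
Proof. by rewrite /dk big_nil. Qed.

Lemma dksq_1 k s : dksq k s 1 = 1.
Proof. by rewrite /dksq dk_1 /= /Rpower ln_1 Rmult_0_r exp_0; field. Qed.

(** Two bounds for the local factor at [p], with [y = p^(-s)]. The sum of squares is at most the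
    square [(1 - y)^(-2k)], which is linear in [k] in the exponent and good for small [p]; and
    [d_k^2 <= d_(k^2)] gives [(1 - y^2)^(-k^2)], which is quadratic in [k] but decays like
    [p^(-2s)]. Summing the exponent over all integers [m] instead of primes makes prime counting
    unnecessary. *)
Lemma dksq_euler k s N : (0 < k)%nat -> 1 / 2 < s < 1 ->
  rsum (dksq k s) N <=
  exp (rsum (fun m => Rmin (7 * INR k * Rpower (INR m) (- s))
                         (2 * INR k ^ 2 * Rpower (INR m) (- (2 * s)))) N).
Proof.
move=> k0 hs; have K0 : 0 <= INR k by apply: pos_INR.
apply: rsum_euler_bound.
- by move=> n _; apply: dksq_ge0.
- exact: dksq_1.
- move=> p j d pp d0 pd; rewrite /dksq dk_pfactor_mul // dk_prime_pow // !mult_INR.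
  have E1 := Rpower_pos (INR d) (2 * s).
  have E2 := Rpower_pos (INR (p ^ j)) (2 * s).
  have D0 : 0 < INR d by apply: lt_0_INR; apply/ltP.
  have P0 : 0 < INR (p ^ j) by apply: lt_0_INR; apply/ltP; rewrite expn_gt0 prime_gt0.
  rewrite -Rpower_mult_distr //.
  field; lra.
- move=> m _; apply: Rmin_case; repeat apply: Rmult_le_pos => //; try lra; try exact: Rlt_le (Rpower_pos _ _); exact: pow2_ge_0.
move=> p A pp.
have p2 : 2 <= INR p by apply: (le_INR 2); apply/leP; apply: prime_gt1.
set y := Rpower (INR p) (- s).
have y0 : 0 < y by apply: Rpower_pos.
have yy : Rpower (INR p) (- (2 * s)) = y ^ 2.
  by rewrite -Rpower_pow // /y Rpower_mult; congr Rpower; rewrite /=; ring.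
have y2 : y ^ 2 <= / 2.
  rewrite -yy Rpower_Ropp; apply: Rinv_le_contravar; first lra.
  apply: Rle_trans (_ : Rpower (INR p) 1 <= _); first by rewrite Rpower_1; lra.
  apply: Rle_Rpower; lra.
(* [25 / 49] exceeds [1 / 2]. With this, [y / (1 - y) <= 7 y / 2], and the exponent [2k] turns it
   into the constant 7. *)
have y57 : y <= 5 / 7 by nra.
rewrite (eq_bigr (fun a => (INR 'C(k + a - 1, a) * y ^ a) ^ 2)); last first.
  move=> a _; rewrite /dksq dk_prime_pow // INR_expn Rpower_pow_l; last lra.
  rewrite Rpow_mult_distr -Rpow_mult_distr; rewrite Rpow_mult_distr /Rdiv; congr (_ * _).
  rewrite -[(y ^ a) ^ 2]pow_mult Nat.mul_comm pow_mult -yy Rpower_Ropp.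
  by rewrite pow_inv.
apply: (Rmin_case _ _ (fun x => _ <= exp x)).
- apply: Rle_trans (Rsum_sqr_le _ _ _ _) _.
    move=> i _; apply: Rmult_le_pos; [exact: pos_INR|apply: pow_le; lra].
  have H := bin_series_le k A y (conj (Rlt_le _ _ y0) (Rle_lt_trans _ _ _ y57 _)).
  apply: Rle_trans (pow_incr _ _ 2 (conj _ (H _))) _; try lra.
    apply: Rsum_ge0 => i _ _; apply: Rmult_le_pos; [exact: pos_INR|apply: pow_le; lra].
  rewrite -pow_mult.
  apply: Rle_trans (pow_incr _ _ _ (conj _ (inv_one_minus_le _ _))) _; try lra.
    apply: Rlt_le; apply: Rinv_0_lt_compat; lra.
  rewrite pow_exp; apply: exp_le; rewrite mult_INR /=.
  have : y / (1 - y) <= 7 / 2 * y.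
    apply: (Rmult_le_reg_r (1 - y)); first lra.
    rewrite /Rdiv (Rmult_assoc y) Rinv_l; nra.
  nra.
- apply: Rle_trans (_ : \big[Rplus/0]_(0 <= a < A.+1) (INR 'C(k * k + a - 1, a) * (y ^ 2) ^ a) <= _).
    apply: Rsum_le => a _ _; rewrite Rpow_mult_distr -!pow_mult (Nat.mul_comm a).
    apply: Rmult_le_compat_r; first by apply: pow_le; lra.
    by rewrite -INR_expn; apply: le_INR; apply/leP; apply: bin_sqr_le.
  have H : 0 <= y ^ 2 < 1 by split; [apply: pow2_ge_0|lra].
  apply: Rle_trans (bin_series_le _ _ _ H) _.
  apply: Rle_trans (pow_incr _ _ _ (conj _ (inv_one_minus_le _ H))) _.
    apply: Rlt_le; apply: Rinv_0_lt_compat; lra.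
  rewrite pow_exp yy; apply: exp_le; rewrite mult_INR.
  have : y ^ 2 / (1 - y ^ 2) <= 2 * y ^ 2.
    apply: (Rmult_le_reg_r (1 - y ^ 2)); first lra.
    rewrite /Rdiv (Rmult_assoc (y ^ 2)) Rinv_l; nra.
  have : 0 <= INR k * INR k by nra.
  rewrite /=; nra.
Qed.

Lemma rsum_le f g N : (forall n, (0 < n)%coq_nat /\ (n <= N)%coq_nat -> f n <= g n) -> rsum f N <= rsum g N.
Proof.
elim: N => [|N IH] H /=; first lra.
apply: Rplus_le_compat; [apply: IH => n Hn; apply: H|apply: H]; lia.
Qed.

(** [d_0] is the unit of Dirichlet convolution: a prime with exponent [a >= 1] contributes
    [C(a - 1, a) = 0]. It starts the inductions on [k]. *)
Lemma dk_0 n : (1 < n)%coq_nat -> dk 0 n = 0%nat.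
Proof.
move=> /ltP n1.
have pn : pdiv n \in primes n by rewrite mem_primes pdiv_prime // (ltnW n1) pdiv_dvd.
rewrite /dk (big_rem _ pn) /= add0n bin_small ?mul0n //.
by rewrite subn1 prednK // logn_gt0.
Qed.

End DivisorSums.
Import DivisorSums.

(** * Growth of the series of squared coefficients *)

Lemma Rpower_mvt (x e : R) : 0 < x ->
  exists xi, x < xi < x + 1 /\ Rpower (x + 1) e - Rpower x e = e * Rpower xi (e - 1).
Proof.
intros Hx.
destruct (MVT_cor2 (fun z => Rpower z e) (fun z => e * Rpower z (e - 1)) x (x + 1)) as [c [H1 H2]].
- lra.
- intros c Hc. apply derivable_pt_lim_power; lra.
- exists c; split; [lra|]. rewrite H1. ring.
Qed.

Lemma Rpower_le_base_neg x y e : 0 < x <= y -> e <= 0 -> Rpower y e <= Rpower x e.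
Proof.
intros H He. unfold Rpower. apply exp_le.
assert (ln x <= ln y) by (apply ln_le; lra). nra.
Qed.

Lemma Rpower_le_base_pos x y e : 0 < x <= y -> 0 <= e -> Rpower x e <= Rpower y e.
Proof.
intros H He. unfold Rpower. apply exp_le.
assert (ln x <= ln y) by (apply ln_le; lra). nra.
Qed.

Lemma rsumS f N : rsum f (S N) = rsum f N + f (S N).
Proof. reflexivity. Qed.

(** Integral comparison in telescoping form: by the mean value theorem each term is at most an
    increment of [x^(1 - s) / (1 - s)]. *)
Lemma rsum_Rpower_le s M : 0 < s < 1 -> (1 <= M)%nat ->
  rsum (fun m => Rpower (INR m) (- s)) M <= Rpower (INR M) (1 - s) / (1 - s).
Proof.
intros Hs HM. induction M as [|M IH]; [lia|].
destruct M as [|M].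
- simpl. unfold Rpower. rewrite ln_1, !Rmult_0_r, exp_0.
  apply (Rmult_le_reg_r (1 - s)); [lra|]. field_simplify; lra.
- assert (IH' := IH ltac:(lia)). clear IH.
  change (rsum (fun m => Rpower (INR m) (- s)) (S (S M))) with
    (rsum (fun m => Rpower (INR m) (- s)) (S M) + Rpower (INR (S (S M))) (- s)).
  assert (Hp : 0 < INR (S M)) by (apply lt_0_INR; lia).
  destruct (Rpower_mvt (INR (S M)) (1 - s) Hp) as [xi [Hx E]].
  rewrite (S_INR (S M)) in *.
  assert (Rpower (INR (S M) + 1) (- s) <= Rpower xi (1 - s - 1)).
  { replace (1 - s - 1) with (- s) by ring. apply Rpower_le_base_neg; lra. }
  assert (E2 : Rpower (INR (S M) + 1) (1 - s) / (1 - s) - Rpower (INR (S M)) (1 - s) / (1 - s)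
    = Rpower xi (1 - s - 1)).
  { unfold Rdiv. rewrite <- Rmult_minus_distr_r, E. field. lra. }
  lra.
Qed.

Lemma rsum_Rpower_tail_le s M j : 1 / 2 < s -> (1 <= M)%nat ->
  rsum (fun m => Rpower (INR m) (- (2 * s))) (M + j) - rsum (fun m => Rpower (INR m) (- (2 * s))) M
  <= (Rpower (INR M) (1 - 2 * s) - Rpower (INR (M + j)) (1 - 2 * s)) / (2 * s - 1).
Proof.
intros Hs HM. induction j as [|j IH].
- rewrite Nat.add_0_r. unfold Rdiv. rewrite Rminus_diag, Rminus_diag. lra.
- rewrite Nat.add_succ_r, !rsumS.
  assert (Hp : 0 < INR (M + j)) by (apply lt_0_INR; lia).
  destruct (Rpower_mvt (INR (M + j)) (1 - 2 * s) Hp) as [xi [Hx E]].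
  rewrite (S_INR (M + j)) in *.
  assert (Rpower (INR (M + j) + 1) (- (2 * s)) <= Rpower xi (1 - 2 * s - 1)).
  { replace (1 - 2 * s - 1) with (- (2 * s)) by ring. apply Rpower_le_base_neg; lra. }
  assert (E2 : (Rpower (INR M) (1 - 2 * s) - Rpower (INR (M + j) + 1) (1 - 2 * s)) / (2 * s - 1)
   = (Rpower (INR M) (1 - 2 * s) - Rpower (INR (M + j)) (1 - 2 * s)) / (2 * s - 1)
     + Rpower xi (1 - 2 * s - 1)).
  { replace (Rpower (INR (M + j) + 1) (1 - 2 * s)) with
     (Rpower (INR (M + j)) (1 - 2 * s) + (1 - 2 * s) * Rpower xi (1 - 2 * s - 1)) by lra.
    field. lra. }
  lra.
Qed.

Lemma rsum_mono f M j : (forall n, (1 <= n)%nat -> 0 <= f n) -> rsum f M <= rsum f (M + j).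
Proof.
intros H. induction j as [|j IH].
- rewrite Nat.add_0_r. lra.
- rewrite Nat.add_succ_r. simpl. assert (Hs := H (S (M + j)) ltac:(lia)). lra.
Qed.

Lemma rsum_scal c f N : rsum (fun n => c * f n) N = c * rsum f N.
Proof. induction N as [|N IH]; simpl; [|rewrite IH]; ring. Qed.

Lemma rsum_ext f g N : (forall n, (1 <= n <= N)%nat -> f n = g n) -> rsum f N = rsum g N.
Proof.
intros H. induction N as [|N IH]; simpl; [reflexivity|].
rewrite IH, H; [reflexivity|lia|intros n Hn; apply H; lia].
Qed.

Lemma rsum_le_incr f g M j : (forall n, (M < n)%nat -> f n <= g n) ->
  rsum f (M + j) - rsum f M <= rsum g (M + j) - rsum g M.
Proof.
intros H. induction j as [|j IH].
- rewrite Nat.add_0_r. lra.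
- rewrite Nat.add_succ_r. simpl. assert (Hs := H (S (M + j)) ltac:(lia)). lra.
Qed.

Lemma dksq_sum_le k s N : (1 <= k)%nat -> 1 / 2 < s < 1 ->
  rsum (dksq k s) N <= exp ((7 / (1 - s) + 4 / (2 * s - 1)) * Rpower (INR k) (/ s)).
Proof.
intros Hk Hs.
eapply Rle_trans; [apply dksq_euler; [apply ssrbool.introT with (1:=ssrnat.leP); lia|lra]|].
apply exp_le.
set (g := fun m : nat => Rmin _ _).
set (y := Rpower (INR k) (/ s)).
assert (K1 : 1 <= INR k) by (apply (le_INR 1); lia).
assert (y1 : 1 <= y).
{ unfold y. rewrite <- (Rpower_O (INR k)) by lra. apply Rle_Rpower; [lra|].
  apply Rlt_le, Rinv_0_lt_compat; lra. }
assert (Ek : INR k = Rpower y s).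
{ unfold y. rewrite Rpower_mult, Rinv_l, Rpower_1; lra. }
assert (g0 : forall n, (1 <= n)%nat -> 0 <= g n).
{ intros n _. unfold g. apply Rmin_case; repeat apply Rmult_le_pos; try lra;
  try (apply Rlt_le, Rpower_pos); apply pow2_ge_0. }
(* At [y = k^(1/s)] the two local bounds balance: since [k = y^s], both [k y^(1 - s)] and
   [k^2 y^(1 - 2s)] equal [y]. *)
destruct (nfloor_ex y) as [M [HM1 HM2]]; [lra|].
assert (HM : (1 <= M)%nat).
{ apply INR_le. simpl. destruct M as [|M]; [simpl in HM2; lra|]. rewrite S_INR. pose proof (pos_INR M). lra. }
assert (Mpos : 1 <= INR M) by (apply (le_INR 1); lia).
assert (A : rsum g M <= 7 / (1 - s) * y).
{ eapply Rle_trans; [apply rsum_le with (g := fun m => 7 * INR k * Rpower (INR m) (- s))|].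
  - intros n _. apply Rmin_l.
  - rewrite rsum_scal.
    eapply Rle_trans; [apply Rmult_le_compat_l; [nra|apply rsum_Rpower_le; [lra|exact HM]]|].
    assert (Rpower (INR M) (1 - s) <= Rpower y (1 - s)) by (apply Rpower_le_base_pos; lra).
    assert (Ey : INR k * Rpower y (1 - s) = y).
    { rewrite Ek, <- Rpower_plus. replace (s + (1 - s)) with 1 by ring. apply Rpower_1; lra. }
    replace (7 / (1 - s) * y) with (7 / (1 - s) * (INR k * Rpower y (1 - s))) by (rewrite Ey; ring).
    assert (0 < / (1 - s)) by (apply Rinv_0_lt_compat; lra).
    unfold Rdiv.
    apply Rle_trans with ((7 * INR k * / (1 - s)) * Rpower (INR M) (1 - s)); [right; ring|].
    apply Rle_trans with ((7 * INR k * / (1 - s)) * Rpower y (1 - s)); [|right; ring].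
    apply Rmult_le_compat_l; [|assumption].
    apply Rmult_le_pos; lra. }
assert (i2 : 0 < / (2 * s - 1)) by (apply Rinv_0_lt_compat; lra).
destruct (Nat.le_gt_cases N M) as [HNM|HNM].
- replace M with (N + (M - N))%nat in A by lia.
  pose proof (rsum_mono g N (M - N) g0). unfold Rdiv at 2. nra.
- replace N with (M + (N - M))%nat by lia. set (j := (N - M)%nat).
  assert (Hi := rsum_le_incr g (fun m => 2 * INR k ^ 2 * Rpower (INR m) (- (2 * s))) M j).
  rewrite !rsum_scal in Hi.
  assert (Ht := rsum_Rpower_tail_le s M j ltac:(lra) HM).
  assert (Hi' := Hi ltac:(intros n _; apply Rmin_r)). clear Hi.
  (* [M >= y / 2] because [M >= 1] and [M + 1 > y]. Rounding down thus costs [2^(2s - 1) <= 2],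
     which turns the constant 2 of the tail into 4. *)
  assert (Rpower (INR M) (1 - 2 * s) <= 2 * Rpower y (1 - 2 * s)).
  { apply Rle_trans with (Rpower (y / 2) (1 - 2 * s)).
    - apply Rpower_le_base_neg; lra.
    - unfold Rdiv. rewrite <- Rpower_mult_distr by lra.
      rewrite Rmult_comm. apply Rmult_le_compat_r; [apply Rlt_le, Rpower_pos|].
      replace (/ 2) with (Rpower 2 (-(1))) by (rewrite Rpower_Ropp, Rpower_1; lra).
      rewrite Rpower_mult. apply Rle_trans with (Rpower 2 1); [apply Rle_Rpower; lra|rewrite Rpower_1; lra]. }
  assert (Ey : INR k ^ 2 * Rpower y (1 - 2 * s) = y).
  { rewrite Ek, <- Rpower_pow by apply Rpower_pos. rewrite Rpower_mult, <- Rpower_plus.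
    replace (s * INR 2 + (1 - 2 * s)) with 1 by (simpl; ring). apply Rpower_1; lra. }
  assert (P2 := Rpower_pos (INR (M + j)) (1 - 2 * s)).
  set (a := Rpower (INR M) (1 - 2 * s)) in *. set (b := Rpower (INR (M + j)) (1 - 2 * s)) in *.
  set (u := Rpower y (1 - 2 * s)) in *.
  set (D := rsum _ (M + j) - _) in Ht.
  assert (D <= 2 * u * / (2 * s - 1)).
  { eapply Rle_trans; [exact Ht|]. unfold Rdiv. apply Rmult_le_compat_r; lra. }
  assert (k2 : 0 <= INR k ^ 2) by apply pow2_ge_0.
  assert (2 * INR k ^ 2 * D <= 4 / (2 * s - 1) * y).
  { rewrite <- Ey. apply Rle_trans with (2 * INR k ^ 2 * (2 * u * / (2 * s - 1))).
    - apply Rmult_le_compat_l; lra.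
    - right. unfold Rdiv. ring. }
  unfold D in *. lra.
Qed.

(** [Series] has a default value on divergent series, so convergence, here from monotonicity and
    [dksq_sum_le], has to be shown before [Dsum] carries any information. *)
Lemma dksq_series k s : (1 <= k)%nat -> 1 / 2 < s < 1 ->
  is_lim_seq (rsum (dksq k s)) (Dsum k s).
Proof.
intros Hk Hs.
assert (E : forall n, sum_n (fun n => dksq k s (S n)) n = rsum (dksq k s) (S n)).
{ induction n as [|n IH].
  - rewrite sum_O. simpl. ring.
  - rewrite sum_Sn, IH. reflexivity. }
assert (G : ex_finite_lim_seq (rsum (dksq k s))).
{ apply ex_finite_lim_seq_incr with (exp ((7 / (1 - s) + 4 / (2 * s - 1)) * Rpower (INR k) (/ s))).
  - intros n. rewrite rsumS. pose proof (dksq_ge0 k s (S n)). lra.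
  - intros n. apply dksq_sum_le; assumption. }
destruct G as [l Hl].
replace (Dsum k s) with l; [exact Hl|].
symmetry. apply is_series_unique.
change (is_lim_seq (sum_n (fun n => dksq k s (S n))) l).
apply is_lim_seq_ext with (fun n => rsum (dksq k s) (S n)).
- intros n. symmetry. apply E.
- apply (is_lim_seq_incr_1 (rsum (dksq k s))). exact Hl.
Qed.

Lemma rsum_dksq_le_Dsum k s N : (1 <= k)%nat -> 1 / 2 < s < 1 -> rsum (dksq k s) N <= Dsum k s.
Proof.
intros Hk Hs. apply (is_lim_seq_incr_compare (rsum (dksq k s))).
- apply dksq_series; assumption.
- intros n. rewrite rsumS. pose proof (dksq_ge0 k s (S n)). lra.
Qed.

Lemma Dsum_ge1 k s : (1 <= k)%nat -> 1 / 2 < s < 1 -> 1 <= Dsum k s.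
Proof.
intros Hk Hs. apply Rle_trans with (rsum (dksq k s) 1).
- rewrite rsumS, dksq_1. simpl. lra.
- apply rsum_dksq_le_Dsum; assumption.
Qed.

Lemma Dsum_le k s : (1 <= k)%nat -> 1 / 2 < s < 1 ->
  Dsum k s <= exp ((7 / (1 - s) + 4 / (2 * s - 1)) * Rpower (INR k) (/ s)).
Proof.
intros Hk Hs.
assert (H := is_lim_seq_le (rsum (dksq k s)) (fun _ => exp ((7 / (1 - s) + 4 / (2 * s - 1)) * Rpower (INR k) (/ s))) _ _
  (fun n => dksq_sum_le k s n Hk Hs) (dksq_series k s Hk Hs) (is_lim_seq_const _)).
exact H.
Qed.

Lemma dksq_shift k s eta n : (1 <= n)%nat ->
  dksq k s n = Rpower (INR n) (- (2 * eta)) * dksq k (s - eta) n.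
Proof.
intros Hn. unfold dksq.
replace (2 * s) with (2 * (s - eta) + 2 * eta) by ring.
rewrite Rpower_plus, Rpower_Ropp. field. split; apply Rgt_not_eq, Rpower_pos.
Qed.

(* Rankin's trick. *)
Lemma Dsum_tail_le k s eta N : (1 <= k)%nat -> (1 <= N)%nat -> 0 <= eta -> 1 / 2 < s - eta -> s < 1 ->
  Dsum k s - rsum (dksq k s) N <=
  Rpower (INR N) (- (2 * eta)) * Dsum k (s - eta).
Proof.
intros Hk HN He H1 H2.
assert (Hj : forall j, rsum (dksq k s) (N + j) - rsum (dksq k s) N <=
  Rpower (INR N) (- (2 * eta)) * Dsum k (s - eta)).
{ intros j.
  set (c := Rpower (INR N) (- (2 * eta))).
  assert (Hi := rsum_le_incr (dksq k s) (fun n => c * dksq k (s - eta) n) N j).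
  rewrite !rsum_scal in Hi.
  assert (Hi' : forall n, (N < n)%nat -> dksq k s n <= c * dksq k (s - eta) n).
  { intros n Hn. rewrite (dksq_shift k s eta n) by lia.
    apply Rmult_le_compat_r; [apply dksq_ge0|].
    apply Rpower_le_base_neg; [|lra]. split; [apply lt_0_INR; lia|apply le_INR; lia]. }
  specialize (Hi Hi').
  assert (0 <= rsum (dksq k (s - eta)) N).
  { pose proof (rsum_mono (dksq k (s - eta)) 0 N (fun n _ => dksq_ge0 _ _ n)). simpl in H. lra. }
  pose proof (rsum_dksq_le_Dsum k (s - eta) (N + j) Hk ltac:(lra)).
  assert (0 < c) by apply Rpower_pos. nra. }
set (c := Rpower _ _ * _) in *.
assert (H : Rbar_le (Dsum k s) (c + rsum (dksq k s) N)).
{ apply (is_lim_seq_le (fun j => rsum (dksq k s) (j + N)) (fun _ => c + rsum (dksq k s) N)).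
  - intros j. specialize (Hj j). rewrite Nat.add_comm. lra.
  - apply (is_lim_seq_incr_n (rsum (dksq k s)) N). apply dksq_series; [assumption|lra].
  - apply is_lim_seq_const. }
simpl in H. lra.
Qed.

(** * Complex sums and the Dirichlet series of the powers of zeta *)

Fixpoint csum (f : nat -> C) (N : nat) : C :=
  match N with O => RtoC 0 | S m => Cplus (csum f m) (f (S m)) end.

Lemma csumS f N : csum f (S N) = (csum f N + f (S N))%C.
Proof. reflexivity. Qed.

Lemma csum_ext f g N : (forall n, (1 <= n <= N)%nat -> f n = g n) -> csum f N = csum g N.
Proof.
intros H. induction N as [|N IH]; [reflexivity|].
rewrite !csumS, IH, H; [reflexivity|lia|intros n Hn; apply H; lia].
Qed.

Lemma csum_pair f N : csum f N = (rsum (fun n => fst (f n)) N, rsum (fun n => snd (f n)) N).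
Proof.
induction N as [|N IH]; [reflexivity|].
rewrite csumS, IH. unfold Cplus. simpl. reflexivity.
Qed.

Lemma csum_scal c f N : csum (fun n => c * f n)%C N = (c * csum f N)%C.
Proof. induction N as [|N IH]; simpl; [|rewrite IH]; ring. Qed.

Lemma csum_plus f g N : csum (fun n => f n + g n)%C N = (csum f N + csum g N)%C.
Proof. induction N as [|N IH]; simpl; [|rewrite IH]; ring. Qed.

Lemma csum_minus f g N : csum (fun n => f n - g n)%C N = (csum f N - csum g N)%C.
Proof. induction N as [|N IH]; simpl; [|rewrite IH]; ring. Qed.

Lemma Cmod_csum_le f N : Cmod (csum f N) <= rsum (fun n => Cmod (f n)) N.
Proof.
induction N as [|N IH].
- simpl. rewrite Cmod_0. lra.
- rewrite csumS, rsumS. eapply Rle_trans; [apply Cmod_triangle|]. lra.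
Qed.

Lemma csum_dkS k (G : nat -> C) N :
  csum (fun n => RtoC (INR (dk (S k) n)) * G n)%C N =
  csum (fun m => csum (fun d => RtoC (INR (dk k d)) * G (d * m)%nat)%C (N / m)) N.
Proof.
rewrite !csum_pair. f_equal.
- rewrite (rsum_ext _ (fun n => INR (dk (S k) n) * fst (G n))) by (intros; simpl; ring).
  rewrite rsum_dkS. apply rsum_ext. intros m _. rewrite csum_pair. simpl.
  apply rsum_ext. intros d _. unfold ssrnat.muln. simpl. ring.
- rewrite (rsum_ext _ (fun n => INR (dk (S k) n) * snd (G n))) by (intros; simpl; ring).
  rewrite rsum_dkS. apply rsum_ext. intros m _. rewrite csum_pair. simpl.
  apply rsum_ext. intros d _. unfold ssrnat.muln. simpl. ring.
Qed.

Lemma Cmod_cpow x w : Cmod (cpow x w) = Rpower x (fst w).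
Proof.
unfold Cmod, cpow, Rpower. simpl.
set (e := exp _). set (a := snd w * ln x).
replace (e * cos a * (e * cos a * 1) + e * sin a * (e * sin a * 1))
  with (e * e * (Rsqr (sin a) + Rsqr (cos a))) by (unfold Rsqr; ring).
rewrite sin2_cos2, Rmult_1_r. apply sqrt_square. apply Rlt_le, exp_pos.
Qed.

Lemma cpow_mult_l x y w : 0 < x -> 0 < y -> cpow (x * y) w = (cpow x w * cpow y w)%C.
Proof.
intros Hx Hy. unfold cpow, Cmult. simpl. rewrite ln_mult by assumption.
rewrite !Rmult_plus_distr_l, exp_plus, cos_plus, sin_plus. f_equal; ring.
Qed.

Lemma cpow_plus x w z : cpow x (w + z)%C = (cpow x w * cpow x z)%C.
Proof.
unfold cpow, Cmult. simpl.
rewrite !Rmult_plus_distr_r, exp_plus, cos_plus, sin_plus. f_equal; ring.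
Qed.

Definition dpoly (k N : nat) (s : C) : C :=
  csum (fun n => RtoC (INR (dk k n)) * cpow (INR n) (- s))%C N.

Lemma zsum_csum N s : zsum N s = csum (fun n => cpow (INR n) (- s)%C) N.
Proof. induction N as [|N IH]; [reflexivity|]. rewrite csumS, <- IH. reflexivity. Qed.

(** Truncating a product of Dirichlet series at [n = d m <= N] truncates the inner factor at
    [N / m]; hence the length must vary in the induction on [k]. *)
Lemma dpolyS k N s : dpoly (S k) N s = csum (fun m => cpow (INR m) (- s) * dpoly k (N / m) s)%C N.
Proof.
unfold dpoly. rewrite csum_dkS. apply csum_ext. intros m Hm.
rewrite <- csum_scal. apply csum_ext. intros d Hd.
rewrite mult_INR, cpow_mult_l by (apply lt_0_INR; lia). ring.
Qed.

Lemma rsum_inv_sq_le M : rsum (fun n => / INR n ^ 2) M <= 2.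
Proof.
assert (H : forall M, rsum (fun n => / INR n ^ 2) (S M) <= 2 - / INR (S M)).
{ induction M0 as [|N IH].
  - simpl. lra.
  - rewrite rsumS. rewrite (S_INR (S N)).
    assert (0 < INR (S N)) by (apply lt_0_INR; lia).
    set (x := INR (S N)) in *.
    assert (/ (x + 1) ^ 2 <= / x - / (x + 1)).
    { replace (/ x - / (x + 1)) with (/ (x * (x + 1))) by (field; lra).
      apply Rinv_le_contravar; nra. }
    lra. }
destruct M as [|M]; [simpl; lra|].
specialize (H M). assert (0 < / INR (S M)) by (apply Rinv_0_lt_compat, lt_0_INR; lia). lra.
Qed.

Lemma Rpower_neg_nat n k : (1 <= n)%nat -> Rpower (INR n) (- INR k) = / INR n ^ k.
Proof.
intros Hn. rewrite Rpower_Ropp, Rpower_pow; [reflexivity|]. apply lt_0_INR; lia.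
Qed.

Lemma dpoly_0 N s : (1 <= N)%nat -> dpoly 0 N s = RtoC 1.
Proof.
intros HN. induction N as [|N IH]; [lia|].
unfold dpoly in *. rewrite csumS. destruct N as [|N].
- simpl csum. rewrite dk_1. unfold cpow. simpl. rewrite ln_1, !Rmult_0_r, exp_0, cos_0, sin_0.
  apply injective_projections; simpl; ring.
- rewrite IH, dk_0 by lia. simpl. ring.
Qed.

(* Ordered factorizations [n_1 ... n_k > N] are weighted by Rankin's trick with exponent 2. *)
Lemma zsum_pow_sub_dpoly k N M s : (N <= M)%nat -> 4 <= fst s ->
  Cmod (zsum M s ^ k - dpoly k N s) <= rsum (fun n => / INR n ^ 2) M ^ k / (INR N + 1) ^ 2.
Proof.
intros HNM Hs. revert N HNM. induction k as [|k IH]; intros N HNM.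
- change (zsum M s ^ 0)%C with (RtoC 1). rewrite pow_O.
  destruct N as [|N].
  + unfold dpoly. simpl. replace (1 - 0)%C with (RtoC 1) by ring. rewrite Cmod_1. lra.
  + rewrite dpoly_0 by lia. replace (1 - 1)%C with (RtoC 0) by ring. rewrite Cmod_0.
    apply Rlt_le, Rdiv_lt_0_compat; [lra|]. pose proof (pos_INR (S N)). apply pow_lt; lra.
- set (Z := zsum M s) in *. rewrite dpolyS, Cpow_S.
  (* For [m > N] the quotient [N / m] is 0 and the inner polynomial is an empty sum, so the range
     extends to that of [zsum M]. *)
  assert (E : csum (fun m => cpow (INR m) (- s) * dpoly k (N / m) s)%C N =
    csum (fun m => cpow (INR m) (- s) * dpoly k (N / m) s)%C M).
  { replace M with (N + (M - N))%nat by lia. generalize (M - N)%nat as j. induction j as [|j IHj].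
    - rewrite Nat.add_0_r. reflexivity.
    - rewrite Nat.add_succ_r, csumS, <- IHj.
      rewrite (Nat.div_small N (S (N + j))) by lia. unfold dpoly at 3. simpl csum. ring. }
  rewrite E. unfold Z at 1. rewrite zsum_csum, Cmult_comm, <- csum_scal, <- csum_minus.
  eapply Rle_trans; [apply Cmod_csum_le|].
  set (S2 := rsum (fun n => / INR n ^ 2) M) in *.
  assert (S20 : 0 <= S2).
  { pose proof (rsum_mono (fun n => / INR n ^ 2) 0 M) as H. simpl in H. apply H.
    intros n Hn. apply Rlt_le, Rinv_0_lt_compat. assert (0 < INR n) by (apply lt_0_INR; lia). nra. }
  assert (N0 := pos_INR N).
  replace (S2 ^ S k / (INR N + 1) ^ 2) with ((S2 ^ k / (INR N + 1) ^ 2) * S2) by (simpl; field; lra).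
  unfold S2 at 2. rewrite <- rsum_scal. apply rsum_le. intros m Hm.
  replace (Z ^ k * cpow (INR m) (- s) - cpow (INR m) (- s) * dpoly k (N / m) s)%C
    with (cpow (INR m) (- s) * (Z ^ k - dpoly k (N / m) s))%C by ring.
  rewrite Cmod_mult, Cmod_cpow. simpl fst.
  assert (M1 : 1 <= INR m) by (apply (le_INR 1); lia).
  assert (A1 : Rpower (INR m) (- fst s) <= / INR m ^ 4).
  { rewrite <- Rpower_neg_nat by lia. apply Rle_Rpower; [lra|]. simpl. lra. }
  assert (Hdiv : (N / m <= M)%nat) by (apply Nat.Div0.div_le_upper_bound; nia).
  specialize (IH (N / m)%nat Hdiv).
  (* This converts the inner error [1 / (q + 1)^2] into [m^2 / (N + 1)^2]; together with [m^(-4)]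
     there remains [m^(-2)], whose sum supplies the next power. *)
  assert (Hq : (N + 1 <= m * (N / m + 1))%nat).
  { pose proof (Nat.div_mod_eq N m). pose proof (Nat.mod_upper_bound N m ltac:(lia)). lia. }
  apply le_INR in Hq. rewrite mult_INR, !plus_INR in Hq. simpl (INR 1) in Hq.
  assert (Q0 := pos_INR (N / m)).
  set (q := INR (N / m)) in *. set (x := INR m) in *. set (n := INR N) in *.
  assert (A2 : / (q + 1) ^ 2 <= x ^ 2 / (n + 1) ^ 2).
  { apply Rle_trans with (/ ((n + 1) / x) ^ 2).
    - apply Rinv_le_contravar; [apply pow_lt, Rdiv_lt_0_compat; lra|].
      apply pow_incr. split; [apply Rlt_le, Rdiv_lt_0_compat; lra|].
      apply (Rmult_le_reg_r x); [lra|]. unfold Rdiv. rewrite Rmult_assoc, Rinv_l; lra.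
    - right. field. lra. }
  assert (P0 : 0 <= S2 ^ k) by (apply pow_le; lra).
  apply Rle_trans with (/ x ^ 4 * (S2 ^ k * (x ^ 2 / (n + 1) ^ 2))).
  + apply Rmult_le_compat; [apply Rlt_le, Rpower_pos|apply Cmod_ge_0|exact A1|].
    eapply Rle_trans; [exact IH|]. unfold Rdiv at 1. apply Rmult_le_compat_l; assumption.
  + right. field. lra.
Qed.

(** A truncated form of [zeta(2)^k <= 2^k]. *)
Lemma rsum_dk_inv_sq_le k N : rsum (fun n => INR (dk k n) * / INR n ^ 2) N <= 2 ^ k.
Proof.
revert N. induction k as [|k IH]; intros N.
- destruct N as [|N]; [simpl; lra|]. rewrite pow_O.
  induction N as [|N IHN].
  + simpl. rewrite dk_1. simpl. lra.
  + rewrite rsumS, dk_0 by lia. simpl (INR 0). lra.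
- rewrite (rsum_dkS k (fun n => / INR n ^ 2)).
  apply Rle_trans with (2 ^ k * rsum (fun m => / INR m ^ 2) N).
  + rewrite <- rsum_scal. apply rsum_le. intros m Hm.
    rewrite (rsum_ext _ (fun d => / INR m ^ 2 * (INR (dk k d) * / INR d ^ 2))).
    * rewrite rsum_scal, Rmult_comm. apply Rmult_le_compat_r; [|apply IH].
      apply Rlt_le, Rinv_0_lt_compat, pow_lt, lt_0_INR. lia.
    * intros d Hd. unfold ssrnat.muln. rewrite mult_INR. field.
      split; apply not_0_INR; lia.
  + change (2 ^ S k) with (2 * 2 ^ k). pose proof (rsum_inv_sq_le N). assert (0 < 2 ^ k) by (apply pow_lt; lra). nra.
Qed.

(** Uses [1 <= (N / n)^2] to reach the convergent sum at exponent 2. The bound is crude and serves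
    only on the horizontal sides, where dividing by the height absorbs it. *)
Lemma Cmod_dpoly_le k N s : 0 <= fst s -> Cmod (dpoly k N s) <= INR N ^ 2 * 2 ^ k.
Proof.
intros Hs. eapply Rle_trans; [apply Cmod_csum_le|].
apply Rle_trans with (INR N ^ 2 * rsum (fun n => INR (dk k n) * / INR n ^ 2) N).
- rewrite <- rsum_scal. apply rsum_le. intros n [Hn1 Hn2].
  rewrite Cmod_mult, Cmod_R, Cmod_cpow, Rabs_pos_eq by apply pos_INR. simpl fst.
  assert (N1 : 1 <= INR n) by (apply (le_INR 1); lia).
  assert (N2 : INR n <= INR N) by (apply le_INR; lia).
  assert (A : Rpower (INR n) (- fst s) <= 1).
  { rewrite <- (Rpower_O (INR n)) by lra. apply Rle_Rpower; lra. }
  assert (B : 1 <= INR N ^ 2 * / INR n ^ 2).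
  { apply (Rmult_le_reg_r (INR n ^ 2)); [apply pow_lt; lra|].
    rewrite Rmult_assoc, Rinv_l, Rmult_1_r, Rmult_1_l; [apply pow_incr; lra|].
    apply pow_nonzero; lra. }
  assert (D := pos_INR (dk k n)).
  replace (INR N ^ 2 * (INR (dk k n) * / INR n ^ 2)) with (INR (dk k n) * (INR N ^ 2 * / INR n ^ 2)) by ring.
  apply Rmult_le_compat_l; lra.
- apply Rmult_le_compat_l; [apply pow2_ge_0|apply rsum_dk_inv_sq_le].
Qed.

(** * Differentiation along curves *)

Lemma C_neq0_sq (z : C) : z <> RtoC 0 -> fst z ^ 2 + snd z ^ 2 <> 0.
Proof.
intros H E. apply H. apply injective_projections; simpl; nra.
Qed.

Definition Rder (f : R -> C) (x : R) (l : C) : Prop :=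
  is_derive (fun u => fst (f u)) x (fst l) /\ is_derive (fun u => snd (f u)) x (snd l).

Lemma Rder_eq f x l m : Rder f x l -> l = m -> Rder f x m.
Proof. intros H <-. exact H. Qed.

Lemma Rder_const c x : Rder (fun _ => c) x (RtoC 0).
Proof. split; apply (@is_derive_const R_AbsRing R_NormedModule). Qed.

Lemma Rder_RtoC x : Rder RtoC x (RtoC 1).
Proof.
split; simpl; [apply (@is_derive_id R_AbsRing)|apply (@is_derive_const R_AbsRing R_NormedModule)].
Qed.

Lemma Rder_plus f g x l m : Rder f x l -> Rder g x m -> Rder (fun u => f u + g u)%C x (l + m)%C.
Proof. intros [F1 F2] [G1 G2]. split; simpl; apply @is_derive_plus; assumption. Qed.

Lemma Rder_opp f x l : Rder f x l -> Rder (fun u => - f u)%C x (- l)%C.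
Proof. intros [F1 F2]. split; simpl; apply @is_derive_opp; assumption. Qed.

Lemma Rder_minus f g x l m : Rder f x l -> Rder g x m -> Rder (fun u => f u - g u)%C x (l - m)%C.
Proof. intros F G. apply Rder_plus; [exact F|apply Rder_opp, G]. Qed.

Lemma Rder_mult f g x l m : Rder f x l -> Rder g x m ->
  Rder (fun u => f u * g u)%C x (l * g x + f x * m)%C.
Proof.
intros [F1 F2] [G1 G2]. split; simpl.
- evar_last; [apply @is_derive_minus; apply @is_derive_mult; try eassumption; intros; apply Rmult_comm|].
  unfold minus, plus, opp, mult; simpl. ring.
- evar_last; [apply @is_derive_plus; apply @is_derive_mult; try eassumption; intros; apply Rmult_comm|].
  unfold minus, plus, opp, mult; simpl. ring.
Qed.

Lemma Rder_inv f x l : Rder f x l -> f x <> RtoC 0 ->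
  Rder (fun u => / f u)%C x (- (/ f x * / f x) * l)%C.
Proof.
intros [F1 F2] H. apply C_neq0_sq in H.
set (a := fun u => fst (f u)) in *. set (b := fun u => snd (f u)) in *.
change (a x ^ 2 + b x ^ 2 <> 0) in H.
assert (ea : ex_derive a x) by (eexists; eassumption).
assert (eb : ex_derive b x) by (eexists; eassumption).
assert (D1 : Derive (fun x0 : R => a x0) x = fst l) by (apply is_derive_unique; exact F1).
assert (D2 : Derive (fun x0 : R => b x0) x = snd l) by (apply is_derive_unique; exact F2).
split.
- change (is_derive (fun u => a u / (a u ^ 2 + b u ^ 2)) x (fst (- (/ f x * / f x) * l)%C)).
  auto_derive; [repeat split; auto|]. rewrite D1, D2.
  unfold Cinv, Cmult, Copp; simpl; fold (a x); fold (b x). field. simpl in H. intros E; apply H; nra.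
- change (is_derive (fun u => - b u / (a u ^ 2 + b u ^ 2)) x (snd (- (/ f x * / f x) * l)%C)).
  auto_derive; [repeat split; auto|]. rewrite D1, D2.
  unfold Cinv, Cmult, Copp; simpl; fold (a x); fold (b x). field. simpl in H. intros E; apply H; nra.
Qed.

Lemma Rder_cpow_exp a f x l : Rder f x l ->
  Rder (fun u => cpow a (f u)) x (RtoC (ln a) * cpow a (f x) * l)%C.
Proof.
intros [F1 F2].
set (p := fun u => fst (f u)) in *. set (q := fun u => snd (f u)) in *.
assert (ea : ex_derive p x) by (eexists; eassumption).
assert (eb : ex_derive q x) by (eexists; eassumption).
assert (D1 : Derive (fun x0 : R => p x0) x = fst l) by (apply is_derive_unique; exact F1).
assert (D2 : Derive (fun x0 : R => q x0) x = snd l) by (apply is_derive_unique; exact F2).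
split.
- change (is_derive (fun u => exp (p u * ln a) * cos (q u * ln a)) x (fst (RtoC (ln a) * cpow a (f x) * l)%C)).
  auto_derive; [repeat split; auto|]. rewrite D1, D2.
  unfold cpow; simpl; fold (p x); fold (q x). ring.
- change (is_derive (fun u => exp (p u * ln a) * sin (q u * ln a)) x (snd (RtoC (ln a) * cpow a (f x) * l)%C)).
  auto_derive; [repeat split; auto|]. rewrite D1, D2.
  unfold cpow; simpl; fold (p x); fold (q x). ring.
Qed.

Lemma cpow_minus1 x w : 0 < x -> cpow x (w - 1)%C = (cpow x w * RtoC (/ x))%C.
Proof.
intros Hx. unfold Cminus. rewrite cpow_plus. f_equal.
unfold cpow. simpl. apply injective_projections; simpl.
- rewrite Ropp_0, Rmult_0_l, cos_0, Rmult_1_r.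
  replace (- (1) * ln x) with (- ln x) by ring. rewrite exp_Ropp, exp_ln; [reflexivity|lra].
- rewrite Ropp_0, Rmult_0_l, sin_0. ring.
Qed.

Lemma Rder_cpow_base w x : 0 < x -> Rder (fun u => cpow u w) x (w * cpow x (w - 1))%C.
Proof.
intros Hx. rewrite cpow_minus1 by assumption. split; unfold cpow; simpl.
- auto_derive; [lra|]. field; lra.
- auto_derive; [lra|]. field; lra.
Qed.

Lemma Cmod_sqr z : Cmod z ^ 2 = fst z ^ 2 + snd z ^ 2.
Proof. unfold Cmod. rewrite pow2_sqrt; [reflexivity|nra]. Qed.

Lemma Cmod_inner_le (z w : C) : fst z * fst w + snd z * snd w <= Cmod z * Cmod w.
Proof.
assert (A := Cmod_ge_0 z). assert (B := Cmod_ge_0 w).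
assert (E := Cmod_sqr z). assert (F := Cmod_sqr w).
apply Rsqr_incr_0_var; [|nra]. unfold Rsqr.
replace (Cmod z * Cmod w * (Cmod z * Cmod w)) with (Cmod z ^ 2 * Cmod w ^ 2) by ring.
rewrite E, F. assert (0 <= (fst z * snd w - snd z * fst w) ^ 2) by apply pow2_ge_0. nra.
Qed.

(** The mean value theorem fails for complex values, so it is applied to the real function obtained
    by projecting [f] on the direction [f b - f a]. *)
Lemma Cmvt_le (f df : R -> C) a b B : a <= b ->
  (forall x, a <= x <= b -> Rder f x (df x)) ->
  (forall x, a <= x <= b -> Cmod (df x) <= B) ->
  Cmod (f b - f a) <= B * (b - a).
Proof.
intros Hab Hd HB.
destruct (Req_dec a b) as [->|Hne].
{ replace (f b - f b)%C with (RtoC 0) by ring. rewrite Cmod_0. lra. }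
set (v := (f b - f a)%C).
set (g := fun u => fst v * fst (f u) + snd v * snd (f u)).
destruct (MVT_cor2 g (fun u => fst v * fst (df u) + snd v * snd (df u)) a b) as [c [E Hc]].
- lra.
- intros c Hc. apply is_derive_Reals. destruct (Hd c Hc) as [D1 D2].
  apply @is_derive_plus; apply @is_derive_scal; assumption.
- assert (Ev : Cmod v ^ 2 = g b - g a).
  { rewrite Cmod_sqr. unfold g, v. simpl. ring. }
  assert (I := Cmod_inner_le v (df c)). assert (Bc := HB c ltac:(lra)).
  assert (V0 := Cmod_ge_0 v).
  destruct (Req_dec (Cmod v) 0) as [Z|Z].
  + rewrite Z. assert (0 <= B) by (pose proof (Cmod_ge_0 (df c)); lra). nra.
  + assert (0 < Cmod v) by lra.
    apply (Rmult_le_reg_l (Cmod v)); [assumption|].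
    replace (Cmod v * Cmod v) with (Cmod v ^ 2) by ring. rewrite Ev, E.
    assert (fst v * fst (df c) + snd v * snd (df c) <= Cmod v * B) by nra. nra.
Qed.

(* Complex differentiability is tested along differentiable curves, so that every closure property reduces
   to the rules for functions of one real variable. *)
Definition Chol (f : C -> C) (z l : C) : Prop :=
  forall (g : R -> C) x m, g x = z -> Rder g x m -> Rder (fun u => f (g u)) x (l * m)%C.

Lemma Chol_eq f z l m : Chol f z l -> l = m -> Chol f z m.
Proof. intros H <-. exact H. Qed.

Lemma Chol_const c z : Chol (fun _ => c) z (RtoC 0).
Proof. intros g x m _ _. eapply Rder_eq; [apply Rder_const|ring]. Qed.

Lemma Chol_id z : Chol (fun w => w) z (RtoC 1).
Proof. intros g x m _ H. eapply Rder_eq; [exact H|ring]. Qed.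

Lemma Chol_plus f g z l m : Chol f z l -> Chol g z m -> Chol (fun w => f w + g w)%C z (l + m)%C.
Proof.
intros F G h x n E H. eapply Rder_eq; [apply Rder_plus; [apply (F h x n E H)|apply (G h x n E H)]|ring].
Qed.

Lemma Chol_opp f z l : Chol f z l -> Chol (fun w => - f w)%C z (- l)%C.
Proof.
intros F h x n E H. eapply Rder_eq; [apply Rder_opp, (F h x n E H)|ring].
Qed.

Lemma Chol_minus f g z l m : Chol f z l -> Chol g z m -> Chol (fun w => f w - g w)%C z (l - m)%C.
Proof. intros F G. apply Chol_plus; [exact F|apply Chol_opp, G]. Qed.

Lemma Chol_mult f g z l m : Chol f z l -> Chol g z m ->
  Chol (fun w => f w * g w)%C z (l * g z + f z * m)%C.
Proof.
intros F G h x n E H. eapply Rder_eq.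
- apply Rder_mult; [apply (F h x n E H)|apply (G h x n E H)].
- cbv beta. rewrite E. ring.
Qed.

Lemma Chol_inv f z l : Chol f z l -> f z <> RtoC 0 ->
  Chol (fun w => / f w)%C z (- (/ f z * / f z) * l)%C.
Proof.
intros F N h x n E H. eapply Rder_eq.
- apply Rder_inv; [apply (F h x n E H)|rewrite E; exact N].
- cbv beta. rewrite E. ring.
Qed.

Lemma Chol_cpow a f z l : Chol f z l -> Chol (fun w => cpow a (f w)) z (RtoC (ln a) * cpow a (f z) * l)%C.
Proof.
intros F h x n E H. eapply Rder_eq; [apply Rder_cpow_exp, (F h x n E H)|cbv beta; rewrite E; ring].
Qed.

Lemma Chol_csum (f : nat -> C -> C) (l : nat -> C) z N :
  (forall n, (1 <= n <= N)%nat -> Chol (f n) z (l n)) ->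
  Chol (fun w => csum (fun n => f n w) N) z (csum l N).
Proof.
intros H. induction N as [|N IH].
- apply (Chol_const (RtoC 0)).
- simpl. apply (Chol_plus (fun w => csum (fun n => f n w) N) (f (S N))).
  + apply IH. intros n Hn. apply H. lia.
  + apply H. lia.
Qed.

(** * Approximation of zeta *)

Lemma C1_minus_neq0 (s : C) : 0 < snd s -> (1 - s)%C <> RtoC 0.
Proof. intros H E. apply (f_equal snd) in E. simpl in E. lra. Qed.

Lemma Cmod_cpow_sub_le (s : C) (a x b : R) : 0 < a -> a <= x <= b -> 0 <= fst s ->
  Cmod (cpow b (- s) - cpow x (- s)) <= Cmod s * Rpower a (- fst s - 1) * (b - x).
Proof.
intros Ha Hx Hs.
apply (Cmvt_le (fun u => cpow u (- s)%C) (fun u => (- s) * cpow u (- s - 1))%C); [lra| |].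
- intros u Hu. apply Rder_cpow_base. lra.
- intros u Hu. rewrite Cmod_mult, Cmod_opp, Cmod_cpow.
  apply Rmult_le_compat_l; [apply Cmod_ge_0|].
  simpl. apply Rpower_le_base_neg; lra.
Qed.

(** The increment is the error of replacing the integral of [x^(-s)] over [[N, N + 1]] by the value
    at [N + 1]. It equals [phi (N + 1) - phi N], and the derivative [(N + 1)^(-s) - x^(-s)] of [phi]
    is small by a second use of the mean value inequality. *)
Lemma zeta_approx_step N (s : C) : (1 <= N)%nat -> 1 / 2 <= fst s -> 0 < snd s ->
  Cmod (zeta_approx (S N) s - zeta_approx N s) <= Cmod s * Rpower (INR N) (- (3 / 2)).
Proof.
intros HN H1 H2.
assert (N1 : 1 <= INR N) by (apply (le_INR 1); lia).
assert (Hn := C1_minus_neq0 s H2).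
set (phi := fun x => (RtoC x * cpow (INR N + 1)%R (- s) - cpow x (1 - s) * / (1 - s))%C).
assert (E : (zeta_approx (S N) s - zeta_approx N s = phi (INR N + 1)%R - phi (INR N))%C).
{ unfold zeta_approx, phi, Cdiv. simpl zsum.
  change (match N with 0%nat => 1 | S _ => INR N + 1 end) with (INR (S N)). rewrite S_INR.
  rewrite RtoC_plus. field. exact Hn. }
rewrite E.
replace (Cmod s * Rpower (INR N) (- (3 / 2))) with (Cmod s * Rpower (INR N) (- (3 / 2)) * (INR N + 1 - INR N)) by ring.
apply (Cmvt_le phi (fun u => cpow (INR N + 1)%R (- s) - cpow u (- s))%C); [lra| |].
- intros u Hu. eapply Rder_eq.
  + apply Rder_minus.
    * apply Rder_mult; [apply Rder_RtoC|apply Rder_const].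
    * apply Rder_mult; [apply Rder_cpow_base; lra|apply Rder_const].
  + cbv beta. replace (1 - s - 1)%C with (- s)%C by ring.
    field. exact Hn.
- intros u Hu. eapply Rle_trans; [apply (Cmod_cpow_sub_le s (INR N) u (INR N + 1)); lra|].
  assert (Rpower (INR N) (- fst s - 1) <= Rpower (INR N) (- (3 / 2))) by (apply Rle_Rpower; lra).
  assert (C0 := Cmod_ge_0 s). assert (P := Rpower_pos (INR N) (- fst s - 1)).
  rewrite Rmult_assoc. apply Rmult_le_compat_l; [assumption|]. nra.
Qed.

(** Makes the step errors telescope. The mean value theorem gives [xi^(-3/2) / 2] with [xi <= 2x],
    and [2^(-3/2) >= 1/4]; hence 8. *)
Lemma Rpower_three_half_le x : 1 <= x ->
  Rpower x (- (3 / 2)) <= 8 * (Rpower x (- (1 / 2)) - Rpower (x + 1) (- (1 / 2))).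
Proof.
intros Hx. destruct (Rpower_mvt x (- (1 / 2)) ltac:(lra)) as [xi [Hxi E]].
replace (- (1 / 2) - 1) with (- (3 / 2)) in E by lra.
assert (A : Rpower (2 * x) (- (3 / 2)) <= Rpower xi (- (3 / 2))) by (apply Rpower_le_base_neg; lra).
rewrite <- Rpower_mult_distr in A by lra.
assert (B : / 4 <= Rpower 2 (- (3 / 2))).
{ replace (/ 4) with (Rpower 2 (- (2))).
  - apply Rle_Rpower; lra.
  - rewrite Rpower_Ropp. replace 2 with (INR 2) at 2 by (simpl; lra).
    rewrite Rpower_pow by lra. simpl. field. }
assert (P := Rpower_pos x (- (3 / 2))). nra.
Qed.

Lemma zeta_approx_diff N j (s : C) : (1 <= N)%nat -> 1 / 2 <= fst s -> 0 < snd s ->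
  Cmod (zeta_approx (N + j) s - zeta_approx N s) <= 8 * Cmod s * Rpower (INR N) (- (1 / 2)).
Proof.
intros HN H1 H2. assert (C0 := Cmod_ge_0 s).
assert (H : Cmod (zeta_approx (N + j) s - zeta_approx N s) <=
  8 * Cmod s * (Rpower (INR N) (- (1 / 2)) - Rpower (INR (N + j)) (- (1 / 2)))).
{ induction j as [|j IH].
  - rewrite Nat.add_0_r. replace (zeta_approx N s - zeta_approx N s)%C with (RtoC 0) by ring.
    rewrite Cmod_0. lra.
  - rewrite Nat.add_succ_r.
    replace (zeta_approx (S (N + j)) s - zeta_approx N s)%C with
      ((zeta_approx (S (N + j)) s - zeta_approx (N + j) s) + (zeta_approx (N + j) s - zeta_approx N s))%C by ring.
    eapply Rle_trans; [apply Cmod_triangle|].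
    assert (S1 := zeta_approx_step (N + j) s ltac:(lia) H1 H2).
    assert (X1 : 1 <= INR (N + j)) by (apply (le_INR 1); lia).
    assert (S2 := Rpower_three_half_le _ X1). rewrite S_INR.
    assert (Cmod s * Rpower (INR (N + j)) (- (3 / 2)) <= Cmod s * (8 * (Rpower (INR (N + j)) (- (1 / 2)) - Rpower (INR (N + j) + 1) (- (1 / 2))))) by (apply Rmult_le_compat_l; assumption).
    lra. }
assert (P := Rpower_pos (INR (N + j)) (- (1 / 2))). nra.
Qed.

Lemma Rpower_neg_half_small c eps : 0 < eps -> exists N0, (1 <= N0)%nat /\ forall N, (N0 <= N)%nat ->
  c * Rpower (INR N) (- (1 / 2)) <= eps.
Proof.
intros He. destruct (nfloor_ex ((Rabs c / eps) ^ 2)) as [m [_ Hm]]; [apply pow2_ge_0|].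
exists (S m). split; [lia|]. intros N HN.
assert (HN' : INR (S m) <= INR N) by (apply le_INR; lia). rewrite S_INR in HN'.
assert (N0 : 0 < INR N) by (apply lt_0_INR; lia).
rewrite Rpower_Ropp. replace (1 / 2) with (/ 2) by lra. rewrite Rpower_sqrt by assumption.
assert (Sq : Rabs c / eps <= sqrt (INR N)).
{ rewrite <- (sqrt_pow2 (Rabs c / eps)).
  - apply sqrt_le_1_alt. lra.
  - apply Rmult_le_pos; [apply Rabs_pos|apply Rlt_le, Rinv_0_lt_compat; assumption]. }
assert (S0 : 0 < sqrt (INR N)) by (apply sqrt_lt_R0; assumption).
apply (Rmult_le_reg_r (sqrt (INR N))); [assumption|].
rewrite Rmult_assoc, Rinv_l, Rmult_1_r by lra.
apply Rle_trans with (Rabs c); [apply Rle_abs|].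
apply Rle_trans with (Rabs c / eps * eps); [right; field; lra|]. nra.
Qed.

Lemma fst_le_Cmod z : Rabs (fst z) <= Cmod z.
Proof. eapply Rle_trans; [apply Rmax_l|apply Rmax_Cmod]. Qed.

Lemma snd_le_Cmod z : Rabs (snd z) <= Cmod z.
Proof. eapply Rle_trans; [apply Rmax_r|apply Rmax_Cmod]. Qed.

Lemma Cmod_le_abs z : Cmod z <= Rabs (fst z) + Rabs (snd z).
Proof.
destruct z as [x y]. replace (x, y) with (RtoC x + RtoC y * Ci)%C.
- eapply Rle_trans; [apply Cmod_triangle|]. rewrite Cmod_mult, !Cmod_R, Cmod_Ci. simpl.
  rewrite !Rmult_0_r, !Rmult_0_l, Rmult_1_r. replace (x + (0 - 0)) with x by ring. replace (0 + (y * 1 + 0)) with y by ring.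
  replace (y - 0) with y by ring. lra.
- apply injective_projections; simpl; ring.
Qed.

(** [zeta] is defined through [Lim_seq], which is total, so the limit must be shown to exist. The
    Cauchy criterion is proved for an abstract coordinate [p] in order to serve both parts at
    once. *)
Lemma zeta_approx_lim (s : C) : 1 / 2 <= fst s -> 0 < snd s ->
  is_lim_seq (fun N => fst (zeta_approx N s)) (fst (zeta s)) /\
  is_lim_seq (fun N => snd (zeta_approx N s)) (snd (zeta s)).
Proof.
intros H1 H2.
assert (K : forall p : C -> R, (forall z w, p (z - w)%C = p z - p w) -> (forall z, Rabs (p z) <= Cmod z) ->
  is_lim_seq (fun N => p (zeta_approx N s)) (real (Lim_seq (fun N => p (zeta_approx N s))))).
{ intros p pl pb. apply Lim_seq_correct'. apply ex_lim_seq_cauchy_corr.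
  intros eps.
  destruct (Rpower_neg_half_small (8 * Cmod s) (eps / 4)) as [N0 [HN0 HN]]; [destruct eps; simpl; lra|].
  exists N0. intros n m Hn Hm. rewrite <- pl.
  eapply Rle_lt_trans; [apply pb|].
  replace (zeta_approx n s - zeta_approx m s)%C with
    ((zeta_approx n s - zeta_approx N0 s) + - (zeta_approx m s - zeta_approx N0 s))%C by ring.
  eapply Rle_lt_trans; [apply Cmod_triangle|]. rewrite Cmod_opp.
  replace n with (N0 + (n - N0))%nat by lia. replace m with (N0 + (m - N0))%nat by lia.
  assert (A := zeta_approx_diff N0 (n - N0) s HN0 H1 H2).
  assert (B := zeta_approx_diff N0 (m - N0) s HN0 H1 H2).
  specialize (HN N0 ltac:(lia)). destruct eps as [e He]; simpl in *. lra. }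
split; apply K.
- intros; reflexivity.
- apply fst_le_Cmod.
- intros; reflexivity.
- apply snd_le_Cmod.
Qed.

(** The limit [j -> oo] in [zeta_approx_diff], coordinate by coordinate; adding the two coordinates
    doubles 8 to 16. *)
Lemma zeta_approx_err N (s : C) : (1 <= N)%nat -> 1 / 2 <= fst s -> 0 < snd s ->
  Cmod (zeta s - zeta_approx N s) <= 16 * Cmod s * Rpower (INR N) (- (1 / 2)).
Proof.
intros HN H1 H2. destruct (zeta_approx_lim s H1 H2) as [L1 L2].
set (B := 8 * Cmod s * Rpower (INR N) (- (1 / 2))).
assert (K : forall (p : C -> R) l, (forall z w, p (z - w)%C = p z - p w) -> (forall z, Rabs (p z) <= Cmod z) ->
  is_lim_seq (fun N => p (zeta_approx N s)) (Finite l) -> Rabs (l - p (zeta_approx N s)) <= B).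
{ intros p l pl pb L.
  assert (La : is_lim_seq (fun j => Rabs (p (zeta_approx (j + N) s) - p (zeta_approx N s))) (Rabs (l - p (zeta_approx N s)))).
  { apply (is_lim_seq_abs _ (Finite (l - p (zeta_approx N s)))).
    apply is_lim_seq_minus'; [|apply is_lim_seq_const].
    apply (is_lim_seq_incr_n (fun N => p (zeta_approx N s)) N). exact L. }
  apply (is_lim_seq_le _ (fun _ => B) _ _) with (2 := La) (3 := is_lim_seq_const B).
  intros j. rewrite <- pl. eapply Rle_trans; [apply pb|].
  rewrite Nat.add_comm. apply zeta_approx_diff; assumption. }
eapply Rle_trans; [apply Cmod_le_abs|].
assert (K1 := K fst _ ltac:(intros; reflexivity) fst_le_Cmod L1).
assert (K2 := K snd _ ltac:(intros; reflexivity) snd_le_Cmod L2).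
change (Rabs (fst (zeta s) - fst (zeta_approx N s)) + Rabs (snd (zeta s) - snd (zeta_approx N s)) <=
  16 * Cmod s * Rpower (INR N) (- (1 / 2))).
unfold B in *. lra.
Qed.

(** The derivative is left in the shape that the rules for sums, products and inverses produce, so
    that they apply without rewriting. *)
Definition zeta_approx_der (N : nat) (s : C) : C :=
  (csum (fun n => RtoC (ln (INR n)) * cpow (INR n) (- s) * - (1)) N -
   (RtoC (ln (INR N)) * cpow (INR N) (1 - s) * - (1) * / (1 - s) +
    cpow (INR N) (1 - s) * (- (/ (1 - s) * / (1 - s)) * - (1))))%C.

Lemma Chol_zeta_approx N s : 0 < snd s -> Chol (zeta_approx N) s (zeta_approx_der N s).
Proof.
intros Hs. assert (Hn := C1_minus_neq0 s Hs).
assert (H1 : Chol (fun w => 1 - w)%C s (- (1))%C).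
{ eapply Chol_eq; [apply (Chol_minus (fun _ => RtoC 1) (fun w => w)); [apply Chol_const|apply Chol_id]|ring]. }
assert (H : Chol (fun w => csum (fun n => cpow (INR n) (- w)%C) N - cpow (INR N) (1 - w) * / (1 - w))%C s (zeta_approx_der N s)).
{ apply Chol_minus.
  - apply (Chol_csum (fun n w => cpow (INR n) (- w)%C)). intros n Hn'.
    apply (Chol_cpow (INR n) (fun w => - w)%C). apply Chol_opp, Chol_id.
  - apply (Chol_mult (fun w => cpow (INR N) (1 - w)) (fun w => / (1 - w))%C).
    + apply (Chol_cpow (INR N) (fun w => 1 - w)%C). exact H1.
    + apply (Chol_inv (fun w => 1 - w)%C); assumption. }
intros g x m Hg Hd.
specialize (H g x m Hg Hd). destruct H as [A B].
split.
- eapply is_derive_ext; [|exact A]. intros u. unfold zeta_approx. rewrite zsum_csum. reflexivity.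
- eapply is_derive_ext; [|exact B]. intros u. unfold zeta_approx. rewrite zsum_csum. reflexivity.
Qed.

Lemma ln_le_self x : 1 <= x -> 0 <= ln x <= x.
Proof.
intros Hx. split.
- rewrite <- ln_1. apply ln_le; lra.
- rewrite <- (ln_exp x) at 2. apply ln_le; [lra|]. pose proof (exp_ineq1_le x). lra.
Qed.

Lemma Cmod_zeta_approx_der N s : (1 <= N)%nat -> 0 <= fst s -> 1 <= snd s ->
  Cmod (zeta_approx_der N s) <= 3 * INR N ^ 2.
Proof.
intros HN H1 H2. assert (Hn := C1_minus_neq0 s ltac:(lra)).
assert (N1 : 1 <= INR N) by (apply (le_INR 1); lia).
assert (LN := ln_le_self _ N1).
assert (D1 : Cmod (/ (1 - s)) <= 1).
{ rewrite Cmod_inv by assumption. rewrite <- Rinv_1. apply Rinv_le_contravar; [lra|].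
  eapply Rle_trans; [|apply snd_le_Cmod]. simpl. rewrite Rabs_left1; lra. }
assert (D0 := Cmod_ge_0 (/ (1 - s))).
assert (PN : Rpower (INR N) (1 - fst s) <= INR N).
{ rewrite <- (Rpower_1 (INR N)) at 2 by lra. apply Rle_Rpower; lra. }
assert (PN0 := Rpower_pos (INR N) (1 - fst s)).
unfold zeta_approx_der, Cminus at 1.
eapply Rle_trans; [apply Cmod_triangle|]. rewrite Cmod_opp.
assert (A : Cmod (csum (fun n => RtoC (ln (INR n)) * cpow (INR n) (- s) * - (1))%C N) <= INR N ^ 2).
{ eapply Rle_trans; [apply Cmod_csum_le|].
  apply Rle_trans with (rsum (fun _ => INR N * 1) N).
  - apply rsum_le. intros n [Hn1 Hn2].
    assert (n1 : 1 <= INR n) by (apply (le_INR 1); lia).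
    assert (n2 : INR n <= INR N) by (apply le_INR; lia).
    assert (L := ln_le_self _ n1).
    rewrite !Cmod_mult, Cmod_R, Cmod_cpow, Cmod_m1, Rabs_pos_eq by lra. simpl fst.
    assert (Rpower (INR n) (- fst s) <= 1).
    { rewrite <- (Rpower_O (INR n)) by lra. apply Rle_Rpower; lra. }
    assert (P := Rpower_pos (INR n) (- fst s)).
    rewrite Rmult_1_r. apply Rmult_le_compat; lra.
  - rewrite rsum_scal. right.
    assert (E : rsum (fun _ => 1) N = INR N).
    { clear. induction N as [|N IH]; [reflexivity|]. rewrite rsumS, S_INR, IH. ring. }
    rewrite E. ring. }
eapply Rle_trans; [apply Rplus_le_compat; [exact A|apply Cmod_triangle]|].
rewrite !Cmod_mult, !Cmod_opp, !Cmod_mult, Cmod_R, !Cmod_cpow, Cmod_1, Rabs_pos_eq by lra.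
change (fst (1 - s)%C) with (1 - fst s).
set (p := Rpower _ _) in *. set (d := Cmod _) in *. set (l := ln _) in *. set (n := INR N) in *.
assert (l * p <= n * n) by (apply Rmult_le_compat; lra).
assert (0 <= l * p) by (apply Rmult_le_pos; lra).
assert (l * p * 1 * d <= n * n) by (rewrite Rmult_1_r; nra).
assert (0 <= d * d <= 1) by nra.
assert (p * (d * d * 1) <= n * n) by nra.
nra.
Qed.

Lemma zeta_approx_lip N sigma a b : (1 <= N)%nat -> 0 <= sigma -> 1 <= a <= b ->
  Cmod (zeta_approx N (sigma, b) - zeta_approx N (sigma, a)) <= 3 * INR N ^ 2 * (b - a).
Proof.
intros HN Hs Hab.
apply (Cmvt_le (fun t => zeta_approx N (sigma, t)) (fun t => zeta_approx_der N (sigma, t) * (0, 1))%C); [lra| |].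
- intros t Ht. apply (Chol_zeta_approx N (sigma, t)); simpl; [lra|reflexivity|].
  split; simpl; [apply (@is_derive_const R_AbsRing R_NormedModule)|apply (@is_derive_id R_AbsRing)].
- intros t Ht. rewrite Cmod_mult. change (0, 1) with Ci. rewrite Cmod_Ci, Rmult_1_r.
  apply Cmod_zeta_approx_der; simpl; lra || lia.
Qed.

(** A substitute for a bound on the derivative of [zeta]: the Lipschitz constant of the
    approximation grows like [N^2], its error decays like [N^(-1/2)], and [N] is left free to
    balance them. *)
Lemma zeta_near_lip N sigma a b : (1 <= N)%nat -> 1 / 2 <= sigma <= 1 -> 1 <= a <= b ->
  Cmod (zeta (sigma, b) - zeta (sigma, a)) <=
  3 * INR N ^ 2 * (b - a) + 32 * (1 + b) * Rpower (INR N) (- (1 / 2)).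
Proof.
intros HN Hs Hab.
replace (zeta (sigma, b) - zeta (sigma, a))%C with
  ((zeta_approx N (sigma, b) - zeta_approx N (sigma, a)) +
   ((zeta (sigma, b) - zeta_approx N (sigma, b)) + - (zeta (sigma, a) - zeta_approx N (sigma, a))))%C by ring.
eapply Rle_trans; [apply Cmod_triangle|].
apply Rplus_le_compat; [apply zeta_approx_lip; lra || lia|].
eapply Rle_trans; [apply Cmod_triangle|]. rewrite Cmod_opp.
assert (B1 := zeta_approx_err N (sigma, b) HN ltac:(simpl; lra) ltac:(simpl; lra)).
assert (B2 := zeta_approx_err N (sigma, a) HN ltac:(simpl; lra) ltac:(simpl; lra)).
assert (M1 : Cmod (sigma, b) <= 1 + b).
{ eapply Rle_trans; [apply Cmod_le_abs|]. simpl. rewrite !Rabs_pos_eq; lra. }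
assert (M2 : Cmod (sigma, a) <= 1 + b).
{ eapply Rle_trans; [apply Cmod_le_abs|]. simpl. rewrite !Rabs_pos_eq; lra. }
assert (P := Rpower_pos (INR N) (- (1 / 2))).
assert (16 * Cmod (sigma, b) * Rpower (INR N) (- (1 / 2)) <= 16 * (1 + b) * Rpower (INR N) (- (1 / 2))) by (apply Rmult_le_compat_r; lra).
assert (16 * Cmod (sigma, a) * Rpower (INR N) (- (1 / 2)) <= 16 * (1 + b) * Rpower (INR N) (- (1 / 2))) by (apply Rmult_le_compat_r; lra).
lra.
Qed.

Lemma Cmod_rev_triangle z w : Rabs (Cmod z - Cmod w) <= Cmod (z - w).
Proof.
apply Rabs_le. split.
- assert (H := Cmod_triangle z (- (z - w))). rewrite Cmod_opp in H.
  replace (z + - (z - w))%C with w in H by ring. lra.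
- assert (H := Cmod_triangle (z - w) w). replace (z - w + w)%C with z in H by ring. lra.
Qed.

(** [N] is fixed first to make the error term small near [t], and only then the neighbourhood is
    chosen against [N^2]. Continuity is what makes the integral in [moment] a genuine one. *)
Lemma continuous_Cmod_zeta sigma t : 1 / 2 <= sigma <= 1 -> 1 < t ->
  continuous (fun u => Cmod (zeta (sigma, u))) t.
Proof.
intros Hs Ht. apply continuity_pt_filterlim.
intros eps He.
destruct (Rpower_neg_half_small (32 * (1 + (t + 1))) (eps / 4)) as [N [HN HB]]; [lra|].
specialize (HB N (Nat.le_refl N)).
set (L := 3 * INR N ^ 2) in *.
assert (L0 : 0 < L).
{ unfold L. assert (0 < INR N) by (apply lt_0_INR; lia). nra. }
set (d := Rmin (Rmin (t - 1) 1) (eps / 4 / L)).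
assert (Hd : 0 < d).
{ unfold d. repeat apply Rmin_pos; try lra. apply Rdiv_lt_0_compat; lra. }
assert (d1 : d <= t - 1) by (unfold d; eapply Rle_trans; [apply Rmin_l|apply Rmin_l]).
assert (d2 : d <= 1) by (unfold d; eapply Rle_trans; [apply Rmin_l|apply Rmin_r]).
assert (d3 : L * d <= eps / 4).
{ apply Rle_trans with (L * (eps / 4 / L)); [apply Rmult_le_compat_l; [lra|apply Rmin_r]|].
  right. field. lra. }
exists d. split; [exact Hd|].
intros u [_ Hu]. change (Rabs (u - t) < d) in Hu.
change (Rabs (Cmod (zeta (sigma, u)) - Cmod (zeta (sigma, t))) < eps).
eapply Rle_lt_trans; [apply Cmod_rev_triangle|].
assert (Hu' := Rabs_def2 _ _ Hu).
assert (P := Rpower_pos (INR N) (- (1 / 2))).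
assert (K : forall a b, 1 <= a <= b -> b <= t + 1 -> b - a <= d ->
  Cmod (zeta (sigma, b) - zeta (sigma, a)) <= eps / 2).
{ intros a b H1 H2 H3. eapply Rle_trans; [apply (zeta_near_lip N); assumption|].
  fold L. assert (L * (b - a) <= L * d) by (apply Rmult_le_compat_l; lra).
  assert (32 * (1 + b) * Rpower (INR N) (- (1 / 2)) <= 32 * (1 + (t + 1)) * Rpower (INR N) (- (1 / 2))) by (apply Rmult_le_compat_r; lra).
  lra. }
destruct (Rle_dec u t) as [H|H].
- assert (Hk := K u t ltac:(lra) ltac:(lra) ltac:(lra)).
  replace (zeta (sigma, u) - zeta (sigma, t))%C with (- (zeta (sigma, t) - zeta (sigma, u)))%C by ring.
  rewrite Cmod_opp. eapply Rle_lt_trans; [exact Hk|lra].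
- assert (Hk := K t u ltac:(lra) ltac:(lra) ltac:(lra)). eapply Rle_lt_trans; [exact Hk|lra].
Qed.

Lemma continuous_pow (f : R -> R) n x : continuous f x -> continuous (fun u => f u ^ n) x.
Proof.
intros H. induction n as [|n IH]; simpl; [apply continuous_const|].
apply (continuous_mult (K := R_AbsRing)); assumption.
Qed.

Lemma ex_RInt_zeta_pow sigma n a b : 1 / 2 <= sigma <= 1 -> 1 < a <= b ->
  ex_RInt (fun t => Cmod (zeta (sigma, t)) ^ n) a b.
Proof.
intros Hs Hab. apply (ex_RInt_continuous (V := R_CompleteNormedModule)).
intros z Hz. rewrite Rmin_left, Rmax_right in Hz by lra.
apply (continuous_pow (fun t => Cmod (zeta (sigma, t)))). apply continuous_Cmod_zeta; lra.
Qed.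

(** * From moments to the maximum *)

Lemma RInt_ge_sub (f : R -> R) a b c d m : a <= c -> c <= d -> d <= b ->
  (forall u v, a <= u <= v -> v <= b -> ex_RInt f u v) ->
  (forall x, 0 <= f x) -> (forall x, c <= x <= d -> m <= f x) ->
  m * (d - c) <= RInt f a b.
Proof.
intros H1 H2 H3 Hex H0 Hm.
assert (E1 : ex_RInt f a c) by (apply Hex; lra).
assert (E2 : ex_RInt f c d) by (apply Hex; lra).
assert (E3 : ex_RInt f d b) by (apply Hex; lra).
assert (E4 : ex_RInt f c b) by (apply Hex; lra).
rewrite <- (RInt_Chasles f a c b), <- (RInt_Chasles f c d b) by assumption.
assert (A1 : 0 <= RInt f a c) by (apply RInt_ge_0; auto).
assert (A3 : 0 <= RInt f d b) by (apply RInt_ge_0; auto).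
assert (A2 : RInt (fun _ => m) c d <= RInt f c d).
{ apply RInt_le; [assumption|apply ex_RInt_const|assumption|]. intros x Hx. apply Hm. lra. }
rewrite RInt_const in A2. unfold scal, plus in *; simpl in *. unfold mult in *; simpl in *. lra.
Qed.

(* The constant comes from the partial sum of length [(96 T)^2] in [zeta_near_lip]. *)
Lemma zeta_large_persists sigma T t0 t : 1 / 2 <= sigma <= 1 -> 10 <= T ->
  T <= t0 <= 2 * T -> T <= t <= 2 * T -> Rabs (t - t0) <= / (300000000 * T ^ 4) ->
  Cmod (zeta (sigma, t0)) - 2 <= Cmod (zeta (sigma, t)).
Proof.
intros Hs HT Ht0 Ht Hd.
destruct (nfloor_ex ((96 * T) ^ 2)) as [m [Hm1 Hm2]]; [apply pow2_ge_0|].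
set (N := S m).
assert (EN : INR N = INR m + 1) by apply S_INR.
assert (N1 : (96 * T) ^ 2 <= INR N) by lra.
(* [3 N^2 <= 3 * 10^8 T^4] accounts for the length of the interval, and
   [32 (1 + b) <= 96 T <= sqrt N] makes the second error term at most 1. *)
assert (N2 : INR N <= 10000 * T ^ 2) by nra.
assert (N0 : 0 < INR N) by nra.
assert (S1 : 96 * T <= sqrt (INR N)).
{ rewrite <- (sqrt_pow2 (96 * T)) by lra. apply sqrt_le_1_alt. exact N1. }
assert (K : forall a b, 1 <= a <= b -> b <= 2 * T -> b - a <= / (300000000 * T ^ 4) ->
  Cmod (zeta (sigma, b) - zeta (sigma, a)) <= 2).
{ intros a b H1 H2 H3.
  eapply Rle_trans; [apply (zeta_near_lip N); try assumption; unfold N; lia|].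
  rewrite Rpower_Ropp. replace (1 / 2) with (/ 2) by lra. rewrite Rpower_sqrt by assumption.
  assert (A : 3 * INR N ^ 2 * (b - a) <= 1).
  { apply Rle_trans with (300000000 * T ^ 4 * / (300000000 * T ^ 4)).
    - apply Rmult_le_compat; [nra|lra| |assumption].
      assert (INR N ^ 2 <= (10000 * T ^ 2) ^ 2) by (apply pow_incr; lra). nra.
    - right. field. lra. }
  assert (B : 32 * (1 + b) * / sqrt (INR N) <= 1).
  { apply (Rmult_le_reg_r (sqrt (INR N))); [lra|]. rewrite Rmult_assoc, Rinv_l by lra. lra. }
  lra. }
assert (Hc : Cmod (zeta (sigma, t0) - zeta (sigma, t)) <= 2).
{ destruct (Rle_dec t t0) as [H|H].
  - apply K; try lra. rewrite Rabs_left1 in Hd by lra. lra.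
  - rewrite <- Cmod_opp.
    replace (- (zeta (sigma, t0) - zeta (sigma, t)))%C with (zeta (sigma, t) - zeta (sigma, t0))%C by ring.
    apply K; try lra. rewrite Rabs_pos_eq in Hd by lra. lra. }
assert (Hr := Rle_trans _ _ _ (Rle_abs _) (Cmod_rev_triangle (zeta (sigma, t0)) (zeta (sigma, t)))).
lra.
Qed.

(** For [M >= 4] the persisting value [M - 2] is at least [M / 2]. The interval of length [h] starts
    at [c], shifted left when [t0] is close to [2T]. The large lower bound on [T] lets one more
    factor [T / 2] absorb the numerical constant. *)
Lemma moment_ge sigma T k t0 : 1 / 2 <= sigma <= 1 -> 1000000000 <= T -> T <= t0 <= 2 * T ->
  4 <= Cmod (zeta (sigma, t0)) ->
  (Cmod (zeta (sigma, t0)) / 2) ^ (2 * k) <= T ^ 6 / 2 * moment k sigma T.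
Proof.
intros Hs HT Ht0 HM. set (M := Cmod (zeta (sigma, t0))) in *.
set (h := / (300000000 * T ^ 4)).
assert (T4 : 1 <= T ^ 4) by (apply pow_R1_Rle; lra).
assert (h0 : 0 < h) by (apply Rinv_0_lt_compat; lra).
assert (h1 : h <= 1) by (unfold h; rewrite <- Rinv_1; apply Rinv_le_contravar; lra).
set (c := Rmin t0 (2 * T - h)).
assert (c1 : c <= t0) by apply Rmin_l. assert (c2 : c <= 2 * T - h) by apply Rmin_r.
assert (c3 : T <= c) by (apply Rmin_glb; lra).
assert (c4 : t0 - h <= c) by (apply Rmin_glb; lra).
assert (I : (M / 2) ^ (2 * k) * (c + h - c) <= RInt (fun t => Cmod (zeta (sigma, t)) ^ (2 * k)) T (2 * T)).
{ apply RInt_ge_sub; try lra.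
  - intros u v H1 H2. apply ex_RInt_zeta_pow; lra.
  - intros x. apply pow_le, Cmod_ge_0.
  - intros x Hx. apply pow_incr. split; [lra|].
    assert (Hp := zeta_large_persists sigma T t0 x Hs ltac:(lra) Ht0 ltac:(lra)).
    fold M in Hp. fold h in Hp. specialize (Hp ltac:(apply Rabs_le; lra)). lra. }
unfold moment. set (J := RInt _ _ _) in *.
replace (c + h - c) with h in I by ring.
assert (P : 0 <= (M / 2) ^ (2 * k)) by (apply pow_le; lra).
set (A := (M / 2) ^ (2 * k)) in *.
assert (E : A = A * h * (300000000 * T ^ 4)) by (unfold h; field; lra).
rewrite E.
apply Rle_trans with (J * (300000000 * T ^ 4)); [apply Rmult_le_compat_r; lra|].
replace (T ^ 6 / 2 * (J / T)) with (J * (T / 2 * T ^ 4)) by (field; lra).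
apply Rmult_le_compat_l; [nra|]. apply Rmult_le_compat_r; lra.
Qed.

Lemma ln_nonpos x : x <= 0 -> ln x = 0.
Proof. intros H. unfold ln. destruct (Rlt_dec 0 x); [exfalso; lra|reflexivity]. Qed.

Lemma Rpower_ge1 x e : 1 <= x -> 0 <= e -> 1 <= Rpower x e.
Proof. intros H1 H2. rewrite <- (Rpower_O x) by lra. apply Rle_Rpower; lra. Qed.

Lemma moment_to_max sigma delta : 1 / 2 < sigma < 1 -> 0 < delta <= sigma ->
  moment_asymp sigma (fun T => Rpower (ln T) delta) ->
  exists C, 0 < C /\ exists T0, forall T, T0 <= T ->
    LT_le sigma T (C * Rpower (ln T) (1 - delta)).
Proof.
intros Hs Hd Hm.
set (K := 7 / (1 - sigma) + 4 / (2 * sigma - 1)).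
assert (K0 : 0 < K).
{ unfold K. apply Rplus_lt_0_compat; apply Rdiv_lt_0_compat; lra. }
(* A relative error of 1 is enough: only [moment <= 2 D_k] is used. *)
destruct (Hm 1 ltac:(lra)) as [T1 HT1].
(* The exponent 6 comes from [T^6] in [moment_ge], [K] from [D_k <= exp (K log T)], and 1 from
   [ln 2], lost in passing from [M / 2] to [M]. *)
exists (7 + K). split; [lra|].
exists (Rmax 1000000000 T1). intros T HT t Ht.
assert (Ta : 1000000000 <= T) by (eapply Rle_trans; [apply Rmax_l|exact HT]).
assert (Tb : T1 <= T) by (eapply Rle_trans; [apply Rmax_r|exact HT]).
set (l := ln T).
assert (l1 : 1 <= l).
{ unfold l. rewrite <- (ln_exp 1). apply ln_le; [apply exp_pos|]. pose proof exp_le_3. lra. }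
assert (q1 : 1 <= Rpower l (1 - delta)) by (apply Rpower_ge1; lra).
set (q := Rpower l (1 - delta)) in *.
set (x := Rpower l delta).
assert (x1 : 1 <= x) by (apply Rpower_ge1; lra).
set (M := Cmod (zeta (sigma, t))).
(* Small values are trivial: [ln] is 0 at nonpositive arguments, and [ln 4 <= 3]. *)
destruct (Rle_dec M 4) as [HM|HM].
{ apply Rle_trans with 3; [|nra].
  destruct (Rle_dec M 0) as [M0|M0].
  - fold M. rewrite ln_nonpos by exact M0. lra.
  - apply Rle_trans with (ln (1 + 3)); [apply ln_le; lra|].
    apply Rle_trans with (ln (exp 3)); [|rewrite ln_exp; lra].
    apply ln_le; [lra|]. pose proof (exp_ineq1_le 3). lra. }
destruct (nfloor_ex x ltac:(lra)) as [k [Hk1 Hk2]].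
assert (k1 : (1 <= k)%nat).
{ destruct k as [|k]; [simpl in Hk2; lra|lia]. }
assert (kR : 1 <= INR k) by (apply (le_INR 1); lia).
assert (Hmk := HT1 T Tb k ltac:(destruct k; [lia|reflexivity]) Hk1).
assert (D1 := Dsum_ge1 k sigma k1 Hs).
assert (Mle : moment k sigma T <= 2 * Dsum k sigma).
{ apply Rabs_le_between in Hmk.
  replace (moment k sigma T) with (moment k sigma T / Dsum k sigma * Dsum k sigma) by (field; lra).
  apply Rmult_le_compat_r; lra. }
assert (Hg := moment_ge sigma T k t ltac:(lra) Ta Ht ltac:(fold M; lra)). fold M in Hg.
assert (T6 : 0 < T ^ 6) by (apply pow_lt; lra).
assert (Dk := Dsum_le k sigma k1 Hs). fold K in Dk.
(* Here [delta <= sigma] enters: [k^(1/sigma) <= l^(delta/sigma) <= l], so [D_k] is at most a fixed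
   power of [T]. *)
assert (Hx : Rpower (INR k) (/ sigma) <= l).
{ apply Rle_trans with (Rpower x (/ sigma)).
  - apply Rpower_le_base_pos; [lra|]. apply Rlt_le, Rinv_0_lt_compat; lra.
  - unfold x. rewrite Rpower_mult. apply Rle_trans with (Rpower l 1); [|rewrite Rpower_1; lra].
    apply Rle_Rpower; [lra|]. apply (Rmult_le_reg_r sigma); [lra|].
    rewrite Rmult_assoc, Rinv_l; lra. }
assert (Hb : (M / 2) ^ (2 * k) <= exp ((6 + K) * l)).
{ apply Rle_trans with (T ^ 6 * Dsum k sigma).
  - eapply Rle_trans; [exact Hg|]. apply Rle_trans with (T ^ 6 / 2 * (2 * Dsum k sigma)); [|right; field].
    apply Rmult_le_compat_l; lra.
  - replace ((6 + K) * l) with (INR 6 * l + K * l) by (simpl; ring). rewrite exp_plus, <- pow_exp.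
    unfold l at 1. rewrite exp_ln by lra. apply Rmult_le_compat_l; [lra|].
    eapply Rle_trans; [exact Dk|]. apply exp_le. apply Rmult_le_compat_l; lra. }
apply ln_le in Hb; [|apply pow_lt; lra].
rewrite ln_exp, ln_pow in Hb by lra.
rewrite mult_INR in Hb. simpl (INR 2) in Hb.
assert (LM : ln M = ln (M / 2) + ln 2) by (rewrite <- ln_mult by lra; f_equal; field).
assert (L2 : ln 2 <= 1).
{ rewrite <- (ln_exp 1). apply ln_le; [lra|]. pose proof (exp_ineq1_le 1). lra. }
assert (L0 : 0 <= ln (M / 2)) by (rewrite <- ln_1; apply ln_le; lra).
assert (xq : l = x * q).
{ unfold x, q. rewrite <- Rpower_plus. replace (delta + (1 - delta)) with 1 by ring. rewrite Rpower_1; lra. }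
assert (x * ln (M / 2) <= x * ((6 + K) * q)).
(* [2k >= k + 1 > x], so rounding [x] down to [k] is paid for by the exponent [2k]. *)
{ apply Rle_trans with (2 * INR k * ln (M / 2)); [apply Rmult_le_compat_r; lra|].
  eapply Rle_trans; [exact Hb|]. rewrite xq at 1. right. ring. }
assert (ln (M / 2) <= (6 + K) * q) by (apply (Rmult_le_reg_l x); lra).
rewrite LM. fold l. lra.
Qed.

(** * Cauchy's formula on a rectangle *)

Definition cont2 (f : R -> R -> C) (x y : R) : Prop :=
  continuity_2d_pt (fun u v => fst (f u v)) x y /\ continuity_2d_pt (fun u v => snd (f u v)) x y.

(* Continuity is tested on two-parameter families, the form in which differentiation under the integral
   sign needs it. *)
Definition Ccont (f : C -> C) (z : C) : Prop :=
  forall g x y, g x y = z -> cont2 g x y -> cont2 (fun u v => f (g u v)) x y.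

Lemma Ccont_const c z : Ccont (fun _ => c) z.
Proof. intros g x y _ _. split; apply continuity_2d_pt_const. Qed.

Lemma Ccont_id z : Ccont (fun w => w) z.
Proof. intros g x y _ H. exact H. Qed.

Lemma cont2_plus f g x y : cont2 f x y -> cont2 g x y -> cont2 (fun u v => f u v + g u v)%C x y.
Proof. intros [F1 F2] [G1 G2]. split; apply continuity_2d_pt_plus; assumption. Qed.

Lemma cont2_mult f g x y : cont2 f x y -> cont2 g x y -> cont2 (fun u v => f u v * g u v)%C x y.
Proof.
intros [F1 F2] [G1 G2]. split; simpl.
- apply continuity_2d_pt_minus; apply continuity_2d_pt_mult; assumption.
- apply continuity_2d_pt_plus; apply continuity_2d_pt_mult; assumption.
Qed.

Lemma Ccont_plus f g z : Ccont f z -> Ccont g z -> Ccont (fun w => f w + g w)%C z.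
Proof. intros F G h x y E H. apply cont2_plus; [apply F|apply G]; assumption. Qed.

Lemma Ccont_opp f z : Ccont f z -> Ccont (fun w => - f w)%C z.
Proof.
intros F h x y E H. destruct (F h x y E H). split; simpl; apply continuity_2d_pt_opp; assumption.
Qed.

Lemma Ccont_mult f g z : Ccont f z -> Ccont g z -> Ccont (fun w => f w * g w)%C z.
Proof. intros F G h x y E H. apply cont2_mult; [apply F|apply G]; assumption. Qed.

Lemma Ccont_inv f z : Ccont f z -> f z <> RtoC 0 -> Ccont (fun w => / f w)%C z.
Proof.
intros F N h x y E H. destruct (F h x y E H) as [A B].
assert (D : continuity_2d_pt (fun u v => / (fst (f (h u v)) ^ 2 + snd (f (h u v)) ^ 2)) x y).
{ apply continuity_2d_pt_inv.
  - simpl. apply continuity_2d_pt_plus; repeat (apply continuity_2d_pt_mult; [assumption|]);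
    apply continuity_2d_pt_const.
  - rewrite E. apply C_neq0_sq, N. }
split.
- apply (continuity_2d_pt_mult (fun u v => fst (f (h u v)))); assumption.
- apply (continuity_2d_pt_mult (fun u v => - snd (f (h u v)))); [apply continuity_2d_pt_opp|]; assumption.
Qed.

Lemma Ccont_cpow a f z : Ccont f z -> Ccont (fun w => cpow a (f w)) z.
Proof.
intros F h x y E H. destruct (F h x y E H) as [A B].
assert (A' : continuity_2d_pt (fun u v => exp (fst (f (h u v)) * ln a)) x y).
{ apply (continuity_1d_2d_pt_comp exp (fun u v => fst (f (h u v)) * ln a)).
  - apply derivable_continuous_pt, derivable_pt_exp.
  - apply continuity_2d_pt_mult; [assumption|apply continuity_2d_pt_const]. }
assert (B' : continuity_2d_pt (fun u v => snd (f (h u v)) * ln a) x y).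
{ apply continuity_2d_pt_mult; [assumption|apply continuity_2d_pt_const]. }
split; simpl; apply continuity_2d_pt_mult; try assumption.
- apply (continuity_1d_2d_pt_comp cos); [apply continuity_cos|exact B'].
- apply (continuity_1d_2d_pt_comp sin); [apply continuity_sin|exact B'].
Qed.

Lemma cont2_continuous f x y : cont2 f x y ->
  continuous (fun v => fst (f x v)) y /\ continuous (fun v => snd (f x v)) y.
Proof.
assert (K : forall g, continuity_2d_pt g x y -> continuous (fun v => g x v) y).
{ intros g H. apply continuity_pt_filterlim. intros eps He.
  destruct (H (mkposreal eps He)) as [d Hd].
  exists d. split; [apply cond_pos|]. intros v [_ Hv].
  apply (Hd x v); [|exact Hv]. replace (x - x) with 0 by ring. rewrite Rabs_R0. apply cond_pos. }
intros [A B]. split; [apply (K _ A)|apply (K _ B)].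
Qed.

Definition cint (f : R -> C) (a b : R) : C :=
  (RInt (fun t => fst (f t)) a b, RInt (fun t => snd (f t)) a b).

Definition seg (w0 u : C) (t : R) : C := (w0 + RtoC t * u)%C.

(** Continuity of [dPsi] is carried along because both differentiation under the integral sign and
    the fundamental theorem of calculus rely on it. *)
Record hol_near (Psi dPsi : C -> C) (z : C) : Prop := {
  hol_der : Chol Psi z (dPsi z);
  hol_cont : Ccont Psi z;
  hol_dcont : Ccont dPsi z }.

Lemma cont2_seg w0 u x y : cont2 (fun l t => RtoC l * seg w0 u t)%C x y.
Proof.
apply cont2_mult.
- split; simpl; [apply continuity_2d_pt_id1|apply continuity_2d_pt_const].
- apply cont2_plus; [split; apply continuity_2d_pt_const|].
  apply cont2_mult; [|split; apply continuity_2d_pt_const].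
  split; simpl; [apply continuity_2d_pt_id2|apply continuity_2d_pt_const].
Qed.

Section Homotopy.
Variables (Psi dPsi : C -> C) (w0 u : C) (a b e : R).
Hypothesis (Hab : a <= b) (He : 0 < e).
Hypothesis Hw : forall t, seg w0 u t <> RtoC 0.
Hypothesis HD : forall l t, - e < l < 1 + e -> a - e < t < b + e ->
  hol_near Psi dPsi (RtoC l * seg w0 u t)%C.

Lemma cont2_quot x y : cont2 (fun l t => u * / seg w0 u t)%C x y.
Proof.
apply cont2_mult; [split; apply continuity_2d_pt_const|].
apply (Ccont_inv (fun w => w) (seg w0 u y)); [apply Ccont_id|apply Hw|reflexivity|].
apply cont2_plus; [split; apply continuity_2d_pt_const|].
apply cont2_mult; [|split; apply continuity_2d_pt_const].
split; simpl; [apply continuity_2d_pt_id2|apply continuity_2d_pt_const].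
Qed.

(** The chain rule brings out the factor [w = seg w0 u t], which cancels the kernel [1 / w]: the
    derivative in [l] has no singular kernel left. *)
Lemma Rder_radial l t : - e < l < 1 + e -> a - e < t < b + e ->
  Rder (fun l => Psi (RtoC l * seg w0 u t) * (u * / seg w0 u t))%C l (dPsi (RtoC l * seg w0 u t) * u)%C.
Proof.
intros Hl Ht. eapply Rder_eq.
- apply Rder_mult; [|apply Rder_const].
  apply (hol_der _ _ _ (HD l t Hl Ht)); [reflexivity|].
  apply Rder_mult; [apply Rder_RtoC|apply Rder_const].
- cbv beta. field. apply Hw.
Qed.

Lemma seg_integrand_cont l t : - e < l < 1 + e -> a - e < t < b + e ->
  cont2 (fun l t => Psi (RtoC l * seg w0 u t) * (u * / seg w0 u t))%C l t.
Proof.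
intros Hl Ht. apply cont2_mult; [|apply cont2_quot].
apply (hol_cont _ _ _ (HD l t Hl Ht)); [reflexivity|apply cont2_seg].
Qed.

Lemma seg_derivative_cont l t : - e < l < 1 + e -> a - e < t < b + e ->
  cont2 (fun l t => dPsi (RtoC l * seg w0 u t) * u)%C l t.
Proof.
intros Hl Ht. apply cont2_mult; [|split; apply continuity_2d_pt_const].
apply (hol_dcont _ _ _ (HD l t Hl Ht)); [reflexivity|apply cont2_seg].
Qed.

Lemma locally_interval (P : R -> Prop) l : - e < l < 1 + e ->
  (forall x, - e < x < 1 + e -> P x) -> locally l P.
Proof.
intros Hl H.
assert (D : 0 < Rmin (l + e) (1 + e - l)) by (apply Rmin_pos; lra).
exists (mkposreal _ D). intros x Hx. unfold ball in Hx; simpl in Hx.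
unfold AbsRing_ball, abs, minus, plus, opp in Hx; simpl in Hx.
apply Rabs_def2 in Hx. pose proof (Rmin_l (l + e) (1 + e - l)). pose proof (Rmin_r (l + e) (1 + e - l)).
apply H. lra.
Qed.

(** Differentiation under the integral sign, for an abstract real coordinate [p]. The margin [e]
    provides the neighbourhood of [[0, 1] x [a, b]] on which the integrand must be regular. *)
Lemma seg_RInt_derive l : - e < l < 1 + e ->
  Rder (fun l => cint (fun t => Psi (RtoC l * seg w0 u t) * (u * / seg w0 u t))%C a b) l
    (cint (fun t => dPsi (RtoC l * seg w0 u t) * u)%C a b).
Proof.
intros Hl.
assert (K : forall p : C -> R,
  (forall f x m, Rder f x m -> is_derive (fun x => p (f x)) x (p m)) ->
  (forall f x y, cont2 f x y -> continuity_2d_pt (fun x y => p (f x y)) x y) ->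
  (forall f x y, cont2 f x y -> continuous (fun v => p (f x v)) y) ->
  is_derive (fun l => RInt (fun t => p (Psi (RtoC l * seg w0 u t) * (u * / seg w0 u t))%C) a b) l
    (RInt (fun t => p (dPsi (RtoC l * seg w0 u t) * u)%C) a b)).
{ intros p p1 p2 p3.
  assert (Dv : forall l t, - e < l < 1 + e -> a - e < t < b + e ->
    Derive (fun z => p (Psi (RtoC z * seg w0 u t) * (u * / seg w0 u t))%C) l = p (dPsi (RtoC l * seg w0 u t) * u)%C).
  { intros l' t Hl' Ht. apply is_derive_unique.
    apply (p1 (fun z => Psi (RtoC z * seg w0 u t) * (u * / seg w0 u t))%C). apply Rder_radial; assumption. }
  evar_last.
  - apply (is_derive_RInt_param (fun l t => p (Psi (RtoC l * seg w0 u t) * (u * / seg w0 u t))%C)).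
    + apply locally_interval; [assumption|]. intros x Hx t Ht.
      rewrite Rmin_left, Rmax_right in Ht by lra.
      eexists. apply (p1 (fun z => Psi (RtoC z * seg w0 u t) * (u * / seg w0 u t))%C).
      apply Rder_radial; lra.
    + intros t Ht. rewrite Rmin_left, Rmax_right in Ht by lra.
      apply (continuity_2d_pt_ext_loc (fun l t => p (dPsi (RtoC l * seg w0 u t) * u)%C)).
      * assert (D : 0 < Rmin e (Rmin (l + e) (1 + e - l))) by (repeat apply Rmin_pos; lra).
        exists (mkposreal _ D). intros x y Hx Hy. simpl in Hx, Hy.
        apply Rabs_def2 in Hx. apply Rabs_def2 in Hy.
        pose proof (Rmin_l e (Rmin (l + e) (1 + e - l))). pose proof (Rmin_r e (Rmin (l + e) (1 + e - l))).
        pose proof (Rmin_l (l + e) (1 + e - l)). pose proof (Rmin_r (l + e) (1 + e - l)).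
        symmetry. apply Dv; lra.
      * apply (p2 (fun l t => dPsi (RtoC l * seg w0 u t) * u)%C). apply seg_derivative_cont; lra.
    + apply locally_interval; [assumption|]. intros x Hx.
      apply (ex_RInt_continuous (V := R_CompleteNormedModule)). intros t Ht.
      rewrite Rmin_left, Rmax_right in Ht by lra.
      apply (p3 (fun l t => Psi (RtoC l * seg w0 u t) * (u * / seg w0 u t))%C). apply seg_integrand_cont; lra.
  - apply RInt_ext. intros t Ht. rewrite Rmin_left, Rmax_right in Ht by lra. apply Dv; lra. }
split; simpl.
- apply (K fst).
  + intros f x m [H _]. exact H.
  + intros f x y [H _]. exact H.
  + intros f x y H. apply (cont2_continuous f x y H).
- apply (K snd).
  + intros f x m [_ H]. exact H.
  + intros f x y [_ H]. exact H.
  + intros f x y H. apply (cont2_continuous f x y H).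
Qed.

(** [l dPsi (l w) u] is the [t]-derivative of [Psi (l w)]. The factor [l] stays on the left since
    dividing by it fails at [l = 0]. *)
Lemma seg_FTC l : - e < l < 1 + e ->
  (RtoC l * cint (fun t => dPsi (RtoC l * seg w0 u t) * u)%C a b =
   Psi (RtoC l * seg w0 u b) - Psi (RtoC l * seg w0 u a))%C.
Proof.
intros Hl.
assert (R : forall t, a <= t <= b -> Rder (fun t => Psi (RtoC l * seg w0 u t)%C) t (RtoC l * (dPsi (RtoC l * seg w0 u t) * u))%C).
{ intros t Ht. eapply Rder_eq.
  - apply (hol_der _ _ _ (HD l t Hl ltac:(lra)) (fun t => RtoC l * seg w0 u t)%C t (RtoC l * u)%C); [reflexivity|].
    eapply Rder_eq.
    + apply Rder_mult; [apply Rder_const|]. apply Rder_plus; [apply Rder_const|].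
      apply Rder_mult; [apply Rder_RtoC|apply Rder_const].
    + cbv beta. ring.
  - ring. }
assert (Cn : forall t, a <= t <= b -> cont2 (fun l' t => RtoC l * (dPsi (RtoC l' * seg w0 u t) * u))%C l t).
{ intros t Ht. apply cont2_mult; [split; apply continuity_2d_pt_const|]. apply seg_derivative_cont; lra. }
assert (Ex : forall t, a <= t <= b -> cont2 (fun l t => dPsi (RtoC l * seg w0 u t) * u)%C l t)
  by (intros; apply seg_derivative_cont; lra).
unfold cint. apply injective_projections.
- change (l * RInt (fun t => fst (dPsi (RtoC l * seg w0 u t) * u)%C) a b - 0 * RInt (fun t => snd (dPsi (RtoC l * seg w0 u t) * u)%C) a b =
    fst (Psi (RtoC l * seg w0 u b)%C) - fst (Psi (RtoC l * seg w0 u a)%C)).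
  rewrite Rmult_0_l, Rminus_0_r.
  assert (E := is_RInt_derive (V := R_CompleteNormedModule) (fun t => fst (Psi (RtoC l * seg w0 u t)%C))
    (fun t => fst (RtoC l * (dPsi (RtoC l * seg w0 u t) * u))%C) a b).
  rewrite Rmin_left, Rmax_right in E by lra.
  assert (E' := E (fun t Ht => proj1 (R t Ht)) (fun t Ht => proj1 (cont2_continuous _ _ _ (Cn t Ht)))).
  apply is_RInt_unique in E'.
  change (minus (fst (Psi (RtoC l * seg w0 u b)%C)) (fst (Psi (RtoC l * seg w0 u a)%C))) with
    (fst (Psi (RtoC l * seg w0 u b)%C) - fst (Psi (RtoC l * seg w0 u a)%C)) in E'.
  rewrite <- E'.
  rewrite <- (RInt_scal (V := R_CompleteNormedModule) (fun t => fst (dPsi (RtoC l * seg w0 u t) * u)%C)).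
  + apply RInt_ext. intros t _. simpl. unfold scal; simpl; unfold mult; simpl. ring.
  + apply (ex_RInt_continuous (V := R_CompleteNormedModule)). intros t Ht.
    rewrite Rmin_left, Rmax_right in Ht by lra.
    exact (proj1 (cont2_continuous _ _ _ (Ex t Ht))).
- change (l * RInt (fun t => snd (dPsi (RtoC l * seg w0 u t) * u)%C) a b + 0 * RInt (fun t => fst (dPsi (RtoC l * seg w0 u t) * u)%C) a b =
    snd (Psi (RtoC l * seg w0 u b)%C) - snd (Psi (RtoC l * seg w0 u a)%C)).
  rewrite Rmult_0_l, Rplus_0_r.
  assert (E := is_RInt_derive (V := R_CompleteNormedModule) (fun t => snd (Psi (RtoC l * seg w0 u t)%C))
    (fun t => snd (RtoC l * (dPsi (RtoC l * seg w0 u t) * u))%C) a b).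
  rewrite Rmin_left, Rmax_right in E by lra.
  assert (E' := E (fun t Ht => proj2 (R t Ht)) (fun t Ht => proj2 (cont2_continuous _ _ _ (Cn t Ht)))).
  apply is_RInt_unique in E'.
  change (minus (snd (Psi (RtoC l * seg w0 u b)%C)) (snd (Psi (RtoC l * seg w0 u a)%C))) with
    (snd (Psi (RtoC l * seg w0 u b)%C) - snd (Psi (RtoC l * seg w0 u a)%C)) in E'.
  rewrite <- E'.
  rewrite <- (RInt_scal (V := R_CompleteNormedModule) (fun t => snd (dPsi (RtoC l * seg w0 u t) * u)%C)).
  + apply RInt_ext. intros t _. simpl. unfold scal; simpl; unfold mult; simpl. ring.
  + apply (ex_RInt_continuous (V := R_CompleteNormedModule)). intros t Ht.
    rewrite Rmin_left, Rmax_right in Ht by lra.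
    exact (proj2 (cont2_continuous _ _ _ (Ex t Ht))).
Qed.

End Homotopy.

Lemma cint_const_scal c f a b : (forall t, Rmin a b <= t <= Rmax a b ->
   continuous (fun t => fst (f t)) t /\ continuous (fun t => snd (f t)) t) ->
  cint (fun t => c * f t)%C a b = (c * cint f a b)%C.
Proof.
intros H.
assert (E1 : ex_RInt (fun t => fst (f t)) a b).
{ apply (ex_RInt_continuous (V := R_CompleteNormedModule)). intros t Ht. apply H, Ht. }
assert (E2 : ex_RInt (fun t => snd (f t)) a b).
{ apply (ex_RInt_continuous (V := R_CompleteNormedModule)). intros t Ht. apply H, Ht. }
unfold cint. apply injective_projections; simpl.
- apply is_RInt_unique. apply @is_RInt_minus; apply @is_RInt_scal; apply RInt_correct; assumption.
- apply is_RInt_unique. apply @is_RInt_plus; apply @is_RInt_scal; apply RInt_correct; assumption.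
Qed.

Lemma cint_const u a b : cint (fun _ => u) a b = (RtoC (b - a) * u)%C.
Proof.
unfold cint. rewrite !RInt_const. apply injective_projections; simpl; unfold scal; simpl; unfold mult; simpl; ring.
Qed.

Lemma cint_ext f g a b : (forall t, Rmin a b < t < Rmax a b -> f t = g t) -> cint f a b = cint g a b.
Proof.
intros H. unfold cint. f_equal; apply RInt_ext; intros t Ht; rewrite H by exact Ht; reflexivity.
Qed.

Lemma continuous_seg_quot w0 u t : (forall t, seg w0 u t <> RtoC 0) ->
  continuous (fun t => fst (u * / seg w0 u t)%C) t /\ continuous (fun t => snd (u * / seg w0 u t)%C) t.
Proof.
intros H. apply (cont2_continuous (fun _ t => u * / seg w0 u t)%C 0 t).
apply cont2_quot. exact H.
Qed.

(** The integral of [Psi w dw / w] along a segment; the kernel [1 / w] is built in, so [Psi] is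
    always the regular factor. *)
Definition side (Psi : C -> C) (w0 u : C) (a b : R) : C :=
  cint (fun t => Psi (seg w0 u t) * (u * / seg w0 u t))%C a b.

Definition rect_int (Psi : C -> C) (eta c V : R) : C :=
  (side Psi (0, - V)%R (RtoC 1) (- eta)%R c + side Psi (c, 0)%R Ci (- V)%R V
   - side Psi (0, V)%R (RtoC 1) (- eta)%R c - side Psi (- eta, 0)%R Ci (- V)%R V)%C.

Lemma seg_h_neq0 v t : v <> 0 -> seg (0, v)%R (RtoC 1) t <> RtoC 0.
Proof. intros Hv E. apply (f_equal snd) in E. unfold seg in E. simpl in E. apply Hv. lra. Qed.

Lemma seg_v_neq0 c t : c <> 0 -> seg (c, 0)%R Ci t <> RtoC 0.
Proof. intros Hc E. apply (f_equal fst) in E. unfold seg in E. simpl in E. apply Hc. lra. Qed.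

Definition kappa (eta c V : R) : C := rect_int (fun _ => RtoC 1) eta c V.

Lemma side_scal z Psi w0 u a b : (forall t, seg w0 u t <> RtoC 0) ->
  (forall t, Psi (RtoC 0 * seg w0 u t)%C = z) ->
  cint (fun t => Psi (RtoC 0 * seg w0 u t) * (u * / seg w0 u t))%C a b = (z * side (fun _ => RtoC 1) w0 u a b)%C.
Proof.
intros Hw Hz.
rewrite (cint_ext _ (fun t => z * (u * / seg w0 u t))%C) by (intros t _; rewrite Hz; reflexivity).
rewrite (cint_const_scal z (fun t => u * / seg w0 u t)%C) by (intros t _; apply continuous_seg_quot, Hw).
f_equal. unfold side. apply cint_ext. intros t _. ring.
Qed.

(* The integral of [Psi (l w) / w] over the rectangle does not depend on [l] in [0, 1]: its derivative is
   the integral of the exact form [dPsi (l w)]. *)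
Lemma cauchy_rect (Psi dPsi : C -> C) eta c V : 0 < eta -> 0 < c -> 0 < V ->
  (forall z, - (2 * V) < snd z -> hol_near Psi dPsi z) ->
  rect_int Psi eta c V = (Psi (RtoC 0) * kappa eta c V)%C.
Proof.
intros He Hc HV HD.
(* Scaled points then have imaginary part above [- (5/4) (5/4) V], hence above [- 2V]. *)
set (e := Rmin (/ 4) (V / 4)).
assert (e0 : 0 < e) by (apply Rmin_pos; lra).
assert (e1 : e <= / 4) by apply Rmin_l. assert (e2 : e <= V / 4) by apply Rmin_r.
assert (DB : forall l t, - e < l < 1 + e -> - eta - e < t < c + e -> hol_near Psi dPsi (RtoC l * seg (0, - V)%R (RtoC 1) t)%C).
{ intros l t Hl Ht. apply HD. unfold seg. simpl. nra. }
assert (DT : forall l t, - e < l < 1 + e -> - eta - e < t < c + e -> hol_near Psi dPsi (RtoC l * seg (0, V)%R (RtoC 1) t)%C).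
{ intros l t Hl Ht. apply HD. unfold seg. simpl. nra. }
assert (DR : forall l t, - e < l < 1 + e -> - V - e < t < V + e -> hol_near Psi dPsi (RtoC l * seg (c, 0)%R Ci t)%C).
{ intros l t Hl Ht. apply HD. unfold seg. simpl. nra. }
assert (DL : forall l t, - e < l < 1 + e -> - V - e < t < V + e -> hol_near Psi dPsi (RtoC l * seg (- eta, 0)%R Ci t)%C).
{ intros l t Hl Ht. apply HD. unfold seg. simpl. nra. }
assert (WB : forall t, seg (0, - V)%R (RtoC 1) t <> RtoC 0) by (intros t; apply seg_h_neq0; lra).
assert (WT : forall t, seg (0, V)%R (RtoC 1) t <> RtoC 0) by (intros t; apply seg_h_neq0; lra).
assert (WR : forall t, seg (c, 0)%R Ci t <> RtoC 0) by (intros t; apply seg_v_neq0; lra).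
assert (WL : forall t, seg (- eta, 0)%R Ci t <> RtoC 0) by (intros t; apply seg_v_neq0; lra).
set (S := fun w0 u a b l => cint (fun t => Psi (RtoC l * seg w0 u t) * (u * / seg w0 u t))%C a b).
set (S' := fun w0 u a b l => cint (fun t => dPsi (RtoC l * seg w0 u t) * u)%C a b).
set (J := fun l => (S (0, - V)%R (RtoC 1) (- eta)%R c l + S (c, 0)%R Ci (- V)%R V l
   - S (0, V)%R (RtoC 1) (- eta)%R c l - S (- eta, 0)%R Ci (- V)%R V l)%C).
set (J' := fun l => (S' (0, - V)%R (RtoC 1) (- eta)%R c l + S' (c, 0)%R Ci (- V)%R V l
   - S' (0, V)%R (RtoC 1) (- eta)%R c l - S' (- eta, 0)%R Ci (- V)%R V l)%C).
assert (HJ : forall l, 0 <= l <= 1 -> Rder J l (J' l)).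
{ intros l Hl. unfold J, J'. repeat apply Rder_minus; try apply Rder_plus.
  - apply (seg_RInt_derive Psi dPsi (0, - V) (RtoC 1) (- eta) c e); auto; lra.
  - apply (seg_RInt_derive Psi dPsi (c, 0) Ci (- V) V e); auto; lra.
  - apply (seg_RInt_derive Psi dPsi (0, V) (RtoC 1) (- eta) c e); auto; lra.
  - apply (seg_RInt_derive Psi dPsi (- eta, 0) Ci (- V) V e); auto; lra. }
(* For [l = 0] the integrand is constant and the displacements of the four sides cancel; for other
   [l] the boundary values of [seg_FTC] cancel at the corners. *)
assert (Z : forall l, 0 <= l <= 1 -> J' l = RtoC 0).
{ intros l Hl. destruct (Req_dec l 0) as [->|Hl0].
  - unfold J', S'.
    assert (E : forall w0 u a b, cint (fun t => dPsi (RtoC 0 * seg w0 u t) * u)%C a b = (RtoC (b - a) * (dPsi (RtoC 0) * u))%C).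
    { intros w0 u a b. rewrite <- cint_const. apply cint_ext. intros t _.
      replace (RtoC 0 * seg w0 u t)%C with (RtoC 0) by ring. reflexivity. }
    rewrite !E. ring.
  - assert (B := seg_FTC Psi dPsi (0, - V) (RtoC 1) (- eta) c e ltac:(lra) e0 DB l ltac:(lra)).
    assert (R := seg_FTC Psi dPsi (c, 0) Ci (- V) V e ltac:(lra) e0 DR l ltac:(lra)).
    assert (T := seg_FTC Psi dPsi (0, V) (RtoC 1) (- eta) c e ltac:(lra) e0 DT l ltac:(lra)).
    assert (L := seg_FTC Psi dPsi (- eta, 0) Ci (- V) V e ltac:(lra) e0 DL l ltac:(lra)).
    assert (c1 : seg (0, - V)%R (RtoC 1) c = seg (c, 0)%R Ci (- V)) by (apply injective_projections; simpl; ring).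
    assert (c2 : seg (c, 0)%R Ci V = seg (0, V)%R (RtoC 1) c) by (apply injective_projections; simpl; ring).
    assert (c3 : seg (0, V)%R (RtoC 1) (- eta) = seg (- eta, 0)%R Ci V) by (apply injective_projections; simpl; ring).
    assert (c4 : seg (- eta, 0)%R Ci (- V) = seg (0, - V)%R (RtoC 1) (- eta)) by (apply injective_projections; simpl; ring).
    rewrite c1 in B. rewrite c2 in R. rewrite c3 in T. rewrite c4 in L.
    assert (E : (RtoC l * J' l = RtoC 0)%C).
    { unfold J', S'.
      replace (RtoC l * _)%C with
       (RtoC l * cint (fun t => dPsi (RtoC l * seg (0, - V)%R (RtoC 1) t) * (RtoC 1))%C (- eta) c +
        RtoC l * cint (fun t => dPsi (RtoC l * seg (c, 0)%R Ci t) * Ci)%C (- V) V -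
        RtoC l * cint (fun t => dPsi (RtoC l * seg (0, V)%R (RtoC 1) t) * (RtoC 1))%C (- eta) c -
        RtoC l * cint (fun t => dPsi (RtoC l * seg (- eta, 0)%R Ci t) * Ci)%C (- V) V)%C by ring.
      rewrite B, R, T, L. ring. }
    assert (Hl' : RtoC l <> RtoC 0) by (intros F; apply Hl0; apply (f_equal fst) in F; exact F).
    replace (J' l) with (/ RtoC l * (RtoC l * J' l))%C by (field; exact Hl').
    rewrite E. ring. }
assert (M := Cmvt_le J J' 0 1 0 ltac:(lra) HJ).
assert (M' : Cmod (J 1 - J 0) <= 0 * (1 - 0)).
{ apply M. intros x Hx. rewrite Z by exact Hx. rewrite Cmod_0. lra. }
assert (E1 : (J 1 - J 0)%C = RtoC 0).
{ apply Cmod_eq_0. pose proof (Cmod_ge_0 (J 1 - J 0)). lra. }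
assert (E2 : J 1 = rect_int Psi eta c V).
{ assert (F : forall w0 u a b, S w0 u a b 1 = side Psi w0 u a b).
  { intros. unfold S, side. apply cint_ext. intros t _. rewrite Cmult_1_l. reflexivity. }
  unfold J, rect_int. rewrite !F. reflexivity. }
assert (E3 : J 0 = (Psi (RtoC 0) * kappa eta c V)%C).
{ unfold J, S. 
  rewrite !(side_scal (Psi (RtoC 0)) Psi); auto; try (intros t; f_equal; ring).
  unfold kappa, rect_int. ring. }
rewrite <- E2, <- E3. replace (J 1) with ((J 1 - J 0) + J 0)%C by ring. rewrite E1. ring.
Qed.

Lemma RInt_le_const (f : R -> R) m a b : a <= b -> ex_RInt f a b -> (forall x, a < x < b -> f x <= m) ->
  RInt f a b <= m * (b - a).
Proof.
intros Hab He Hf.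
assert (H : RInt f a b <= RInt (fun _ => m) a b) by (apply RInt_le; auto; apply ex_RInt_const).
rewrite RInt_const in H. unfold scal in H; simpl in H; unfold mult in H; simpl in H. lra.
Qed.

Lemma RInt_le_0 (f : R -> R) a b : a <= b -> ex_RInt f a b -> (forall x, f x <= 0) -> RInt f a b <= 0.
Proof.
intros Hab He Hf. eapply Rle_trans; [apply (RInt_le_const f 0); auto|]. lra.
Qed.

(* [kappa] is [2 i pi], but a lower bound suffices. *)
Lemma Cmod_kappa_ge1 eta c V : 0 < eta -> 0 < c -> c <= V -> 1 <= Cmod (kappa eta c V).
Proof.
intros He Hc HV.
eapply Rle_trans; [|apply snd_le_Cmod]. eapply Rle_trans; [|apply Rle_abs].
unfold kappa, rect_int.
assert (WB : forall t, seg (0, - V)%R (RtoC 1) t <> RtoC 0) by (intros t; apply seg_h_neq0; lra).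
assert (WT : forall t, seg (0, V)%R (RtoC 1) t <> RtoC 0) by (intros t; apply seg_h_neq0; lra).
assert (WR : forall t, seg (c, 0)%R Ci t <> RtoC 0) by (intros t; apply seg_v_neq0; lra).
assert (WL : forall t, seg (- eta, 0)%R Ci t <> RtoC 0) by (intros t; apply seg_v_neq0; lra).
set (f := fun w0 u t => snd (RtoC 1 * (u * / seg w0 u t))%C).
assert (Ex : forall w0 u x y, (forall t, seg w0 u t <> RtoC 0) -> ex_RInt (f w0 u) x y).
{ intros w0 u x y Hw. apply (ex_RInt_continuous (V := R_CompleteNormedModule)). intros t _.
  unfold f. apply (continuous_ext (fun t => snd (u * / seg w0 u t)%C)).
  - intros v. rewrite Cmult_1_l. reflexivity.
  - apply continuous_seg_quot, Hw. }
change (1 <= RInt (f (0, - V) (RtoC 1)) (- eta) c + RInt (f (c, 0) Ci) (- V) V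
  + - RInt (f (0, V) (RtoC 1)) (- eta) c + - RInt (f (- eta, 0) Ci) (- V) V).
assert (FB : forall t, f (0, - V) (RtoC 1) t = V / (t ^ 2 + V ^ 2)).
{ intros t. unfold f, seg. simpl. field. nra. }
assert (FT : forall t, - f (0, V) (RtoC 1) t = V / (t ^ 2 + V ^ 2)).
{ intros t. unfold f, seg. simpl. field. nra. }
assert (FR : forall t, f (c, 0) Ci t = c / (c ^ 2 + t ^ 2)).
{ intros t. unfold f, seg. simpl. field. nra. }
assert (FL : forall t, - f (- eta, 0) Ci t = eta / (eta ^ 2 + t ^ 2)).
{ intros t. unfold f, seg. simpl. field. nra. }
assert (B0 : 0 <= RInt (f (0, - V) (RtoC 1)) (- eta) c).
{ apply RInt_ge_0; [lra|apply Ex, WB|]. intros t _. rewrite FB.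
  apply Rmult_le_pos; [lra|]. apply Rlt_le, Rinv_0_lt_compat. nra. }
assert (T0 : RInt (f (0, V) (RtoC 1)) (- eta) c <= 0).
{ apply RInt_le_0; [lra|apply Ex, WT|]. intros t.
  assert (0 <= - f (0, V) (RtoC 1) t); [|lra]. rewrite FT.
  apply Rmult_le_pos; [lra|]. apply Rlt_le, Rinv_0_lt_compat. nra. }
assert (L0 : RInt (f (- eta, 0) Ci) (- V) V <= 0).
{ apply RInt_le_0; [lra|apply Ex, WL|]. intros t.
  assert (0 <= - f (- eta, 0) Ci t); [|lra]. rewrite FL.
  apply Rmult_le_pos; [lra|]. apply Rlt_le, Rinv_0_lt_compat. nra. }
(* All four sides contribute nonnegatively to the imaginary part. The right one alone gives 1:
   [c / (c^2 + t^2) >= 1 / (2c)] on [[-c, c]], which lies in [[-V, V]]. *)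
assert (R0 : / (2 * c) * (c - - c) <= RInt (f (c, 0) Ci) (- V) V).
{ apply RInt_ge_sub; try lra.
  - intros x y _ _. apply Ex, WR.
  - intros x. rewrite FR. apply Rmult_le_pos; [lra|]. apply Rlt_le, Rinv_0_lt_compat. nra.
  - intros x Hx. rewrite FR. assert (Hp : 0 < c ^ 2 + x ^ 2) by nra. apply (Rmult_le_reg_r (2 * c * (c ^ 2 + x ^ 2))); [nra|].
    replace (/ (2 * c) * (2 * c * (c ^ 2 + x ^ 2))) with (c ^ 2 + x ^ 2) by (field; lra).
    replace (c / (c ^ 2 + x ^ 2) * (2 * c * (c ^ 2 + x ^ 2))) with (2 * c ^ 2) by (field; lra).
    nra. }
replace (/ (2 * c) * (c - - c)) with 1 in R0 by (field; lra).
lra.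
Qed.

(** * Mean values of Dirichlet polynomials *)

Lemma is_RInt_cos L A B : L <> 0 ->
  exists I, is_RInt (fun t => cos (t * L)) A B I /\ Rabs I <= 2 / Rabs L.
Proof.
intros HL. exists (sin (B * L) / L - sin (A * L) / L). split.
- apply (is_RInt_derive (V := R_CompleteNormedModule) (fun t => sin (t * L) / L) (fun t => cos (t * L))).
  + intros x _. auto_derive; [exact I|]. field. exact HL.
  + intros x _. apply (ex_derive_continuous (V := R_NormedModule)). auto_derive. exact I.
- replace (sin (B * L) / L - sin (A * L) / L) with ((sin (B * L) - sin (A * L)) / L) by (field; exact HL).
  unfold Rdiv. rewrite Rabs_mult, Rabs_inv. apply Rmult_le_compat_r.
  + apply Rlt_le, Rinv_0_lt_compat, Rabs_pos_lt, HL.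
  + pose proof (SIN_bound (B * L)). pose proof (SIN_bound (A * L)). apply Rabs_le. lra.
Qed.

(** The spacing of the frequencies [ln n]: each off-diagonal cosine integral is therefore at most
    [2N], whatever the interval. *)
Lemma ln_gap n m : (1 <= n < m)%nat -> / INR m <= ln (INR m) - ln (INR n).
Proof.
intros H.
assert (Hn : 0 < INR n) by (apply lt_0_INR; lia).
assert (Hm : 0 < INR m) by (apply lt_0_INR; lia).
assert (Hg : INR n + 1 <= INR m) by (rewrite <- S_INR; apply le_INR; lia).
assert (E : ln (INR n) = ln (INR m) + ln (INR n / INR m)).
{ rewrite <- ln_mult; [|assumption|apply Rdiv_lt_0_compat; assumption]. f_equal. field. lra. }
assert (B : ln (INR n / INR m) <= INR n / INR m - 1).
{ assert (0 < INR n / INR m) by (apply Rdiv_lt_0_compat; assumption).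
  pose proof (exp_ineq1_le (ln (INR n / INR m))) as X. rewrite exp_ln in X by assumption. lra. }
assert (/ INR m <= 1 - INR n / INR m); [|lra].
apply (Rmult_le_reg_r (INR m)); [assumption|]. rewrite Rinv_l by lra.
replace ((1 - INR n / INR m) * INR m) with (INR m - INR n) by (field; lra). lra.
Qed.

Lemma is_RInt_cross (a : nat -> R) M m N A B : (M < m <= N)%nat ->
  exists I, is_RInt (fun t => rsum (fun n => a n * cos (t * (ln (INR m) - ln (INR n)))) M) A B I /\
    Rabs I <= 2 * INR N * rsum (fun n => Rabs (a n)) M.
Proof.
intros HM. induction M as [|M IH].
- exists 0. split.
  + simpl. evar_last; [apply (is_RInt_const (V := R_NormedModule))|]. unfold scal; simpl; unfold mult; simpl; ring.
  + rewrite Rabs_R0. simpl. lra.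
- destruct (IH ltac:(lia)) as [I [HI BI]].
  assert (Hg := ln_gap (S M) m ltac:(lia)).
  assert (Hm : 0 < INR m) by (apply lt_0_INR; lia).
  assert (Hmi : 0 < / INR m) by (apply Rinv_0_lt_compat; assumption).
  set (L := ln (INR m) - ln (INR (S M))) in *.
  destruct (is_RInt_cos L A B ltac:(lra)) as [K [HK BK]].
  exists (I + a (S M) * K). split.
  + apply (is_RInt_plus (V := R_NormedModule)
      (fun t => rsum (fun n => a n * cos (t * (ln (INR m) - ln (INR n)))) M)
      (fun t => a (S M) * cos (t * L))); [exact HI|].
    apply (is_RInt_scal (V := R_NormedModule)). exact HK.
  + rewrite rsumS. eapply Rle_trans; [apply Rabs_triang|]. rewrite Rabs_mult.
    assert (HN : INR m <= INR N) by (apply le_INR; lia).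
    assert (Rabs K <= 2 * INR N).
    { eapply Rle_trans; [exact BK|]. rewrite Rabs_pos_eq by lra.
      unfold Rdiv. apply Rmult_le_compat_l; [lra|].
      apply Rle_trans with (/ / INR m); [apply Rinv_le_contravar; lra|]. rewrite Rinv_inv. exact HN. }
    assert (H0 := Rabs_pos (a (S M))).
    assert (Rabs (a (S M)) * Rabs K <= Rabs (a (S M)) * (2 * INR N)) by (apply Rmult_le_compat_l; assumption).
    lra.
Qed.

Lemma rsum_cauchy_schwarz (a : nat -> R) N :
  rsum (fun n => Rabs (a n)) N ^ 2 <= INR N * rsum (fun n => a n ^ 2) N.
Proof.
induction N as [|N IH]; [simpl; lra|].
rewrite !rsumS, S_INR. set (S := rsum (fun n => Rabs (a n)) N) in *. set (Q := rsum (fun n => a n ^ 2) N) in *.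
set (x := Rabs (a (Datatypes.S N))).
assert (Ex : a (Datatypes.S N) ^ 2 = x ^ 2) by (unfold x; rewrite pow2_abs; reflexivity).
rewrite Ex.
assert (x0 : 0 <= x) by apply Rabs_pos. assert (n0 := pos_INR N). set (n := INR N) in *.
assert (Q0 : 0 <= Q).
{ unfold Q. pose proof (rsum_mono (fun n => a n ^ 2) 0 N (fun n _ => pow2_ge_0 _)) as H. exact H. }
assert (S0 : 0 <= S).
{ unfold S. pose proof (rsum_mono (fun n => Rabs (a n)) 0 N (fun n _ => Rabs_pos _)) as H. exact H. }
(* The arithmetic-geometric mean inequality for [Q] and [n x^2], combined with the induction
   hypothesis [S^2 <= n Q]. *)
assert (H : 2 * S * x <= Q + n * x ^ 2).
{ apply Rsqr_incr_0_var; [|nra]. unfold Rsqr.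
  assert (0 <= (Q - n * x ^ 2) ^ 2) by apply pow2_ge_0.
  assert (S ^ 2 * x ^ 2 <= n * Q * x ^ 2) by (apply Rmult_le_compat_r; [apply pow2_ge_0|exact IH]).
  nra. }
nra.
Qed.

(** Terms are added one at a time: the new one contributes its square, integrated exactly, and a
    cross term with the previous ones, which [is_RInt_cross] bounds. *)
Lemma is_RInt_trig_sq (a : nat -> R) M N A B : (M <= N)%nat ->
  exists I, is_RInt (fun t => rsum (fun n => a n * cos (t * ln (INR n))) M ^ 2 +
                              rsum (fun n => a n * sin (t * ln (INR n))) M ^ 2) A B I /\
    Rabs (I - (B - A) * rsum (fun n => a n ^ 2) M) <= 2 * INR N * rsum (fun n => Rabs (a n)) M ^ 2.
Proof.
intros HM. induction M as [|M IH].
- exists 0. split.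
  + eapply is_RInt_ext; [|evar_last; [apply (is_RInt_const (V := R_NormedModule) A B 0)|]].
    * intros t _. simpl. ring.
    * unfold scal; simpl; unfold mult; simpl; ring.
  + simpl. rewrite !Rmult_0_l, !Rmult_0_r, Rminus_0_r, Rabs_R0. lra.
- destruct (IH ltac:(lia)) as [I [HI BI]].
  destruct (is_RInt_cross a M (S M) N A B ltac:(lia)) as [K [HK BK]].
  set (x := a (S M)).
  exists (I + (2 * x * K + (B - A) * x ^ 2)). split.
  + eapply is_RInt_ext; [|apply (is_RInt_plus (V := R_NormedModule)); [exact HI|];
      apply (is_RInt_plus (V := R_NormedModule)); [apply (is_RInt_scal (V := R_NormedModule)); exact HK|];
      apply (is_RInt_const (V := R_NormedModule))].
    intros t _. cbv beta. rewrite !rsumS. unfold plus, scal; simpl; unfold mult; simpl.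
    fold x.
    assert (E : forall M', rsum (fun n => a n * cos (t * (ln (INR (S M)) - ln (INR n)))) M' =
      rsum (fun n => a n * cos (t * ln (INR n))) M' * cos (t * ln (INR (S M))) +
      rsum (fun n => a n * sin (t * ln (INR n))) M' * sin (t * ln (INR (S M)))).
    { induction M' as [|M' IHM]; [simpl; ring|]. rewrite !rsumS, IHM.
      rewrite Rmult_minus_distr_l, cos_minus. ring. }
    change (match M with 0%nat => 1 | S _ => INR M + 1 end) with (INR (S M)).
    rewrite E.
    assert (T := sin2_cos2 (t * ln (INR (S M)))). unfold Rsqr in T.
    set (c := cos (t * ln (INR (S M)))) in *. set (s := sin (t * ln (INR (S M)))) in *.
    set (X := rsum (fun n => a n * cos (t * ln (INR n))) M).
    set (Y := rsum (fun n => a n * sin (t * ln (INR n))) M).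
    transitivity (X ^ 2 + Y ^ 2 + (2 * x * (X * c + Y * s) + x * x * (s * s + c * c))); [rewrite T|]; ring.
  + rewrite !rsumS. fold x.
    replace (I + (2 * x * K + (B - A) * x ^ 2) - (B - A) * (rsum (fun n => a n ^ 2) M + x ^ 2)) with
      ((I - (B - A) * rsum (fun n => a n ^ 2) M) + 2 * x * K) by ring.
    eapply Rle_trans; [apply Rabs_triang|].
    assert (E2 : Rabs (2 * x * K) = 2 * Rabs x * Rabs K) by (rewrite !Rabs_mult, (Rabs_pos_eq 2); lra).
    rewrite E2.
    assert (x0 := Rabs_pos x). assert (n0 := pos_INR N).
    set (S' := rsum (fun n => Rabs (a n)) M) in *.
    assert (2 * Rabs x * Rabs K <= 2 * Rabs x * (2 * INR N * S')) by (apply Rmult_le_compat_l; lra).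
    assert (0 <= INR N * Rabs x ^ 2) by (apply Rmult_le_pos; [assumption|apply pow2_ge_0]).
    nra.
Qed.

Definition dirp (a : nat -> R) (sigma : R) (N : nat) (t : R) : C :=
  csum (fun n => RtoC (a n) * cpow (INR n) (- (sigma, t)))%C N.

(** The error [N^2] per unit of mass is weaker than the optimal [N], but the lengths used are of
    size [T^(1/8)], so it remains far below [T]. *)
Lemma mean_value_dirp (a : nat -> R) sigma N A B :
  exists I, is_RInt (fun t => Cmod (dirp a sigma N t) ^ 2) A B I /\
    Rabs (I - (B - A) * rsum (fun n => a n ^ 2 / Rpower (INR n) (2 * sigma)) N) <=
    2 * INR N ^ 2 * rsum (fun n => a n ^ 2 / Rpower (INR n) (2 * sigma)) N.
Proof.
set (b := fun n => a n * Rpower (INR n) (- sigma)).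
assert (Eb : rsum (fun n => a n ^ 2 / Rpower (INR n) (2 * sigma)) N = rsum (fun n => b n ^ 2) N).
{ apply rsum_ext. intros n _. unfold b. rewrite Rpow_mult_distr. unfold Rdiv. f_equal.
  rewrite <- Rpower_Ropp, <- Rpower_pow by apply Rpower_pos. rewrite Rpower_mult. f_equal. simpl. ring. }
rewrite Eb.
destruct (is_RInt_trig_sq b N N A B (Nat.le_refl N)) as [I [HI BI]].
exists I. split.
- eapply is_RInt_ext; [|exact HI]. intros t _. cbv beta. rewrite Cmod_sqr. unfold dirp. rewrite csum_pair. simpl fst. simpl snd.
  f_equal.
  + f_equal. apply rsum_ext. intros n _. unfold b, Rpower. simpl.
    replace (- t * ln (INR n)) with (- (t * ln (INR n))) by ring. rewrite cos_neg. ring.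
  + transitivity ((- rsum (fun n => b n * sin (t * ln (INR n))) N) ^ 2); [ring|]. f_equal.
    replace (- rsum (fun n => b n * sin (t * ln (INR n))) N) with (-1 * rsum (fun n => b n * sin (t * ln (INR n))) N) by ring.
    rewrite <- rsum_scal.
    apply rsum_ext. intros n _. unfold b, Rpower. simpl.
    replace (- t * ln (INR n)) with (- (t * ln (INR n))) by ring. rewrite sin_neg. ring.
- eapply Rle_trans; [exact BI|].
  assert (C := rsum_cauchy_schwarz b N). assert (n0 := pos_INR N). 
  apply Rle_trans with (2 * INR N * (INR N * rsum (fun n => b n ^ 2) N)); [apply Rmult_le_compat_l; lra|].
  right. ring.
Qed.

(** * The contour integral *)

(** The derivative is quantified away so that closure properties compose without tracking its
    formula. *)
Definition hol_on (D : C -> Prop) (f : C -> C) : Prop :=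
  exists df, forall z, D z -> hol_near f df z.

Lemma hol_on_const D c : hol_on D (fun _ => c).
Proof.
exists (fun _ => RtoC 0). intros z _. split; [apply Chol_const|apply Ccont_const|apply Ccont_const].
Qed.

Lemma hol_on_id D : hol_on D (fun w => w).
Proof.
exists (fun _ => RtoC 1). intros z _. split; [apply Chol_id|apply Ccont_id|apply Ccont_const].
Qed.

Lemma hol_on_plus D f g : hol_on D f -> hol_on D g -> hol_on D (fun w => f w + g w)%C.
Proof.
intros [f' F] [g' G]. exists (fun w => f' w + g' w)%C. intros z Hz.
destruct (F z Hz) as [F1 F2 F3]. destruct (G z Hz) as [G1 G2 G3].
split; [apply Chol_plus|apply Ccont_plus|apply Ccont_plus]; assumption.
Qed.

Lemma hol_on_opp D f : hol_on D f -> hol_on D (fun w => - f w)%C.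
Proof.
intros [f' F]. exists (fun w => - f' w)%C. intros z Hz.
destruct (F z Hz) as [F1 F2 F3].
split; [apply Chol_opp|apply Ccont_opp|apply Ccont_opp]; assumption.
Qed.

Lemma hol_on_minus D f g : hol_on D f -> hol_on D g -> hol_on D (fun w => f w - g w)%C.
Proof. intros F G. apply hol_on_plus; [exact F|apply hol_on_opp, G]. Qed.

Lemma hol_on_mult D f g : hol_on D f -> hol_on D g -> hol_on D (fun w => f w * g w)%C.
Proof.
intros [f' F] [g' G]. exists (fun w => f' w * g w + f w * g' w)%C. intros z Hz.
destruct (F z Hz) as [F1 F2 F3]. destruct (G z Hz) as [G1 G2 G3].
split; [apply Chol_mult; assumption|apply Ccont_mult; assumption|].
apply Ccont_plus; apply Ccont_mult; assumption.
Qed.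

Lemma hol_on_inv D f : hol_on D f -> (forall z, D z -> f z <> RtoC 0) -> hol_on D (fun w => / f w)%C.
Proof.
intros [f' F] N. exists (fun w => - (/ f w * / f w) * f' w)%C. intros z Hz.
destruct (F z Hz) as [F1 F2 F3]. specialize (N z Hz).
assert (I : Ccont (fun w => / f w)%C z) by (apply Ccont_inv; assumption).
split; [apply Chol_inv; assumption|exact I|].
apply Ccont_mult; [apply Ccont_opp, Ccont_mult; exact I|exact F3].
Qed.

Lemma hol_on_cpow D a f : hol_on D f -> hol_on D (fun w => cpow a (f w)).
Proof.
intros [f' F]. exists (fun w => RtoC (ln a) * cpow a (f w) * f' w)%C. intros z Hz.
destruct (F z Hz) as [F1 F2 F3].
split; [apply Chol_cpow; assumption|apply Ccont_cpow; assumption|].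
apply Ccont_mult; [apply Ccont_mult; [apply Ccont_const|apply Ccont_cpow; assumption]|assumption].
Qed.

Lemma hol_on_pow D f k : hol_on D f -> hol_on D (fun w => f w ^ k)%C.
Proof.
intros F. induction k as [|k IH].
- apply (hol_on_const D (RtoC 1)).
- apply (hol_on_mult D f (fun w => f w ^ k)%C); assumption.
Qed.

Lemma hol_on_csum D (f : nat -> C -> C) N :
  (forall n, hol_on D (f n)) -> hol_on D (fun w => csum (fun n => f n w) N).
Proof.
intros H. induction N as [|N IH].
- apply (hol_on_const D (RtoC 0)).
- apply (hol_on_plus D (fun w => csum (fun n => f n w) N) (f (S N))); [exact IH|apply H].
Qed.

Lemma hol_on_ext D f g : (forall w, f w = g w) -> hol_on D f -> hol_on D g.
Proof.
intros E [f' F]. exists f'. intros z Hz. destruct (F z Hz) as [F1 F2 F3].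
split; [| |exact F3].
- intros h x m Hh Hd. destruct (F1 h x m Hh Hd) as [A B].
  split; [eapply is_derive_ext; [|exact A]|eapply is_derive_ext; [|exact B]];
  intros u; cbv beta; rewrite E; reflexivity.
- intros h x y Hh Hc. destruct (F2 h x y Hh Hc) as [A B].
  split; [eapply continuity_2d_pt_ext; [|exact A]|eapply continuity_2d_pt_ext; [|exact B]];
  intros u v; cbv beta; rewrite E; reflexivity.
Qed.

Lemma hol_on_zeta_approx D M s : (forall z, D z -> 0 < snd (s + z)%C) ->
  hol_on D (fun w => zeta_approx M (s + w)).
Proof.
intros HD.
apply (hol_on_ext D (fun w => csum (fun n => cpow (INR n) (- (s + w))%C) M - cpow (INR M) (1 - (s + w)) * / (1 - (s + w)))%C).
- intros w. unfold zeta_approx. rewrite zsum_csum. reflexivity.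
- assert (Hs : hol_on D (fun w => s + w)%C) by (apply hol_on_plus; [apply hol_on_const|apply hol_on_id]).
  assert (H1 : hol_on D (fun w => 1 - (s + w))%C) by (apply hol_on_minus; [apply hol_on_const|exact Hs]).
  apply hol_on_minus.
  + apply (hol_on_csum D (fun n w => cpow (INR n) (- (s + w))%C)). intros n.
    apply (hol_on_cpow D (INR n) (fun w => - (s + w))%C). apply hol_on_opp, Hs.
  + apply hol_on_mult; [apply (hol_on_cpow D (INR M) (fun w => 1 - (s + w))%C); exact H1|].
    apply (hol_on_inv D (fun w => 1 - (s + w))%C); [exact H1|].
    intros z Hz. apply C1_minus_neq0, HD, Hz.
Qed.

Lemma hol_on_dpoly D k N s : hol_on D (fun w => dpoly k N (s + w)).
Proof.
apply (hol_on_csum D (fun n w => RtoC (INR (dk k n)) * cpow (INR n) (- (s + w)))%C). intros n.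
apply hol_on_mult; [apply hol_on_const|].
apply (hol_on_cpow D (INR n) (fun w => - (s + w))%C).
apply hol_on_opp. apply hol_on_plus; [apply hol_on_const|apply hol_on_id].
Qed.

Lemma continuous_side D Psi w0 u t : hol_on D Psi -> (forall t, seg w0 u t <> RtoC 0) -> D (seg w0 u t) ->
  continuous (fun t => fst (Psi (seg w0 u t) * (u * / seg w0 u t))%C) t /\
  continuous (fun t => snd (Psi (seg w0 u t) * (u * / seg w0 u t))%C) t.
Proof.
intros [dPsi H] Hw Hd.
apply (cont2_continuous (fun _ t => Psi (seg w0 u t) * (u * / seg w0 u t))%C 0 t).
apply cont2_mult; [|apply cont2_quot, Hw].
apply (hol_cont _ _ _ (H _ Hd)); [reflexivity|].
apply cont2_plus; [split; apply continuity_2d_pt_const|].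
apply cont2_mult; [|split; apply continuity_2d_pt_const].
split; simpl; [apply continuity_2d_pt_id2|apply continuity_2d_pt_const].
Qed.

Lemma RInt_abs_bound (f g : R -> R) a b : a <= b -> ex_RInt f a b -> ex_RInt g a b ->
  (forall t, a <= t <= b -> Rabs (f t) <= g t) -> Rabs (RInt f a b) <= RInt g a b.
Proof.
intros Hab Hf Hg H. apply Rabs_le. split.
- assert (E : RInt (fun t => - g t) a b <= RInt f a b).
  { apply RInt_le; [assumption|apply (ex_RInt_opp (V := R_NormedModule)); assumption|assumption|].
    intros t Ht. specialize (H t ltac:(lra)). apply Rabs_le_between in H. lra. }
  rewrite (RInt_opp (V := R_CompleteNormedModule) g) in E by assumption. exact E.
- apply RInt_le; [assumption|assumption|assumption|].
  intros t Ht. specialize (H t ltac:(lra)). apply Rabs_le_between in H. lra.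
Qed.

(** The factor 2 is the price of estimating the two coordinates separately. *)
Lemma Cmod_cint_le (f : R -> C) g a b : a <= b ->
  (forall t, a <= t <= b -> continuous (fun t => fst (f t)) t /\ continuous (fun t => snd (f t)) t) ->
  ex_RInt g a b -> (forall t, a <= t <= b -> Cmod (f t) <= g t) ->
  Cmod (cint f a b) <= 2 * RInt g a b.
Proof.
intros Hab Hc Hg H.
eapply Rle_trans; [apply Cmod_le_abs|]. unfold cint; simpl.
assert (A : Rabs (RInt (fun t => fst (f t)) a b) <= RInt g a b).
{ apply RInt_abs_bound; [assumption| |assumption|].
  - apply (ex_RInt_continuous (V := R_CompleteNormedModule)). intros t Ht.
    rewrite Rmin_left, Rmax_right in Ht by lra. apply Hc, Ht.
  - intros t Ht. eapply Rle_trans; [apply fst_le_Cmod|apply H, Ht]. }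
assert (B : Rabs (RInt (fun t => snd (f t)) a b) <= RInt g a b).
{ apply RInt_abs_bound; [assumption| |assumption|].
  - apply (ex_RInt_continuous (V := R_CompleteNormedModule)). intros t Ht.
    rewrite Rmin_left, Rmax_right in Ht by lra. apply Hc, Ht.
  - intros t Ht. eapply Rle_trans; [apply snd_le_Cmod|apply H, Ht]. }
lra.
Qed.

Lemma cint_plus (f g : R -> C) a b : a <= b ->
  (forall t, a <= t <= b -> continuous (fun t => fst (f t)) t /\ continuous (fun t => snd (f t)) t) ->
  (forall t, a <= t <= b -> continuous (fun t => fst (g t)) t /\ continuous (fun t => snd (g t)) t) ->
  cint (fun t => f t + g t)%C a b = (cint f a b + cint g a b)%C.
Proof.
intros Hab Hf Hg. unfold cint. apply injective_projections; simpl.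
- apply (RInt_plus (V := R_CompleteNormedModule) (fun t => fst (f t)) (fun t => fst (g t)));
  apply (ex_RInt_continuous (V := R_CompleteNormedModule)); intros t Ht;
  rewrite Rmin_left, Rmax_right in Ht by lra; [apply Hf, Ht|apply Hg, Ht].
- apply (RInt_plus (V := R_CompleteNormedModule) (fun t => snd (f t)) (fun t => snd (g t)));
  apply (ex_RInt_continuous (V := R_CompleteNormedModule)); intros t Ht;
  rewrite Rmin_left, Rmax_right in Ht by lra; [apply Hf, Ht|apply Hg, Ht].
Qed.

Lemma side_plus D f g w0 u a b : a <= b -> hol_on D f -> hol_on D g ->
  (forall t, seg w0 u t <> RtoC 0) -> (forall t, a <= t <= b -> D (seg w0 u t)) ->
  side (fun w => f w + g w)%C w0 u a b = (side f w0 u a b + side g w0 u a b)%C.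
Proof.
intros Hab Hf Hg Hw HD. unfold side.
rewrite <- cint_plus.
- apply cint_ext. intros t _. ring.
- assumption.
- intros t Ht. apply (continuous_side D); auto.
- intros t Ht. apply (continuous_side D); auto.
Qed.

Lemma side_scal_l D c f w0 u a b : a <= b -> hol_on D f ->
  (forall t, seg w0 u t <> RtoC 0) -> (forall t, a <= t <= b -> D (seg w0 u t)) ->
  side (fun w => c * f w)%C w0 u a b = (c * side f w0 u a b)%C.
Proof.
intros Hab Hf Hw HD. unfold side. rewrite <- cint_const_scal.
- apply cint_ext. intros t _. ring.
- intros t Ht. rewrite Rmin_left, Rmax_right in Ht by lra. apply (continuous_side D); auto.
Qed.

Lemma side_csum D (c : nat -> C) (f : nat -> C -> C) w0 u a b N : a <= b -> (forall n, hol_on D (f n)) ->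
  (forall t, seg w0 u t <> RtoC 0) -> (forall t, a <= t <= b -> D (seg w0 u t)) ->
  side (fun w => csum (fun n => c n * f n w) N)%C w0 u a b = csum (fun n => c n * side (f n) w0 u a b)%C N.
Proof.
intros Hab Hf Hw HD. induction N as [|N IH].
- simpl. unfold side. rewrite (cint_ext _ (fun _ => RtoC 0)) by (intros; ring).
  rewrite cint_const. ring.
- rewrite csumS, <- IH, <- (side_scal_l D) by auto.
  apply (side_plus D (fun w => csum (fun n => c n * f n w) N)%C (fun w => c (S N) * f (S N) w)%C); auto.
  + apply (hol_on_csum D (fun n w => c n * f n w)%C). intros n. apply hol_on_mult; [apply hol_on_const|apply Hf].
  + apply hol_on_mult; [apply hol_on_const|apply Hf].
Qed.

(** The primitive is the inverse hyperbolic sine of [v / c], up to a constant. *)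
Lemma is_RInt_inv_sqrt c V : 0 < c -> 0 <= V ->
  is_RInt (fun v => / sqrt (c ^ 2 + v ^ 2)) (- V) V
    (ln (V + sqrt (c ^ 2 + V ^ 2)) - ln (- V + sqrt (c ^ 2 + (- V) ^ 2))).
Proof.
intros Hc HV.
assert (Hp : forall v, 0 < v + sqrt (c ^ 2 + v ^ 2)).
{ intros v. assert (Rabs v < sqrt (c ^ 2 + v ^ 2)).
  { rewrite <- sqrt_Rsqr_abs. apply sqrt_lt_1_alt. unfold Rsqr. split; nra. }
  pose proof (Rle_abs (- v)) as X. rewrite Rabs_Ropp in X. lra. }
assert (Hs : forall v, 0 < sqrt (c ^ 2 + v ^ 2)) by (intros v; apply sqrt_lt_R0; nra).
apply (is_RInt_derive (V := R_CompleteNormedModule) (fun v => ln (v + sqrt (c ^ 2 + v ^ 2)))).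
- intros v _. specialize (Hp v). specialize (Hs v). auto_derive.
  + split; [nra|]. split; [|exact I]. simpl in *. exact Hp.
  + replace (c * (c * 1) + v * (v * 1)) with (c ^ 2 + v ^ 2) by ring. field. lra.
- intros v _. specialize (Hs v). apply (ex_derive_continuous (V := R_NormedModule)). auto_derive.
  split; [nra|]. split; [|exact I]. simpl in *. apply Rgt_not_eq. exact Hs.
Qed.

(** The integral of [|dw| / |w|] along the left side, of logarithmic size in [V / eta]. *)
Definition Lam (eta V : R) : R := RInt (fun v => / sqrt (eta ^ 2 + v ^ 2)) (- V) V.

Lemma Lam_le eta V : 0 < eta -> 0 < V -> 0 <= Lam eta V <= 2 * ln ((2 * V + eta) / eta).
Proof.
intros He HV. unfold Lam. rewrite (is_RInt_unique _ _ _ _ (is_RInt_inv_sqrt eta V He ltac:(lra))).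
replace ((- V) ^ 2) with (V ^ 2) by ring. set (r := sqrt (eta ^ 2 + V ^ 2)).
assert (r2 : r ^ 2 = eta ^ 2 + V ^ 2) by (unfold r; rewrite pow2_sqrt; nra).
assert (r0 : 0 <= r) by apply sqrt_pos.
assert (rV : V < r) by nra. assert (re : r <= V + eta) by nra.
split.
- assert (ln (- V + r) <= ln (V + r)) by (apply ln_le; lra). lra.
(* [(r - V) (r + V) = eta^2]. *)
- assert (E : ln (- V + r) = ln (eta ^ 2) - ln (V + r)).
  { rewrite <- ln_div by nra. f_equal. field_simplify_eq; nra. }
  rewrite E, ln_div by lra.
  assert (ln (V + r) <= ln (2 * V + eta)) by (apply ln_le; lra).
  assert (ln (eta ^ 2) = 2 * ln eta) by (rewrite ln_pow by lra; simpl; ring). lra.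
Qed.

Lemma ex_RInt_inv_sqrt eta V : 0 < eta -> 0 <= V -> ex_RInt (fun v => / sqrt (eta ^ 2 + v ^ 2)) (- V) V.
Proof. intros. eexists. apply is_RInt_inv_sqrt; assumption. Qed.

Lemma Cmod_seg_v c v : c <> 0 -> Cmod (Ci * / seg (c, 0) Ci v) = / sqrt (c ^ 2 + v ^ 2).
Proof.
intros Hc. rewrite Cmod_mult, Cmod_Ci, Rmult_1_l, Cmod_inv by (apply seg_v_neq0, Hc).
f_equal. unfold Cmod, seg. f_equal. simpl. ring.
Qed.

Lemma side_v_le D Psi c eta V B : hol_on D Psi -> 0 < eta -> eta <= Rabs c -> 0 < V -> 0 <= B ->
  (forall v, - V <= v <= V -> D (c, v)) -> (forall v, - V <= v <= V -> Cmod (Psi (c, v)) <= B) ->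
  Cmod (side Psi (c, 0) Ci (- V) V) <= 2 * B * Lam eta V.
Proof.
intros HP He Hc HV HB HD Hb.
assert (c0 : c <> 0) by (intros ->; rewrite Rabs_R0 in Hc; lra).
assert (Es : forall v, seg (c, 0) Ci v = (c, v)) by (intros v; apply injective_projections; simpl; ring).
assert (H : Cmod (side Psi (c, 0) Ci (- V) V) <= 2 * RInt (fun v => B * / sqrt (eta ^ 2 + v ^ 2)) (- V) V).
{ apply Cmod_cint_le; [lra| | |].
  - intros t Ht. apply (continuous_side D); [assumption|intros; apply seg_v_neq0, c0|rewrite Es; apply HD, Ht].
  - apply (ex_RInt_scal (V := R_NormedModule)), ex_RInt_inv_sqrt; lra.
  - intros t Ht. rewrite Cmod_mult, Cmod_seg_v by assumption.
    apply Rmult_le_compat; [apply Cmod_ge_0| |rewrite Es; apply Hb, Ht|].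
    + apply Rlt_le, Rinv_0_lt_compat, sqrt_lt_R0. nra.
    + apply Rinv_le_contravar; [apply sqrt_lt_R0; nra|]. apply sqrt_le_1_alt.
      rewrite <- (pow2_abs c). assert (eta ^ 2 <= Rabs c ^ 2) by (apply pow_incr; lra). lra. }
rewrite (RInt_scal (V := R_CompleteNormedModule)) in H by (apply ex_RInt_inv_sqrt; lra).
unfold scal in H; simpl in H; unfold mult in H; simpl in H. unfold Lam. simpl. lra.
Qed.

Lemma side_h_le D Psi v eta c B : hol_on D Psi -> - eta <= c -> v <> 0 -> 0 <= B ->
  (forall x, - eta <= x <= c -> D (x, v)) -> (forall x, - eta <= x <= c -> Cmod (Psi (x, v)) <= B) ->
  Cmod (side Psi (0, v) (RtoC 1) (- eta) c) <= 2 * (B / Rabs v * (c + eta)).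
Proof.
intros HP Hc Hv HB HD Hb.
assert (Es : forall x, seg (0, v) (RtoC 1) x = (x, v)) by (intros x; apply injective_projections; simpl; ring).
assert (H : Cmod (side Psi (0, v) (RtoC 1) (- eta) c) <= 2 * RInt (fun _ => B / Rabs v) (- eta) c).
{ apply Cmod_cint_le; [lra| |apply ex_RInt_const|].
  - intros t Ht. apply (continuous_side D); [assumption|intros; apply seg_h_neq0, Hv|rewrite Es; apply HD, Ht].
  - intros t Ht. rewrite !Cmod_mult, Cmod_1, Rmult_1_l, Cmod_inv by (apply seg_h_neq0, Hv).
    apply Rmult_le_compat; [apply Cmod_ge_0| |rewrite Es; apply Hb, Ht|].
    + apply Rlt_le, Rinv_0_lt_compat, Cmod_gt_0, seg_h_neq0, Hv.
    + apply Rinv_le_contravar; [apply Rabs_pos_lt, Hv|]. rewrite Es. apply (snd_le_Cmod (t, v)). }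
rewrite RInt_const in H. unfold scal in H; simpl in H; unfold mult in H; simpl in H. lra.
Qed.

(* The left side of the contour applied to [(X / n)^w]. *)
Definition lcoef (X eta V : R) (n : nat) : C :=
  side (fun w => cpow X w * cpow (INR n) (- w))%C (- eta, 0) Ci (- V) V.

(** What [dpoly] contributes to the left side: [n^(-(s + w)) = n^(-s) n^(-w)], so the integral over
    [w] enters only through the coefficients [lcoef]. *)
Definition lpoly (k N : nat) (X eta V : R) (s : C) : C :=
  csum (fun n => RtoC (INR (dk k n)) * cpow (INR n) (- s) * lcoef X eta V n)%C N.

(** On the left side [|(X / n)^w| = X^(-eta) n^eta]. The first factor is the gain, the second later
    moves [D_k] from [sigma] to [sigma - eta]. *)
Lemma Cmod_lcoef_le X eta V n : 0 < X -> 0 < eta -> 0 < V -> (1 <= n)%nat ->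
  Cmod (lcoef X eta V n) <= 2 * (Rpower X (- eta) * Rpower (INR n) eta) * Lam eta V.
Proof.
intros HX He HV Hn. unfold lcoef.
apply (side_v_le (fun _ => True)).
- apply hol_on_mult.
  + apply (hol_on_cpow _ X (fun w => w)), hol_on_id.
  + apply (hol_on_cpow _ (INR n) (fun w => - w)%C), hol_on_opp, hol_on_id.
- assumption.
- rewrite Rabs_left; lra.
- assumption.
- apply Rmult_le_pos; apply Rlt_le, Rpower_pos.
- intros; exact I.
- intros v _. rewrite Cmod_mult, !Cmod_cpow. simpl. rewrite Ropp_involutive. lra.
Qed.

Lemma Cmod_pow_sub_le (a b : C) r k : 1 <= r -> Cmod a <= r -> Cmod b <= r ->
  Cmod (a ^ k - b ^ k) <= INR k * r ^ k * Cmod (a - b).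
Proof.
intros Hr Ha Hb. assert (D0 := Cmod_ge_0 (a - b)).
induction k as [|k IH].
- simpl. replace (1 - 1)%C with (RtoC 0) by ring. rewrite Cmod_0. lra.
- rewrite !Cpow_S.
  replace (a * a ^ k - b * b ^ k)%C with (a * (a ^ k - b ^ k) + (a - b) * b ^ k)%C by ring.
  eapply Rle_trans; [apply Cmod_triangle|]. rewrite !Cmod_mult, Cmod_pow, S_INR.
  assert (P1 : 1 <= r ^ k) by (apply pow_R1_Rle; lra).
  assert (Cmod b ^ k <= r ^ k) by (apply pow_incr; split; [apply Cmod_ge_0|assumption]).
  assert (A1 : Cmod a * Cmod (a ^ k - b ^ k) <= r * (INR k * r ^ k * Cmod (a - b))).
  { apply Rmult_le_compat; [apply Cmod_ge_0|apply Cmod_ge_0|assumption|exact IH]. }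
  assert (A2 : Cmod (a - b) * Cmod b ^ k <= Cmod (a - b) * (r * r ^ k)).
  { apply Rmult_le_compat_l; [assumption|]. nra. }
  change (r ^ S k) with (r * r ^ k). nra.
Qed.

Lemma Cmod_vec_le x y : 0 <= x -> 0 <= y -> Cmod (x, y) <= x + y.
Proof. intros. eapply Rle_trans; [apply Cmod_le_abs|]. simpl. rewrite !Rabs_pos_eq; lra. Qed.

(** The three error terms come from the two horizontal sides, the right side, and [zeta_approx^k] on
    the left side. The part of [dpoly] on the left side is kept as [lpoly], since it is small only
    in mean square. The condition [2V <= t] keeps the pole at 1 away. *)
Lemma pointwise_approx k N M sigma t X eta V W rho :
  0 < eta -> 1 / 2 <= sigma - eta -> sigma < 1 -> 4 <= V -> 2 * V <= t -> 1 <= X -> 0 <= W -> 0 <= rho ->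
  (forall x v, - eta <= x <= 4 - sigma -> - V <= v <= V -> Cmod (zeta_approx M (sigma + x, t + v)) <= W) ->
  (forall v, - V <= v <= V -> Cmod (zeta_approx M (4, t + v) ^ k - dpoly k N (4, t + v)) <= rho) ->
  Cmod (kappa eta (4 - sigma) V * (zeta_approx M (sigma, t) ^ k - dpoly k N (sigma, t))
        - lpoly k N X eta V (sigma, t))
  <= 4 * ((W ^ k + INR N ^ 2 * 2 ^ k) * Rpower X (4 - sigma) / V * (4 - sigma + eta))
     + 2 * (rho * Rpower X (4 - sigma)) * Lam eta V
     + 2 * (W ^ k * Rpower X (- eta)) * Lam eta V.
Proof.
intros He Hse Hs HV Ht HX HW Hrho Hz Hr.
set (s := (sigma, t) : C). set (c := 4 - sigma).
set (D := fun z : C => - (2 * V) < snd z).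
assert (HD : forall z, D z -> 0 < snd (s + z)%C) by (intros z Hz'; unfold D in Hz'; simpl; lra).
set (F := fun w => (zeta_approx M (s + w) ^ k * cpow X w)%C).
set (G := fun w => (dpoly k N (s + w) * cpow X w)%C).
set (Psi := fun w => ((zeta_approx M (s + w) ^ k - dpoly k N (s + w)) * cpow X w)%C).
assert (hX : hol_on D (fun w => cpow X w)) by (apply (hol_on_cpow D X (fun w => w)), hol_on_id).
assert (hZ : hol_on D (fun w => zeta_approx M (s + w) ^ k)%C) by (apply hol_on_pow, hol_on_zeta_approx, HD).
assert (hP := hol_on_dpoly D k N s).
assert (hF : hol_on D F) by (apply hol_on_mult; assumption).
assert (hG : hol_on D G) by (apply hol_on_mult; assumption).
assert (hPsi : hol_on D Psi) by (apply hol_on_mult; [apply hol_on_minus|]; assumption).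
assert (WL : forall t, seg (- eta, 0)%R Ci t <> RtoC 0) by (intros; apply seg_v_neq0; lra).
assert (Es : forall c v, seg (c, 0) Ci v = (c, v)) by (intros; apply injective_projections; simpl; ring).
assert (DL : forall v, - V <= v <= V -> D (seg (- eta, 0)%R Ci v)).
{ intros v Hv. rewrite Es. unfold D. simpl. lra. }
destruct hPsi as [dPsi hd].
assert (Cau := cauchy_rect Psi dPsi eta c V He ltac:(unfold c; lra) ltac:(lra) hd).
assert (hPsi : hol_on D Psi) by (exists dPsi; exact hd).
assert (X0 : cpow X (RtoC 0) = RtoC 1).
{ unfold cpow. simpl. rewrite !Rmult_0_l, exp_0, cos_0, sin_0. apply injective_projections; simpl; ring. }
assert (P0 : Psi (RtoC 0) = (zeta_approx M s ^ k - dpoly k N s)%C).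
{ unfold Psi. rewrite X0. replace (s + RtoC 0)%C with s by ring. ring. }
(* Only on the left side is [Psi] separated into its two parts; on the right side their difference
   is what is small. *)
assert (LE : side Psi (- eta, 0) Ci (- V) V = (side F (- eta, 0)%R Ci (- V)%R V - lpoly k N X eta V s)%C).
{ assert (E1 : side Psi (- eta, 0) Ci (- V) V = (side F (- eta, 0)%R Ci (- V)%R V + side (fun w => - (1) * G w)%C (- eta, 0)%R Ci (- V)%R V)%C).
  { rewrite <- (side_plus D); auto; [|lra|apply hol_on_mult; [apply hol_on_const|exact hG]].
    unfold side. apply cint_ext. intros v _. unfold Psi, F, G. ring. }
  rewrite E1, (side_scal_l D); auto; [|lra].
  assert (E2 : side G (- eta, 0) Ci (- V) V = lpoly k N X eta V s).
  { transitivity (side (fun w => csum (fun n => (RtoC (INR (dk k n)) * cpow (INR n) (- s)) * (cpow X w * cpow (INR n) (- w)))%C N) (- eta, 0) Ci (- V) V).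
    - unfold side. apply cint_ext. intros v _. f_equal. set (w := seg _ _ _).
      unfold G, dpoly. rewrite Cmult_comm, <- csum_scal. apply csum_ext. intros n _.
      replace (- (s + w))%C with (- s + - w)%C by ring. rewrite cpow_plus. ring.
    - rewrite (side_csum D (fun n => RtoC (INR (dk k n)) * cpow (INR n) (- s))%C (fun n w => cpow X w * cpow (INR n) (- w))%C); auto; [lra|].
      intros n. apply hol_on_mult; [exact hX|].
      apply (hol_on_cpow D (INR n) (fun w => - w)%C), hol_on_opp, hol_on_id. }
  rewrite E2. ring. }
assert (Xc : 0 < Rpower X c) by apply Rpower_pos.
assert (Hx : forall x, - eta <= x <= c -> Rpower X x <= Rpower X c) by (intros; apply Rle_Rpower; lra).
assert (N20 : 0 <= INR N ^ 2 * 2 ^ k).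
{ apply Rmult_le_pos; [apply pow2_ge_0|apply pow_le; lra]. }
assert (Wk : 0 <= W ^ k) by (apply pow_le; assumption).
assert (Hh : forall x v, - eta <= x <= c -> - V <= v <= V -> Cmod (Psi (x, v)) <= (W ^ k + INR N ^ 2 * 2 ^ k) * Rpower X c).
{ intros x v Hx' Hv. unfold Psi. rewrite Cmod_mult, Cmod_cpow.
  apply Rmult_le_compat; [apply Cmod_ge_0|apply Rlt_le, Rpower_pos| |apply Hx; simpl; lra].
  eapply Rle_trans; [apply Cmod_triangle|]. rewrite Cmod_opp, Cmod_pow.
  apply Rplus_le_compat.
  - apply pow_incr. split; [apply Cmod_ge_0|]. apply (Hz x v Hx' Hv).
  - apply Cmod_dpoly_le. simpl. lra. }
assert (BB : Cmod (side Psi (0, - V) (RtoC 1) (- eta) c) <= 2 * ((W ^ k + INR N ^ 2 * 2 ^ k) * Rpower X c / V * (c + eta))).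
{ replace V with (Rabs (- V)) at 2 by (rewrite Rabs_left; lra).
  apply (side_h_le D); auto; [unfold c; lra|lra|apply Rmult_le_pos; lra| |].
  - intros x Hx'. unfold D. simpl. lra.
  - intros x Hx'. apply Hh; lra. }
assert (BT : Cmod (side Psi (0, V) (RtoC 1) (- eta) c) <= 2 * ((W ^ k + INR N ^ 2 * 2 ^ k) * Rpower X c / V * (c + eta))).
{ replace V with (Rabs V) at 2 by (rewrite Rabs_pos_eq; lra).
  apply (side_h_le D); auto; [unfold c; lra|lra|apply Rmult_le_pos; lra| |].
  - intros x Hx'. unfold D. simpl. lra.
  - intros x Hx'. apply Hh; lra. }
assert (BR : Cmod (side Psi (c, 0) Ci (- V) V) <= 2 * (rho * Rpower X c) * Lam eta V).
{ apply (side_v_le D); auto; [unfold c; rewrite Rabs_pos_eq; lra|lra|apply Rmult_le_pos; lra| |].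
  - intros v Hv. unfold D. simpl. lra.
  - intros v Hv. unfold Psi. rewrite Cmod_mult, Cmod_cpow. simpl fst.
    apply Rmult_le_compat_r; [lra|].
    replace (s + (c, v))%C with ((4, t + v) : C); [apply Hr, Hv|].
    unfold s, c. apply injective_projections; simpl; ring. }
assert (BL : Cmod (side F (- eta, 0) Ci (- V) V) <= 2 * (W ^ k * Rpower X (- eta)) * Lam eta V).
{ apply (side_v_le D); auto; [rewrite Rabs_left; lra|lra|apply Rmult_le_pos; [assumption|apply Rlt_le, Rpower_pos]| |].
  - intros v Hv. unfold D. simpl. lra.
  - intros v Hv. unfold F. rewrite Cmod_mult, Cmod_cpow, Cmod_pow. simpl fst.
    apply Rmult_le_compat_r; [apply Rlt_le, Rpower_pos|].
    apply pow_incr. split; [apply Cmod_ge_0|]. apply (Hz (- eta) v); [unfold c; lra|exact Hv]. }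
assert (E : (kappa eta c V * (zeta_approx M s ^ k - dpoly k N s) - lpoly k N X eta V s =
   side Psi (0, - V)%R (RtoC 1) (- eta)%R c + side Psi (c, 0)%R Ci (- V)%R V
   + - side Psi (0, V)%R (RtoC 1) (- eta)%R c + - side F (- eta, 0)%R Ci (- V)%R V)%C).
{ rewrite <- P0, Cmult_comm, <- Cau. unfold rect_int. rewrite LE. ring. }
rewrite E.
set (b1 := side Psi (0, - V) _ _ _) in *. set (b2 := side Psi (c, 0) _ _ _) in *.
set (b3 := side Psi (0, V) _ _ _) in *. set (b4 := side F _ _ _ _) in *.
pose proof (Cmod_triangle (b1 + b2 + - b3) (- b4)) as T1. rewrite Cmod_opp in T1.
pose proof (Cmod_triangle (b1 + b2) (- b3)) as T2. rewrite Cmod_opp in T2.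
pose proof (Cmod_triangle b1 b2) as T3.
lra.
Qed.

Lemma zeta_approx_uniform S eps : 0 < eps -> exists M0, (1 <= M0)%nat /\ forall M s, (M0 <= M)%nat ->
  1 / 2 <= fst s -> 0 < snd s -> Cmod s <= S -> Cmod (zeta s - zeta_approx M s) <= eps.
Proof.
intros He. destruct (Rpower_neg_half_small (16 * S) eps He) as [M0 [H0 H]].
exists M0. split; [assumption|]. intros M s HM H1 H2 H3.
eapply Rle_trans; [apply zeta_approx_err; auto; lia|].
eapply Rle_trans; [|apply (H M HM)].
apply Rmult_le_compat_r; [apply Rlt_le, Rpower_pos|lra].
Qed.

Lemma zsum_four_le M s : 4 <= fst s -> Cmod (zsum M s) <= 2.
Proof.
intros Hs. rewrite zsum_csum. eapply Rle_trans; [apply Cmod_csum_le|].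
eapply Rle_trans; [|apply (rsum_inv_sq_le M)]. apply rsum_le. intros n Hn.
rewrite Cmod_cpow. simpl fst. rewrite <- Rpower_neg_nat by lia.
apply Rle_Rpower; [apply (le_INR 1); lia|]. simpl. lra.
Qed.

(** At real part 4 the correction [M^(1 - s) / (1 - s)] tends to 0, so [zeta_approx] may be replaced
    by the sum [zsum], to which [zsum_pow_sub_dpoly] applies. The radius 3 is 2 for [zsum] plus 1
    for the correction. *)
Lemma zeta_approx_right k N eps : 0 < eps -> exists M0, forall M s, (M0 <= M)%nat ->
  fst s = 4 -> 1 <= snd s ->
  Cmod (zeta_approx M s ^ k - dpoly k N s) <= 2 ^ k / (INR N + 1) ^ 2 + eps.
Proof.
intros He.
destruct (Rpower_neg_half_small (INR k * 3 ^ k) eps He) as [M0 [H0 H]].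
exists (M0 + N)%nat. intros M s HM H1 H2.
assert (M1 : 1 <= INR M) by (apply (le_INR 1); lia).
assert (Hn := C1_minus_neq0 s ltac:(lra)).
assert (D : Cmod (zeta_approx M s - zsum M s) <= Rpower (INR M) (- (1 / 2))).
{ unfold zeta_approx. replace (zsum M s - cpow (INR M) (1 - s) / (1 - s) - zsum M s)%C with
    (- (cpow (INR M) (1 - s) / (1 - s)))%C by ring.
  rewrite Cmod_opp, Cmod_div, Cmod_cpow by assumption.
  change (fst (1 - s)%C) with (1 - fst s). rewrite H1.
  assert (1 <= Cmod (1 - s)).
  { eapply Rle_trans; [|apply snd_le_Cmod]. simpl. rewrite Rabs_left1; lra. }
  apply Rle_trans with (Rpower (INR M) (1 - 4) / 1).
  - unfold Rdiv. apply Rmult_le_compat_l; [apply Rlt_le, Rpower_pos|]. apply Rinv_le_contravar; lra.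
  - unfold Rdiv. rewrite Rinv_1, Rmult_1_r. apply Rle_Rpower; lra. }
assert (Z2 := zsum_four_le M s ltac:(lra)).
assert (D1 : Rpower (INR M) (- (1 / 2)) <= 1).
{ apply Rle_trans with (Rpower (INR M) 0); [apply Rle_Rpower; lra|rewrite Rpower_O; lra]. }
assert (Z3 : Cmod (zeta_approx M s) <= 3).
{ replace (zeta_approx M s) with ((zeta_approx M s - zsum M s) + zsum M s)%C by ring.
  eapply Rle_trans; [apply Cmod_triangle|]. lra. }
replace (zeta_approx M s ^ k - dpoly k N s)%C with
  ((zsum M s ^ k - dpoly k N s) + (zeta_approx M s ^ k - zsum M s ^ k))%C by ring.
eapply Rle_trans; [apply Cmod_triangle|]. apply Rplus_le_compat.
- eapply Rle_trans; [apply zsum_pow_sub_dpoly; [lia|lra]|].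
  apply Rmult_le_compat_r.
  + apply Rlt_le, Rinv_0_lt_compat, pow_lt. pose proof (pos_INR N). lra.
  + apply pow_incr. split; [|apply rsum_inv_sq_le].
    pose proof (rsum_mono (fun n => / INR n ^ 2) 0 M) as R0. apply R0.
    intros n Hn'. apply Rlt_le, Rinv_0_lt_compat, pow_lt, lt_0_INR. lia.
- eapply Rle_trans; [apply (Cmod_pow_sub_le _ _ 3); lra|].
  eapply Rle_trans; [|apply (H M ltac:(lia))].
  apply Rmult_le_compat_l; [|assumption].
  apply Rmult_le_pos; [apply pos_INR|apply pow_le; lra].
Qed.

(** The limit [M -> oo] in [pointwise_approx]. The room for it is [W + 1] in place of [W], and twice
    the tail bound on the right side. *)
Lemma pointwise_zeta k N sigma t X eta V W :
  0 < eta -> 1 / 2 <= sigma - eta -> sigma < 1 -> 4 <= V -> 2 * V <= t -> 1 <= X -> 0 <= W ->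
  (forall x v, - eta <= x <= 4 - sigma -> - V <= v <= V -> Cmod (zeta (sigma + x, t + v)) <= W) ->
  Cmod (kappa eta (4 - sigma) V * (zeta (sigma, t) ^ k - dpoly k N (sigma, t))
        - lpoly k N X eta V (sigma, t))
  <= 4 * (((W + 1) ^ k + INR N ^ 2 * 2 ^ k) * Rpower X (4 - sigma) / V * (4 - sigma + eta))
     + 2 * ((2 * (2 ^ k / (INR N + 1) ^ 2)) * Rpower X (4 - sigma)) * Lam eta V
     + 2 * ((W + 1) ^ k * Rpower X (- eta)) * Lam eta V.
Proof.
intros He Hse Hs HV Ht HX HW Hz.
set (R0 := 4 * _ + _ + _).
apply le_epsilon. intros eps Heps.
set (Kp := Cmod (kappa eta (4 - sigma) V)).
assert (Kp0 : 0 <= Kp) by apply Cmod_ge_0.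
(* [A - 1] is the Lipschitz factor by which the approximation error of [zeta] enters; the extra 1
   makes division by [A] safe. *)
set (A := Kp * (INR k * (W + 1) ^ k) + 1).
assert (A0 : 1 <= A).
{ unfold A. assert (0 <= Kp * (INR k * (W + 1) ^ k)); [|lra].
  repeat apply Rmult_le_pos; [assumption|apply pos_INR|apply pow_le; lra]. }
assert (q0 : 0 < 2 ^ k / (INR N + 1) ^ 2).
{ apply Rdiv_lt_0_compat; [apply pow_lt; lra|]. apply pow_lt. pose proof (pos_INR N). lra. }
destruct (zeta_approx_right k N _ q0) as [M1 HM1].
destruct (zeta_approx_uniform (5 + (t + V)) (Rmin 1 (eps / A))) as [M2 [_ HM2]].
{ apply Rmin_pos; [lra|]. apply Rdiv_lt_0_compat; lra. }
set (M := (M1 + M2)%nat).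
assert (Hu : forall x v, - eta <= x <= 4 - sigma -> - V <= v <= V ->
  Cmod (zeta (sigma + x, t + v) - zeta_approx M (sigma + x, t + v)) <= Rmin 1 (eps / A)).
{ intros x v Hx Hv. apply HM2; [unfold M; lia|simpl; lra|simpl; lra|].
  eapply Rle_trans; [apply Cmod_vec_le; lra|]. lra. }
assert (Ha : forall x v, - eta <= x <= 4 - sigma -> - V <= v <= V ->
  Cmod (zeta_approx M (sigma + x, t + v)) <= W + 1).
{ intros x v Hx Hv. specialize (Hu x v Hx Hv). specialize (Hz x v Hx Hv).
  pose proof (Rmin_l 1 (eps / A)).
  replace (zeta_approx M (sigma + x, t + v)) with
   (zeta (sigma + x, t + v)%R + - (zeta (sigma + x, t + v)%R - zeta_approx M (sigma + x, t + v)%R))%C by ring.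
  eapply Rle_trans; [apply Cmod_triangle|]. rewrite Cmod_opp. lra. }
assert (P := pointwise_approx k N M sigma t X eta V (W + 1) (2 * (2 ^ k / (INR N + 1) ^ 2))
  He Hse Hs HV Ht HX ltac:(lra) ltac:(lra) Ha).
assert (P' : Cmod (kappa eta (4 - sigma)%R V * (zeta_approx M (sigma, t) ^ k - dpoly k N (sigma, t))
        - lpoly k N X eta V (sigma, t)) <= R0).
{ apply P. intros v Hv.
  eapply Rle_trans; [apply HM1; [unfold M; lia|reflexivity|simpl; lra]|]. lra. }
clear P.
assert (Hu0 := Hu 0 0 ltac:(lra) ltac:(lra)). assert (Hz0 := Hz 0 0 ltac:(lra) ltac:(lra)).
assert (Ha0 := Ha 0 0 ltac:(lra) ltac:(lra)).
rewrite !Rplus_0_r in Hu0, Hz0, Ha0.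
replace (kappa eta (4 - sigma)%R V * (zeta (sigma, t) ^ k - dpoly k N (sigma, t)) - lpoly k N X eta V (sigma, t))%C with
  ((kappa eta (4 - sigma)%R V * (zeta_approx M (sigma, t) ^ k - dpoly k N (sigma, t)) - lpoly k N X eta V (sigma, t)) +
   kappa eta (4 - sigma)%R V * (zeta (sigma, t) ^ k - zeta_approx M (sigma, t) ^ k))%C by ring.
eapply Rle_trans; [apply Cmod_triangle|]. apply Rplus_le_compat; [exact P'|].
rewrite Cmod_mult. fold Kp.
assert (Q := Cmod_pow_sub_le (zeta (sigma, t)) (zeta_approx M (sigma, t)) (W + 1) k ltac:(lra) ltac:(lra) Ha0).
apply Rle_trans with (Kp * (INR k * (W + 1) ^ k * (eps / A))).
- apply Rmult_le_compat_l; [assumption|]. eapply Rle_trans; [exact Q|].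
  apply Rmult_le_compat_l.
  + apply Rmult_le_pos; [apply pos_INR|apply pow_le; lra].
  + eapply Rle_trans; [exact Hu0|apply Rmin_r].
- replace (Kp * (INR k * (W + 1) ^ k * (eps / A))) with ((A - 1) * (eps / A)) by (unfold A; ring).
  assert (0 < eps / A) by (apply Rdiv_lt_0_compat; lra).
  replace eps with (A * (eps / A)) at 2 by (field; lra). nra.
Qed.

(** * From the maximum to moments *)

(** [mean_value_dirp] is stated for real coefficients, so the complex [lcoef] is separated into its
    two parts. *)
Lemma lpoly_split k N X eta V sigma t :
  (lpoly k N X eta V (sigma, t) =
   dirp (fun n => INR (dk k n) * fst (lcoef X eta V n))%R sigma N t +
   Ci * dirp (fun n => INR (dk k n) * snd (lcoef X eta V n))%R sigma N t)%C.
Proof.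
unfold lpoly, dirp. rewrite <- csum_scal, <- csum_plus. apply csum_ext. intros n _.
set (z := cpow _ _). destruct (lcoef X eta V n) as [p q].
rewrite !RtoC_mult. simpl fst. simpl snd.
replace ((p, q) : C) with (RtoC p + Ci * RtoC q)%C by (apply injective_projections; simpl; ring).
ring.
Qed.

Lemma rsum_plus f g N : rsum (fun n => f n + g n) N = rsum f N + rsum g N.
Proof. induction N as [|N IH]; simpl; [|rewrite IH]; ring. Qed.

(** By [Cmod_lcoef_le] the factor [n^(2 eta)] turns [d_k(n)^2 n^(-2 sigma)] into the term at
    [sigma - eta], which leaves [X^(-2 eta)] as gain. *)
Lemma lpoly_mass k N X eta V sigma : (1 <= k)%nat -> 1 / 2 < sigma - eta -> sigma < 1 -> 0 < X -> 0 < eta -> 0 < V ->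
  rsum (fun n => (INR (dk k n) * fst (lcoef X eta V n)) ^ 2 / Rpower (INR n) (2 * sigma)) N +
  rsum (fun n => (INR (dk k n) * snd (lcoef X eta V n)) ^ 2 / Rpower (INR n) (2 * sigma)) N <=
  4 * Lam eta V ^ 2 * Rpower X (- (2 * eta)) * Dsum k (sigma - eta).
Proof.
intros Hk H1 H2 HX He HV.
rewrite <- rsum_plus.
assert (P := Rpower_pos X (- (2 * eta))).
set (c := 4 * Lam eta V ^ 2 * Rpower X (- (2 * eta))).
assert (c0 : 0 <= c).
{ unfold c. apply Rmult_le_pos; [|lra]. apply Rmult_le_pos; [lra|apply pow2_ge_0]. }
apply Rle_trans with (rsum (fun n => c * dksq k (sigma - eta) n) N).
- apply rsum_le. intros n [Hn _].
  replace ((INR (dk k n) * fst (lcoef X eta V n)) ^ 2 / Rpower (INR n) (2 * sigma) +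
    (INR (dk k n) * snd (lcoef X eta V n)) ^ 2 / Rpower (INR n) (2 * sigma)) with
   (dksq k sigma n * Cmod (lcoef X eta V n) ^ 2) by (rewrite Cmod_sqr; unfold dksq, Rdiv; ring).
  assert (L := Cmod_lcoef_le X eta V n HX He HV ltac:(lia)).
  rewrite (dksq_shift k sigma eta n) by lia.
  assert (n0 : 0 < INR n) by (apply lt_0_INR; lia).
  assert (D0 := dksq_ge0 k (sigma - eta) n).
  assert (L2 : Cmod (lcoef X eta V n) ^ 2 <= c * Rpower (INR n) (2 * eta)).
  { eapply Rle_trans; [apply pow_incr; split; [apply Cmod_ge_0|exact L]|].
    unfold c. replace (- (2 * eta)) with (- eta + - eta) by ring. replace (2 * eta) with (eta + eta) by ring.
    rewrite !Rpower_plus. right. ring. }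
  replace (c * dksq k (sigma - eta) n) with
    ((Rpower (INR n) (- (2 * eta)) * dksq k (sigma - eta) n) * (c * Rpower (INR n) (2 * eta))).
  + apply Rmult_le_compat_l; [|exact L2]. apply Rmult_le_pos; [apply Rlt_le, Rpower_pos|assumption].
  + rewrite Rpower_Ropp. field. apply Rgt_not_eq, Rpower_pos.
- rewrite rsum_scal. apply Rmult_le_compat_l; [assumption|]. apply rsum_dksq_le_Dsum; [assumption|lra].
Qed.

(** The cross term [2 |b| |a - b|] is distributed by the weighted arithmetic-geometric mean
    inequality, so that it costs only a fraction [eps] of the main term. *)
Lemma Cmod_sqr_perturb (a b : C) eps : 0 < eps ->
  Rabs (Cmod a ^ 2 - Cmod b ^ 2) <= eps * Cmod b ^ 2 + (1 + / eps) * Cmod (a - b) ^ 2.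
Proof.
intros He. assert (H := Cmod_rev_triangle a b).
assert (A0 := Cmod_ge_0 a). assert (B0 := Cmod_ge_0 b). assert (E0 := Cmod_ge_0 (a - b)).
set (x := Cmod a) in *. set (y := Cmod b) in *. set (e := Cmod (a - b)) in *.
apply Rabs_le_between in H.
assert (K : 2 * y * e <= eps * y ^ 2 + / eps * e ^ 2).
{ assert (0 < / eps) by (apply Rinv_0_lt_compat; assumption).
  assert (S : 0 <= / eps * (eps * y - e) ^ 2) by (apply Rmult_le_pos; [lra|apply pow2_ge_0]).
  replace (/ eps * (eps * y - e) ^ 2) with (eps * y ^ 2 - 2 * y * e + / eps * e ^ 2) in S by (field; lra).
  lra. }
apply Rabs_le. split; nra.
Qed.

(** Integrates the pointwise comparison of [zeta^k] with [dpoly]; [|kappa| >= 1] allows it to be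
    dropped from the contour estimate. The mean value theorem is used three times: for [dpoly] and
    for the two halves of [lpoly]. The last term is the tail of [D_k] beyond [N]. *)
Lemma moment_core k N sigma T X eta V R0 eps :
  (1 <= k)%nat -> (1 <= N)%nat -> 0 < eta -> 1 / 2 < sigma - eta -> sigma < 1 -> 2 <= T -> 0 < X ->
  4 - sigma <= V -> 0 < eps ->
  (forall t, T <= t <= 2 * T ->
    Cmod (kappa eta (4 - sigma) V * (zeta (sigma, t) ^ k - dpoly k N (sigma, t))
        - lpoly k N X eta V (sigma, t)) <= R0) ->
  Rabs (moment k sigma T / Dsum k sigma - 1) <=
    eps * (1 + 2 * INR N ^ 2 / T) + 2 * INR N ^ 2 / T
    + (1 + / eps) * (16 * (1 + 2 * INR N ^ 2 / T) * (Lam eta V ^ 2 * Rpower X (- (2 * eta)) * Dsum k (sigma - eta)) + 2 * R0 ^ 2)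
    + Rpower (INR N) (- (2 * eta)) * Dsum k (sigma - eta).
Proof.
intros Hk HN He H1 H2 HT HX HV Heps HR.
set (D := Dsum k sigma). set (D' := Dsum k (sigma - eta)).
assert (D1 : 1 <= D) by (apply Dsum_ge1; [assumption|lra]).
assert (D'1 : 1 <= D') by (apply Dsum_ge1; [assumption|lra]).
set (p := fun n => INR (dk k n) * fst (lcoef X eta V n)).
set (q := fun n => INR (dk k n) * snd (lcoef X eta V n)).
destruct (mean_value_dirp (fun n => INR (dk k n)) sigma N T (2 * T)) as [IP [HP BP]].
destruct (mean_value_dirp p sigma N T (2 * T)) as [I1 [HI1 B1]].
destruct (mean_value_dirp q sigma N T (2 * T)) as [I2 [HI2 B2]].
change (fun n : nat => INR (dk k n) ^ 2 / Rpower (INR n) (2 * sigma)) with (dksq k sigma) in BP.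
set (Q := rsum (dksq k sigma) N) in *.
set (Q1 := rsum (fun n => p n ^ 2 / Rpower (INR n) (2 * sigma)) N) in *.
set (Q2 := rsum (fun n => q n ^ 2 / Rpower (INR n) (2 * sigma)) N) in *.
assert (QD : Q <= D) by (apply rsum_dksq_le_Dsum; [assumption|lra]).
assert (Q0 : 0 <= Q).
{ unfold Q. pose proof (rsum_mono (dksq k sigma) 0 N (fun n _ => dksq_ge0 k sigma n)) as H. exact H. }
assert (QT : D - Q <= Rpower (INR N) (- (2 * eta)) * D').
{ apply Dsum_tail_le; auto; lra. }
assert (QL : Q1 + Q2 <= 4 * (Lam eta V ^ 2 * Rpower X (- (2 * eta)) * D')).
{ eapply Rle_trans; [apply lpoly_mass; auto; lra|]. unfold D'. lra. }
replace (2 * T - T) with T in * by ring.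
set (n2 := 2 * INR N ^ 2) in *.
assert (n20 : 0 <= n2) by (unfold n2; pose proof (pow2_ge_0 (INR N)); lra).
set (f := fun t => Cmod (zeta (sigma, t)) ^ (2 * k)).
assert (Hf : is_RInt f T (2 * T) (T * moment k sigma T)).
{ unfold moment. fold f.
  assert (E : forall x : R, T * (x / T) = x) by (intros x; field; lra).
  rewrite E.
  apply (RInt_correct (V := R_CompleteNormedModule)). apply ex_RInt_zeta_pow; lra. }
set (g := fun t => eps * Cmod (dirp (fun n => INR (dk k n)) sigma N t) ^ 2 +
   (1 + / eps) * (4 * Cmod (dirp p sigma N t) ^ 2 + 4 * Cmod (dirp q sigma N t) ^ 2 + 2 * R0 ^ 2)).
set (Ig := eps * IP + (1 + / eps) * (4 * I1 + 4 * I2 + T * (2 * R0 ^ 2))).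
assert (Hg : is_RInt g T (2 * T) Ig).
{ apply (is_RInt_plus (V := R_NormedModule)); [apply (is_RInt_scal (V := R_NormedModule)); exact HP|].
  apply (is_RInt_scal (V := R_NormedModule)).
  apply (is_RInt_plus (V := R_NormedModule)).
  - apply (is_RInt_plus (V := R_NormedModule)); apply (is_RInt_scal (V := R_NormedModule)); assumption.
  - evar_last; [apply (is_RInt_const (V := R_NormedModule))|].
    unfold scal; simpl; unfold mult; simpl. ring. }
assert (ie : 0 < / eps) by (apply Rinv_0_lt_compat; assumption).
assert (Hdiff : is_RInt (fun t => f t - Cmod (dirp (fun n => INR (dk k n)) sigma N t) ^ 2) T (2 * T) (T * moment k sigma T - IP)).
{ apply (is_RInt_minus (V := R_NormedModule)); assumption. }
assert (Hpt : forall t, T <= t <= 2 * T -> Rabs (f t - Cmod (dirp (fun n => INR (dk k n)) sigma N t) ^ 2) <= g t).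
{ intros t Ht.
  change (dirp (fun n => INR (dk k n)) sigma N t) with (dpoly k N (sigma, t)) in *.
  unfold f. rewrite Nat.mul_comm, pow_mult, <- Cmod_pow.
  eapply Rle_trans; [apply (Cmod_sqr_perturb _ _ eps Heps)|].
  unfold g. change (dirp (fun n => INR (dk k n)) sigma N t) with (dpoly k N (sigma, t)).
  apply Rplus_le_compat_l. apply Rmult_le_compat_l; [lra|].
  set (E := (zeta (sigma, t) ^ k - dpoly k N (sigma, t))%C).
  specialize (HR t Ht). fold E in HR.
  assert (K1 := Cmod_kappa_ge1 eta (4 - sigma) V He ltac:(lra) HV).
  assert (E0 := Cmod_ge_0 E).
  assert (HE : Cmod E <= Cmod (lpoly k N X eta V (sigma, t)) + R0).
  { apply Rle_trans with (Cmod (kappa eta (4 - sigma) V * E)); [rewrite Cmod_mult; nra|].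
    replace (kappa eta (4 - sigma)%R V * E)%C with (lpoly k N X eta V (sigma, t) + (kappa eta (4 - sigma)%R V * E - lpoly k N X eta V (sigma, t)))%C by ring.
    eapply Rle_trans; [apply Cmod_triangle|]. lra. }
  assert (HL : Cmod (lpoly k N X eta V (sigma, t)) <= Cmod (dirp p sigma N t) + Cmod (dirp q sigma N t)).
  { rewrite lpoly_split. eapply Rle_trans; [apply Cmod_triangle|]. rewrite Cmod_mult, Cmod_Ci, Rmult_1_l. unfold p, q. lra. }
  assert (P0 := Cmod_ge_0 (dirp p sigma N t)). assert (Q0' := Cmod_ge_0 (dirp q sigma N t)).
  set (x := Cmod (dirp p sigma N t)) in *. set (y := Cmod (dirp q sigma N t)) in *.
  (* [(x + y + R0)^2 <= 2 (x + y)^2 + 2 R0^2 <= 4 x^2 + 4 y^2 + 2 R0^2]. *)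
  apply Rle_trans with ((x + y + R0) ^ 2); [apply pow_incr; lra|].
  pose proof (pow2_ge_0 (x - y)). pose proof (pow2_ge_0 (x + y - R0)). nra. }
assert (HB : Rabs (T * moment k sigma T - IP) <= Ig).
{ rewrite <- (is_RInt_unique _ _ _ _ Hdiff), <- (is_RInt_unique _ _ _ _ Hg).
  apply RInt_abs_bound; [lra|eexists; exact Hdiff|eexists; exact Hg|exact Hpt]. }
apply Rabs_le_between in BP. apply Rabs_le_between in B1. apply Rabs_le_between in B2.
set (m := moment k sigma T) in *.
set (Y := Lam eta V ^ 2 * Rpower X (- (2 * eta)) * D') in *.
set (Z := Rpower (INR N) (- (2 * eta)) * D') in *.
assert (IPle : IP <= (T + n2) * D) by nra.
assert (I12 : 4 * I1 + 4 * I2 <= 16 * (T + n2) * Y) by nra.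
assert (Igle : Ig <= eps * ((T + n2) * D) + (1 + / eps) * (16 * (T + n2) * Y + T * (2 * R0 ^ 2))).
{ unfold Ig. apply Rplus_le_compat; apply Rmult_le_compat_l; lra. }
assert (IPT : Rabs (IP - T * D) <= n2 * D + T * Z).
{ assert (n2 * Q <= n2 * D) by (apply Rmult_le_compat_l; lra).
  assert (T * (D - Q) <= T * Z) by (apply Rmult_le_compat_l; lra).
  assert (T * Q <= T * D) by (apply Rmult_le_compat_l; lra).
  apply Rabs_le. split; nra. }
assert (Tot : Rabs (T * m - T * D) <= eps * ((T + n2) * D) + (1 + / eps) * (16 * (T + n2) * Y + T * (2 * R0 ^ 2)) + (n2 * D + T * Z)).
{ replace (T * m - T * D) with ((T * m - IP) + (IP - T * D)) by ring.
  eapply Rle_trans; [apply Rabs_triang|]. lra. }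
replace (m / D - 1) with ((T * m - T * D) * / (T * D)) by (field; lra).
assert (TD : 0 < T * D) by (apply Rmult_lt_0_compat; lra).
rewrite Rabs_mult, (Rabs_pos_eq (/ (T * D))) by (apply Rlt_le, Rinv_0_lt_compat; assumption).
apply (Rmult_le_reg_r (T * D)); [assumption|]. rewrite Rmult_assoc, Rinv_l, Rmult_1_r by lra.
eapply Rle_trans; [exact Tot|].
assert (Y0 : 0 <= Y).
{ unfold Y. apply Rmult_le_pos; [|lra]. apply Rmult_le_pos; [apply pow2_ge_0|apply Rlt_le, Rpower_pos]. }
assert (Z0 : 0 <= Z) by (unfold Z; apply Rmult_le_pos; [apply Rlt_le, Rpower_pos|lra]).
assert (R20 : 0 <= 2 * R0 ^ 2) by (pose proof (pow2_ge_0 R0); lra).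
set (G := 16 * (T + n2) * Y + T * (2 * R0 ^ 2)).
assert (G0 : 0 <= G).
{ unfold G. apply Rplus_le_le_0_compat; apply Rmult_le_pos; lra. }
replace ((eps * (1 + n2 / T) + n2 / T + (1 + / eps) * (16 * (1 + n2 / T) * Y + 2 * R0 ^ 2) + Z) * (T * D)) with
  (eps * ((T + n2) * D) + n2 * D + ((1 + / eps) * G) * D + T * Z * D) by (unfold G; field; lra).
assert (0 <= (1 + / eps) * G) by (apply Rmult_le_pos; lra).
assert (0 <= T * Z) by (apply Rmult_le_pos; lra).
(* [D >= 1] turns the absolute errors into relative ones. *)
assert ((1 + / eps) * G * 1 <= (1 + / eps) * G * D) by (apply Rmult_le_compat_l; lra).
assert (T * Z * 1 <= T * Z * D) by (apply Rmult_le_compat_l; lra).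
lra.
Qed.

(** * Inequalities for the choice of parameters *)

(** [ln x = 4 ln (x^(1/4)) <= 4 x^(1/4)], so the square is at most [16 sqrt x]. This is at most
    [x / 128] once [sqrt x >= 2048], that is [x >= 2^22 = 4194304]. *)
Lemma ln_sqr_le x : 4194304 <= x -> ln x ^ 2 <= x / 128.
Proof.
intros Hx.
set (r := sqrt x). assert (r0 : 0 <= r) by apply sqrt_pos.
assert (rr : r * r = x) by (apply sqrt_sqrt; lra).
assert (r1 : 2048 <= r).
{ unfold r. rewrite <- (sqrt_pow2 2048) by lra. apply sqrt_le_1_alt. lra. }
set (s := sqrt r). assert (s0 : 0 <= s) by apply sqrt_pos.
assert (ss : s * s = r) by (apply sqrt_sqrt; lra).
assert (s1 : 1 <= s) by nra.
assert (E : ln x = 4 * ln s).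
{ rewrite <- rr, <- ss, !ln_mult by nra. ring. }
assert (L := ln_le_self s s1).
assert (0 <= ln x <= 4 * s) by lra.
assert (ln x ^ 2 <= (4 * s) ^ 2) by (apply pow_incr; lra). nra.
Qed.

(** [ln_sqr_le] is exactly [2 ln l <= l / ln l / 64], so the exponential is at most [l^(-2)]. *)
Lemma small_factor l : 4194304 <= l -> l * exp (- (l / ln l / 64)) <= / l.
Proof.
intros Hl. assert (A := ln_sqr_le l Hl).
assert (L1 : 1 <= ln l).
{ rewrite <- (ln_exp 1). apply ln_le; [apply exp_pos|]. pose proof exp_le_3. lra. }
assert (B : 2 * ln l <= l / ln l / 64).
{ apply (Rmult_le_reg_r (64 * ln l)); [lra|].
  replace (l / ln l / 64 * (64 * ln l)) with l by (field; lra). nra. }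
apply Rle_trans with (l * exp (- (2 * ln l))).
- apply Rmult_le_compat_l; [lra|]. apply exp_le. lra.
- replace (- (2 * ln l)) with (- ln l + - ln l) by ring.
  rewrite exp_plus, !exp_Ropp, exp_ln by lra. right. field. lra.
Qed.

Lemma Rpower_le_self x a : 0 < x <= 1 -> 1 <= a -> Rpower x a <= x.
Proof.
intros Hx Ha. rewrite <- (Rpower_1 x) at 2 by lra. unfold Rpower. apply exp_le.
assert (ln x <= 0) by (rewrite <- ln_1; apply ln_le; lra). nra.
Qed.

(** Replacing [1 / sigma] by [1 / (sigma - eta)] adds at most [4 eta = 2 / ln l] to the exponent,
    and [l^(2 / ln l) = e^2 <= 9]: the shift of the line costs only a constant. The factor
    [c / ln l] survives because [1 / sigma >= 1]. *)
Lemma k_power_le sigma delta eta c l k :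
  1 / 2 < sigma < 1 -> 0 < delta <= sigma -> 0 < c <= 1 -> 1 <= ln l -> eta = / (2 * ln l) -> 1 / 2 < sigma - eta ->
  1 <= k -> k <= c * Rpower l delta / ln l ->
  Rpower k (/ (sigma - eta)) <= 9 * c * (l / ln l).
Proof.
intros Hs Hd Hc Hl He Hse Hk1 Hk2.
assert (l0 : 1 <= l).
{ destruct (Rle_dec 1 l) as [H|H]; [exact H|]. exfalso.
  destruct (Rle_dec l 0) as [H'|H'].
  - rewrite ln_nonpos in Hl; lra.
  - assert (ln l <= 0) by (rewrite <- ln_1; apply ln_le; lra). lra. }
assert (e0 : 0 < eta) by (rewrite He; apply Rinv_0_lt_compat; lra).
set (x := c * Rpower l delta / ln l) in *.
assert (P1 : 1 <= Rpower l delta) by (apply Rpower_ge1; lra).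
assert (P2 : Rpower l delta <= l).
{ rewrite <- (Rpower_1 l) at 2 by lra. apply Rle_Rpower; lra. }
assert (il : 0 < / ln l <= 1).
{ split; [apply Rinv_0_lt_compat; lra|]. rewrite <- Rinv_1. apply Rinv_le_contravar; lra. }
assert (xl : x <= l).
{ unfold x, Rdiv. assert (c * Rpower l delta <= l) by nra.
  assert (0 <= c * Rpower l delta) by nra. nra. }
set (s' := sigma - eta) in *.
assert (is' : 0 < / s') by (apply Rinv_0_lt_compat; lra).
apply Rle_trans with (Rpower x (/ s')); [apply Rpower_le_base_pos; lra|].
assert (E : / s' = / sigma + (eta / (sigma * s'))) by (unfold s' in *; field; lra).
assert (B : eta / (sigma * s') <= 2 / ln l).
{ apply Rle_trans with (eta * 4).
  - unfold Rdiv. apply Rmult_le_compat_l; [lra|].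
    replace 4 with (/ (/ 4)) by field. apply Rinv_le_contravar; [lra|]. nra.
  - rewrite He. right. field. lra. }
rewrite E, Rpower_plus.
assert (F1 : Rpower x (eta / (sigma * s')) <= 9).
{ apply Rle_trans with (Rpower l (2 / ln l)).
  - apply Rle_trans with (Rpower x (2 / ln l)); [apply Rle_Rpower; lra|].
    apply Rpower_le_base_pos; [lra|]. apply Rlt_le, Rdiv_lt_0_compat; lra.
  - unfold Rpower. replace (2 / ln l * ln l) with (1 + 1) by (field; lra). rewrite exp_plus.
    pose proof exp_le_3. pose proof (exp_pos 1). nra. }
assert (F2 : Rpower x (/ sigma) <= c * (l / ln l)).
{ replace x with ((c * / ln l) * Rpower l delta) by (unfold x, Rdiv; ring).
  assert (c0 : 0 < c * / ln l) by (apply Rmult_lt_0_compat; lra).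
  rewrite <- Rpower_mult_distr by lra.
  assert (G1 : Rpower (c * / ln l) (/ sigma) <= c * / ln l).
  { apply Rpower_le_self; [split; [assumption|nra]|]. rewrite <- Rinv_1. apply Rinv_le_contravar; lra. }
  assert (G2 : Rpower (Rpower l delta) (/ sigma) <= l).
  { rewrite Rpower_mult. rewrite <- (Rpower_1 l) at 2 by lra. apply Rle_Rpower; [lra|].
    apply (Rmult_le_reg_r sigma); [lra|]. rewrite Rmult_assoc, Rinv_l; lra. }
  replace (c * (l / ln l)) with ((c * / ln l) * l) by (unfold Rdiv; ring).
  apply Rmult_le_compat; try (apply Rlt_le, Rpower_pos); assumption. }
assert (0 < c * (l / ln l)).
{ apply Rmult_lt_0_compat; [lra|]. apply Rdiv_lt_0_compat; lra. }
apply Rle_trans with (c * (l / ln l) * 9); [|lra].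
apply Rmult_le_compat; try (apply Rlt_le, Rpower_pos); assumption.
Qed.

(** The height [t + v] may leave [[T, 2T]], so the hypothesis is applied at [T / 2], [T] or [2T].
    There [ln ln T' <= 2 ln ln T], which is why the shift to the left is half of the permitted one,
    and [(ln T')^(1 - delta)] at most doubles, hence [2 C]. *)
Lemma zeta_region_bound sigma delta C T1 T t x v :
  1 / 2 < sigma < 1 -> 0 < delta <= sigma -> 0 < C ->
  (forall T, T1 <= T -> forall beta, sigma - 1 / ln (ln T) <= beta ->
     LT_le beta T (C * Rpower (ln T) (1 - delta))) ->
  2 * T1 <= T -> 100 <= ln T ->
  T <= t <= 2 * T -> - (T / 2) <= v <= T / 2 -> - / (2 * ln (ln T)) <= x ->
  Cmod (zeta (sigma + x, t + v)) <= exp (2 * C * Rpower (ln T) (1 - delta)).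
Proof.
intros Hs Hd HC H HT Hl Ht Hv Hx.
set (l := ln T) in *.
assert (T0 : 0 < T).
{ destruct (Rle_dec T 0) as [N|N]; [|lra]. unfold l in Hl. rewrite ln_nonpos in Hl; lra. }
assert (ET : exp l = T) by (apply exp_ln; exact T0).
assert (T2 : 101 <= T) by (rewrite <- ET; pose proof (exp_ineq1_le l); lra).
assert (l2 : ln 2 <= 1).
{ rewrite <- (ln_exp 1). apply ln_le; [lra|]. pose proof (exp_ineq1_le 1). lra. }
assert (l2' : 0 <= ln 2) by (rewrite <- ln_1; apply ln_le; lra).
assert (K : forall T', T / 2 <= T' <= 2 * T -> T' <= t + v <= 2 * T' ->
  Cmod (zeta (sigma + x, t + v)) <= exp (2 * C * Rpower l (1 - delta))).
{ intros T' H1 H2.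
  assert (La : ln T' <= 2 * l).
  { apply Rle_trans with (ln (2 * T)); [apply ln_le; lra|]. rewrite ln_mult by lra. fold l. lra. }
  assert (Lb : 3 <= ln T').
  { apply Rle_trans with (ln (T / 2)); [|apply ln_le; lra]. rewrite ln_div by lra. fold l. lra. }
  assert (La2 : ln T' <= l * l) by nra.
  assert (Lc : 1 <= ln (ln T')).
  { rewrite <- (ln_exp 1). apply ln_le; [apply exp_pos|]. pose proof exp_le_3. lra. }
  assert (Ld : ln (ln T') <= 2 * ln l).
  { replace (2 * ln l) with (ln (l * l)) by (rewrite ln_mult by lra; ring). apply ln_le; lra. }
  assert (Hb : sigma - 1 / ln (ln T') <= sigma + x).
  { assert (/ (2 * ln l) <= / ln (ln T')) by (apply Rinv_le_contravar; lra).
    unfold Rdiv. lra. }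
  assert (B := H T' ltac:(lra) (sigma + x) Hb (t + v) H2).
  set (z := Cmod (zeta (sigma + x, t + v))) in *.
  assert (Bd : C * Rpower (ln T') (1 - delta) <= 2 * C * Rpower l (1 - delta)).
  { apply Rle_trans with (C * (2 * Rpower l (1 - delta))); [|right; ring].
    apply Rmult_le_compat_l; [lra|].
    apply Rle_trans with (Rpower (2 * l) (1 - delta)); [apply Rpower_le_base_pos; lra|].
    rewrite <- Rpower_mult_distr by lra.
    apply Rmult_le_compat_r; [apply Rlt_le, Rpower_pos|].
    apply Rle_trans with (Rpower 2 1); [apply Rle_Rpower; lra|rewrite Rpower_1; lra]. }
  (* At [z = 0] the default value of [ln] carries no information, but the bound is trivial. *)
  destruct (Rle_dec z 0) as [z0|z0].
  - eapply Rle_trans; [exact z0|apply Rlt_le, exp_pos].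
  - rewrite <- (exp_ln z) by lra. apply exp_le. lra. }
destruct (Rle_dec (t + v) T) as [A|A]; [apply (K (T / 2)); lra|].
destruct (Rle_dec (t + v) (2 * T)) as [A'|A']; [apply (K T); lra|apply (K (2 * T)); lra].
Qed.

Lemma two_pow_le_exp k : 2 ^ k <= exp (INR k).
Proof.
replace (INR k) with (INR k * 1) by ring. rewrite <- pow_exp. apply pow_incr.
pose proof (exp_ineq1_le 1). lra.
Qed.

Lemma exp_plus1_pow_le B k : 0 <= B -> (exp B + 1) ^ k <= exp (INR k * (B + 1)).
Proof.
intros HB. rewrite <- pow_exp. apply pow_incr. pose proof (exp_pos B). split; [lra|].
rewrite exp_plus. assert (1 <= exp B) by (rewrite <- exp_0; apply exp_le; lra).
pose proof (exp_ineq1_le 1). nra.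
Qed.

(** * Error terms in the single scale [y = log T / log log T] *)

Section Quantitative.
Variables (sigma delta Cz c : R) (k : nat) (l : R).
(** [X^(-eta) = exp (- y / 32)] is the available gain, and [exp (y / 64)] is the size allowed for
    each of [zeta^k], [2^k] and [D_k (sigma - eta)]. What remains is [exp (- y / 64)]; [w] includes
    the factor [l] lost through [Lam], and still is at most [1 / l]. *)
Let T := exp l.
Let y := l / ln l.
Let eta := / (2 * ln l).
Let X := exp (l / 16).
Let w := l * exp (- (y / 64)).
Hypothesis Hs : 1 / 2 < sigma < 1.
Hypothesis Hd : 0 < delta <= sigma.
Hypothesis HC : 0 < Cz.
Hypothesis Hc : 0 < c <= 1.
Hypothesis Hc1 : c * (2 * Cz + 1) <= / 64.
Hypothesis Hc2 : (7 / (1 - sigma) + 4 / (sigma - 1 / 2)) * (9 * c) <= / 64.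
Hypothesis Hl : 4194304 <= l.
Hypothesis Heta : (sigma + 1 / 2) / 2 <= sigma - eta.
Hypothesis Hk : (1 <= k)%nat.
Hypothesis Hkl : INR k <= c * Rpower l delta / ln l.

Lemma ln_l_ge1 : 1 <= ln l.
Proof.
rewrite <- (ln_exp 1). apply ln_le; [apply exp_pos|]. pose proof exp_le_3. lra.
Qed.

Lemma eta_pos : 0 < eta.
Proof. apply Rinv_0_lt_compat. pose proof ln_l_ge1. lra. Qed.

Lemma y_bounds : 0 < y <= l.
Proof.
pose proof ln_l_ge1 as L. unfold y. split; [apply Rdiv_lt_0_compat; lra|].
apply (Rmult_le_reg_r (ln l)); [lra|]. unfold Rdiv. rewrite Rmult_assoc, Rinv_l; nra.
Qed.

Lemma k_le_y : INR k <= c * y.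
Proof.
pose proof ln_l_ge1 as L. eapply Rle_trans; [exact Hkl|]. unfold y, Rdiv.
rewrite Rmult_assoc. apply Rmult_le_compat_l; [lra|].
apply Rmult_le_compat_r; [apply Rlt_le, Rinv_0_lt_compat; lra|].
rewrite <- (Rpower_1 l) at 2 by lra. apply Rle_Rpower; lra.
Qed.

(** The exponents [delta] and [1 - delta] add up to 1, so [k l^(1 - delta) <= c l / ln l = c y]. *)
Lemma zeta_bound_pow_le : (exp (2 * Cz * Rpower l (1 - delta)) + 1) ^ k <= exp (y / 64).
Proof.
pose proof ln_l_ge1 as L. pose proof y_bounds as Y. pose proof (Rpower_pos l (1 - delta)) as P.
eapply Rle_trans; [apply exp_plus1_pow_le|apply exp_le].
- apply Rmult_le_pos; lra.
- assert (A : INR k * Rpower l (1 - delta) <= c * y).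
  { apply Rle_trans with (c * Rpower l delta / ln l * Rpower l (1 - delta)); [apply Rmult_le_compat_r; lra|].
    right. replace (c * Rpower l delta / ln l * Rpower l (1 - delta)) with
      (c * (Rpower l delta * Rpower l (1 - delta)) / ln l) by (unfold Rdiv; ring).
    rewrite <- Rpower_plus. replace (delta + (1 - delta)) with 1 by ring. rewrite Rpower_1 by lra.
    unfold y, Rdiv. ring. }
  pose proof k_le_y as B.
  apply Rle_trans with (2 * Cz * (c * y) + c * y); [nra|].
  apply Rle_trans with ((c * (2 * Cz + 1)) * y); [right; ring|]. nra.
Qed.

Lemma two_pow_le : 2 ^ k <= exp (y / 64).
Proof.
eapply Rle_trans; [apply two_pow_le_exp|apply exp_le].
pose proof k_le_y. pose proof y_bounds.
assert (c <= / 64) by nra. nra.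
Qed.

(** [Heta] keeps [sigma - eta] at distance at least [(sigma - 1/2) / 2] from [1/2], so the constant
    of [Dsum_le] stays bounded while [eta] varies with [T]. *)
Lemma Dsum_shift_le : Dsum k (sigma - eta) <= exp (y / 64).
Proof.
pose proof ln_l_ge1 as L. pose proof eta_pos as E. pose proof y_bounds as Y.
eapply Rle_trans; [apply Dsum_le; [assumption|lra]|apply exp_le].
assert (K1 : 7 / (1 - (sigma - eta)) <= 7 / (1 - sigma)).
{ unfold Rdiv. apply Rmult_le_compat_l; [lra|]. apply Rinv_le_contravar; lra. }
assert (K2 : 4 / (2 * (sigma - eta) - 1) <= 4 / (sigma - 1 / 2)).
{ unfold Rdiv. apply Rmult_le_compat_l; [lra|]. apply Rinv_le_contravar; lra. }
assert (K0 : 0 < 7 / (1 - sigma) + 4 / (sigma - 1 / 2)).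
{ apply Rplus_lt_0_compat; apply Rdiv_lt_0_compat; lra. }
assert (P := k_power_le sigma delta eta c l (INR k) Hs Hd Hc L eq_refl ltac:(lra) ltac:(apply (le_INR 1); lia) Hkl).
fold y in P. pose proof (Rpower_pos (INR k) (/ (sigma - eta))).
apply Rle_trans with ((7 / (1 - sigma) + 4 / (sigma - 1 / 2)) * (9 * c * y)).
- apply Rmult_le_compat; try lra.
  assert (0 < 7 / (1 - (sigma - eta))) by (apply Rdiv_lt_0_compat; lra).
  assert (0 < 4 / (2 * (sigma - eta) - 1)) by (apply Rdiv_lt_0_compat; lra). lra.
- replace ((7 / (1 - sigma) + 4 / (sigma - 1 / 2)) * (9 * c * y)) with
   ((7 / (1 - sigma) + 4 / (sigma - 1 / 2)) * (9 * c) * y) by ring. nra.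
Qed.

Lemma T_ge : 8 * l <= T.
Proof.
unfold T. replace l with (l / 2 + l / 2) at 2 by field. rewrite exp_plus.
pose proof (exp_ineq1_le (l / 2)). nra.
Qed.

Lemma Lam_bounds : 0 <= Lam eta (T / 2) <= 4 * l.
Proof.
pose proof T_ge as HT. pose proof ln_l_ge1 as L. pose proof eta_pos as E.
destruct (Lam_le eta (T / 2)) as [A B]; [assumption|lra|]. split; [assumption|].
eapply Rle_trans; [exact B|].
replace (4 * l) with (2 * ln (T * T)).
- apply Rmult_le_compat_l; [lra|]. apply ln_le; [apply Rdiv_lt_0_compat; lra|].
  (* It remains to see [2 T ln l + 1 <= T^2], which follows from [T >= 8 l]. *)
  replace ((2 * (T / 2) + eta) / eta) with (T * (2 * ln l) + 1) by (unfold eta; field; lra).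
  assert (ln l <= l) by (apply ln_le_self; lra). nra.
- unfold T. rewrite <- exp_plus, ln_exp. ring.
Qed.

Lemma Rpower_X e : Rpower X e = exp (e * l / 16).
Proof. unfold X, Rpower. rewrite ln_exp. f_equal. field. Qed.

Lemma Rpower_X_eta e : Rpower X (e * eta) = exp (e * y / 32).
Proof.
pose proof ln_l_ge1. rewrite Rpower_X. f_equal. unfold eta, y. field. lra.
Qed.

Lemma w_bounds : 0 < w <= / l /\ exp (- (y / 64)) <= w.
Proof.
pose proof (small_factor l Hl) as S. fold y in S. fold w in S.
pose proof (exp_pos (- (y / 64))). unfold w in *. repeat split; nra.
Qed.

Lemma X_ge1 : 1 <= X.
Proof. unfold X. rewrite <- exp_0. apply exp_le. lra. Qed.

Lemma pow_X n : X ^ n = exp (INR n * l / 16).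
Proof. unfold X. rewrite pow_exp. f_equal. field. Qed.

Lemma N_sqr_div_T_le N : INR N <= 2 * X ^ 2 -> 2 * INR N ^ 2 / T <= 8 * w.
Proof.
intros HN2. pose proof X_ge1 as X1. pose proof y_bounds as Y. pose proof w_bounds as [_ W].
assert (A : INR N ^ 2 <= (2 * X ^ 2) ^ 2) by (apply pow_incr; split; [apply pos_INR|assumption]).
apply Rle_trans with (8 * (X ^ 4 / T)).
- replace (8 * (X ^ 4 / T)) with (2 * (2 * X ^ 2) ^ 2 / T) by (field; apply Rgt_not_eq, exp_pos).
  unfold Rdiv. apply Rmult_le_compat_r; [apply Rlt_le, Rinv_0_lt_compat, exp_pos|]. lra.
- apply Rmult_le_compat_l; [lra|]. eapply Rle_trans; [|exact W].
  rewrite pow_X. unfold T, Rdiv at 1. rewrite <- exp_Ropp, <- exp_plus. apply exp_le. simpl. lra.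
Qed.

(** [N >= X^2] gives [N^(-2 eta) <= X^(-4 eta) = exp (- y / 8)]. *)
Lemma Dsum_tail_small N : X ^ 2 <= INR N -> Rpower (INR N) (- (2 * eta)) * Dsum k (sigma - eta) <= w.
Proof.
intros HN1. pose proof X_ge1 as X1. pose proof y_bounds as Y. pose proof w_bounds as [_ W]. pose proof eta_pos as E. pose proof Dsum_shift_le as D.
eapply Rle_trans; [|exact W].
apply Rle_trans with (exp (- (y / 8)) * exp (y / 64)).
- apply Rmult_le_compat; [apply Rlt_le, Rpower_pos| | |exact D].
  + pose proof (Dsum_ge1 k (sigma - eta) Hk ltac:(lra)). lra.
  + apply Rle_trans with (Rpower (X ^ 2) (- (2 * eta))).
    * apply Rpower_le_base_neg; [split; [nra|assumption]|lra].
    * rewrite Rpower_pow_l by lra. replace (- (2 * eta)) with ((-2) * eta) by ring.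
      rewrite Rpower_X_eta, pow_exp. apply exp_le. simpl. lra.
- rewrite <- exp_plus. apply exp_le. lra.
Qed.

Lemma left_mass_small : Lam eta (T / 2) ^ 2 * Rpower X (- (2 * eta)) * Dsum k (sigma - eta) <= 16 * w ^ 2.
Proof.
pose proof X_ge1 as X1. pose proof y_bounds as Y. pose proof eta_pos as E. pose proof Dsum_shift_le as D.
pose proof Lam_bounds as [L0 L1]. pose proof (Dsum_ge1 k (sigma - eta) Hk ltac:(lra)) as D1.
replace (- (2 * eta)) with ((-2) * eta) by ring. rewrite Rpower_X_eta.
apply Rle_trans with ((4 * l) ^ 2 * exp (-2 * y / 32) * exp (y / 64)).
- apply Rmult_le_compat; [|lra| |exact D].
  + apply Rmult_le_pos; [apply pow2_ge_0|apply Rlt_le, exp_pos].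
  + apply Rmult_le_compat_r; [apply Rlt_le, exp_pos|]. apply pow_incr. lra.
- unfold w. replace (16 * (l * exp (- (y / 64))) ^ 2) with ((4 * l) ^ 2 * exp (- (y / 64)) ^ 2) by ring.
  rewrite pow_exp, Rmult_assoc, <- exp_plus.
  apply Rmult_le_compat_l; [apply pow2_ge_0|]. apply exp_le. simpl. lra.
Qed.

(** Horizontal sides: [N^2 X^4 / T] is about [X^8 / T = T^(-1/2)]. Right side: [N >= X^2] makes the
    tail at most [X^(-4)] times [2^k], which beats [X^(4 - sigma)]; this fixes the length of
    [dpoly]. Left side: [exp (y / 64) X^(-eta)]. The constants 160, 16 and 8 add up to less than
    200. *)
Lemma remainder_small N : X ^ 2 <= INR N -> INR N <= 2 * X ^ 2 ->
  4 * (((exp (2 * Cz * Rpower l (1 - delta)) + 1) ^ k + INR N ^ 2 * 2 ^ k) * Rpower X (4 - sigma) / (T / 2) * (4 - sigma + eta))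
     + 2 * ((2 * (2 ^ k / (INR N + 1) ^ 2)) * Rpower X (4 - sigma)) * Lam eta (T / 2)
     + 2 * ((exp (2 * Cz * Rpower l (1 - delta)) + 1) ^ k * Rpower X (- eta)) * Lam eta (T / 2)
  <= 200 * w.
Proof.
intros HN1 HN2.
pose proof X_ge1 as X1. pose proof y_bounds as Y. pose proof eta_pos as E.
pose proof Lam_bounds as [L0 L1]. pose proof zeta_bound_pow_le as Z. pose proof two_pow_le as W2. pose proof w_bounds as [[w0 w1] W].
pose proof (exp_pos (y / 64)) as ey. pose proof (Rpower_pos X (4 - sigma)) as PX.
set (G := (exp (2 * Cz * Rpower l (1 - delta)) + 1) ^ k) in *.
assert (G0 : 0 <= G) by (apply pow_le; pose proof (exp_pos (2 * Cz * Rpower l (1 - delta))); lra).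
assert (p0 : 0 < 2 ^ k) by (apply pow_lt; lra).
set (Lm := Lam eta (T / 2)) in *.
assert (Tpos : 0 < T) by apply exp_pos.
assert (N2 : INR N ^ 2 <= 4 * X ^ 4).
{ replace (4 * X ^ 4) with ((2 * X ^ 2) ^ 2) by ring. apply pow_incr. split; [apply pos_INR|assumption]. }
assert (X41 : 1 <= X ^ 4) by (apply pow_R1_Rle; lra).
assert (A1 : 4 * ((G + INR N ^ 2 * 2 ^ k) * Rpower X (4 - sigma) / (T / 2) * (4 - sigma + eta)) <= 160 * w).
{ assert (B1 : G + INR N ^ 2 * 2 ^ k <= 5 * X ^ 4 * exp (y / 64)).
  { assert (INR N ^ 2 * 2 ^ k <= 4 * X ^ 4 * exp (y / 64)).
    { apply Rmult_le_compat; [apply pow2_ge_0|lra|assumption|assumption]. }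
    assert (1 * exp (y / 64) <= X ^ 4 * exp (y / 64)) by (apply Rmult_le_compat_r; lra). lra. }
  assert (B2 : Rpower X (4 - sigma) <= X ^ 4).
  { rewrite <- (Rpower_pow 4 X) by lra. apply Rle_Rpower; [lra|]. simpl. lra. }
  assert (B0 : 0 <= G + INR N ^ 2 * 2 ^ k).
  { apply Rplus_le_le_0_compat; [assumption|]. apply Rmult_le_pos; [apply pow2_ge_0|lra]. }
  assert (B3 : (G + INR N ^ 2 * 2 ^ k) * Rpower X (4 - sigma) <= 5 * X ^ 4 * exp (y / 64) * X ^ 4).
  { apply Rmult_le_compat; lra. }
  assert (B4 : 5 * X ^ 4 * exp (y / 64) * X ^ 4 / (T / 2) <= 10 * w).
  { replace (5 * X ^ 4 * exp (y / 64) * X ^ 4 / (T / 2)) with (10 * (X ^ 8 * exp (y / 64) / T)) by (field; lra).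
    apply Rmult_le_compat_l; [lra|]. eapply Rle_trans; [|exact W].
    rewrite pow_X. unfold T, Rdiv at 1. rewrite <- exp_Ropp, <- !exp_plus. apply exp_le. simpl. lra. }
  assert (B5 : (G + INR N ^ 2 * 2 ^ k) * Rpower X (4 - sigma) / (T / 2) <= 10 * w).
  { eapply Rle_trans; [|exact B4]. unfold Rdiv at 1 3. apply Rmult_le_compat_r; [|exact B3].
    apply Rlt_le, Rinv_0_lt_compat. lra. }
  assert (B6 : 0 <= (G + INR N ^ 2 * 2 ^ k) * Rpower X (4 - sigma) / (T / 2)).
  { apply Rmult_le_pos; [apply Rmult_le_pos; lra|]. apply Rlt_le, Rinv_0_lt_compat. lra. }
  nra. }
assert (A2 : 2 * ((2 * (2 ^ k / (INR N + 1) ^ 2)) * Rpower X (4 - sigma)) * Lm <= 16 * w).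
{ assert (B1 : 2 ^ k / (INR N + 1) ^ 2 <= exp (y / 64) / X ^ 4).
  { unfold Rdiv. apply Rmult_le_compat; [lra| |assumption|].
    - apply Rlt_le, Rinv_0_lt_compat, pow_lt. pose proof (pos_INR N). lra.
    - apply Rinv_le_contravar; [lra|]. replace (X ^ 4) with ((X ^ 2) ^ 2) by ring.
      apply pow_incr. split; [apply pow2_ge_0|lra]. }
  (* The exponent is [y / 64 - sigma l / 16], at most [y / 64 - y / 32] since [sigma > 1/2] and
     [y <= l]. *)
  assert (B2 : 2 ^ k / (INR N + 1) ^ 2 * Rpower X (4 - sigma) <= exp (- (y / 64))).
  { eapply Rle_trans; [apply Rmult_le_compat_r; [lra|exact B1]|].
    rewrite Rpower_X, pow_X. unfold Rdiv at 1. rewrite <- exp_Ropp, <- !exp_plus. apply exp_le. simpl. nra. }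
  assert (B0 : 0 <= 2 ^ k / (INR N + 1) ^ 2 * Rpower X (4 - sigma)).
  { apply Rmult_le_pos; [|lra]. apply Rlt_le, Rdiv_lt_0_compat; [lra|]. apply pow_lt. pose proof (pos_INR N). lra. }
  assert (B3 : 2 ^ k / (INR N + 1) ^ 2 * Rpower X (4 - sigma) * Lm <= exp (- (y / 64)) * (4 * l)).
  { apply Rmult_le_compat; lra. }
  unfold w. lra. }
assert (A3 : 2 * (G * Rpower X (- eta)) * Lm <= 8 * w).
{ replace (- eta) with ((-1) * eta) by ring. rewrite Rpower_X_eta.
  assert (B2 : G * exp (-1 * y / 32) <= exp (- (y / 64))).
  { eapply Rle_trans; [apply Rmult_le_compat_r; [apply Rlt_le, exp_pos|exact Z]|].
    rewrite <- exp_plus. apply exp_le. lra. }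
  assert (B0 : 0 <= G * exp (-1 * y / 32)) by (apply Rmult_le_pos; [assumption|apply Rlt_le, exp_pos]).
  assert (B3 : G * exp (-1 * y / 32) * Lm <= exp (- (y / 64)) * (4 * l)) by (apply Rmult_le_compat; lra).
  unfold w. lra. }
lra.
Qed.

Lemma moment_quant eps : 0 < eps ->
  (forall t x v, T <= t <= 2 * T -> - (T / 2) <= v <= T / 2 -> - eta <= x ->
     Cmod (zeta (sigma + x, t + v)) <= exp (2 * Cz * Rpower l (1 - delta))) ->
  Rabs (moment k sigma T / Dsum k sigma - 1) <=
    2 * eps + 9 * / l + (1 + / eps) * (81000 * / l).
Proof using Hs Hd HC Hc Hc1 Hc2 Hl Heta Hk Hkl.
intros Heps Hz.
assert (X1 := X_ge1).
destruct (nfloor_ex (X ^ 2)) as [m [Hm1 Hm2]]; [apply pow2_ge_0|].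
assert (N1 : X ^ 2 <= INR (S m)) by (rewrite S_INR; lra).
assert (N2 : INR (S m) <= 2 * X ^ 2) by (rewrite S_INR; nra).
set (N := S m) in *.
assert (HT8 := T_ge).
assert (e0 := eta_pos).
assert (Ll := Lam_bounds).
assert (HNT := N_sqr_div_T_le N N2).
assert (HNe := Dsum_tail_small N N1).
assert (HLm := left_mass_small).
assert (HR := remainder_small N N1 N2).
destruct w_bounds as [[w0 w1] _].
assert (M := moment_core k N sigma T X eta (T / 2) (200 * w) eps Hk ltac:(unfold N; lia) e0 ltac:(lra) ltac:(lra)
  ltac:(lra) ltac:(lra) ltac:(lra) Heps).
eapply Rle_trans.
- apply M. intros t Ht. eapply Rle_trans; [|exact HR].
  apply pointwise_zeta; try lra.
  + apply Rlt_le, exp_pos.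
  + intros x v Hx Hv. apply Hz; lra.
- clear M HR.
  assert (il : 0 < / l <= / 4194304) by (split; [apply Rinv_0_lt_compat; lra|apply Rinv_le_contravar; lra]).
  set (a := 2 * INR N ^ 2 / T) in *. set (b := Lam eta (T / 2) ^ 2 * _ * _) in *. set (d := Rpower (INR N) _ * _) in *.
  assert (ie : 0 < / eps) by (apply Rinv_0_lt_compat; assumption).
  assert (a0 : 0 <= a).
  { unfold a. apply Rmult_le_pos; [pose proof (pow2_ge_0 (INR N)); lra|]. apply Rlt_le, Rinv_0_lt_compat; lra. }
  assert (w2 : w ^ 2 <= w) by nra.
  assert (b0 : 0 <= b).
  { unfold b. apply Rmult_le_pos; [apply Rmult_le_pos; [apply pow2_ge_0|apply Rlt_le, Rpower_pos]|].
    pose proof (Dsum_ge1 k (sigma - eta) Hk ltac:(lra)). lra. }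
  assert (A1 : eps * (1 + a) <= 2 * eps) by nra.
  (* [2 * 200^2 = 80000] and [16 * 2 * 16 = 512], both multiplied by [w^2 <= w <= 1 / l]. *)
  assert (A2 : 16 * (1 + a) * b + 2 * (200 * w) ^ 2 <= 81000 * / l).
  { assert (16 * (1 + a) * b <= 32 * (16 * w ^ 2)) by (apply Rmult_le_compat; lra). nra. }
  assert ((1 + / eps) * (16 * (1 + a) * b + 2 * (200 * w) ^ 2) <= (1 + / eps) * (81000 * / l)) by (apply Rmult_le_compat_l; lra).
  lra.
Qed.

End Quantitative.

Lemma max_to_moment sigma delta : 1 / 2 < sigma < 1 -> 0 < delta <= sigma ->
  (exists C, 0 < C /\ exists T0, forall T, T0 <= T ->
     forall beta, sigma - 1 / ln (ln T) <= beta ->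
       LT_le beta T (C * Rpower (ln T) (1 - delta))) ->
  exists c, 0 < c /\ moment_asymp sigma (fun T => c * Rpower (ln T) delta / ln (ln T)).
Proof.
intros Hs Hd [Cz [HC [T1 HL]]].
set (K := 7 / (1 - sigma) + 4 / (sigma - 1 / 2)).
assert (K0 : 0 < K) by (apply Rplus_lt_0_compat; apply Rdiv_lt_0_compat; lra).
(* One choice meets both smallness conditions, [c (2 Cz + 1) <= 1/64] for the power of [zeta] and
   [9 c K <= 1/64] for [D_k]; [576 = 64 * 9]. *)
set (c := / (64 * (2 * Cz + 1) + 576 * K)).
assert (Hden : 64 < 64 * (2 * Cz + 1) + 576 * K) by lra.
assert (c0 : 0 < c) by (apply Rinv_0_lt_compat; lra).
assert (cE : c * (64 * (2 * Cz + 1) + 576 * K) = 1) by (apply Rinv_l; lra).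
assert (c1 : c <= 1) by nra.
assert (Hc1 : c * (2 * Cz + 1) <= / 64) by nra.
assert (Hc2 : K * (9 * c) <= / 64) by nra.
exists c. split; [assumption|].
intros eps Heps.
set (B := 9 + (1 + / (eps / 4)) * 81000).
assert (ie : 0 < / (eps / 4)) by (apply Rinv_0_lt_compat; lra).
assert (B0 : 0 < B) by (unfold B; nra).
(* The three thresholds serve [ln_sqr_le], the condition [eta <= (sigma - 1/2) / 2], and
   [B / l <= eps / 2]. The threshold [2 T1] in the next line allows the hypothesis to be used at
   [T / 2]. *)
set (L := Rmax 4194304 (Rmax (exp (/ (sigma - 1 / 2))) (2 * B / eps))).
exists (Rmax (exp L) (2 * T1)). intros T HT k Hk Hkl.
assert (Ta : exp L <= T) by (eapply Rle_trans; [apply Rmax_l|exact HT]).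
assert (Tb : 2 * T1 <= T) by (eapply Rle_trans; [apply Rmax_r|exact HT]).
assert (Hl : L <= ln T) by (rewrite <- (ln_exp L); apply ln_le; [apply exp_pos|exact Ta]).
assert (L1 : 4194304 <= ln T) by (eapply Rle_trans; [apply Rmax_l|exact Hl]).
assert (L23 : Rmax (exp (/ (sigma - 1 / 2))) (2 * B / eps) <= ln T) by (eapply Rle_trans; [apply Rmax_r|exact Hl]).
assert (L2 : exp (/ (sigma - 1 / 2)) <= ln T) by (eapply Rle_trans; [apply Rmax_l|exact L23]).
assert (L3 : 2 * B / eps <= ln T) by (eapply Rle_trans; [apply Rmax_r|exact L23]).
assert (Le : / (sigma - 1 / 2) <= ln (ln T)).
{ rewrite <- (ln_exp (/ (sigma - 1 / 2))). apply ln_le; [apply exp_pos|exact L2]. }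
assert (is : 0 < / (sigma - 1 / 2)) by (apply Rinv_0_lt_compat; lra).
assert (He : (sigma + 1 / 2) / 2 <= sigma - / (2 * ln (ln T))).
{ assert (/ (2 * ln (ln T)) <= / (2 * / (sigma - 1 / 2))) by (apply Rinv_le_contravar; lra).
  replace (/ (2 * / (sigma - 1 / 2))) with ((sigma - 1 / 2) / 2) in H by (field; lra). lra. }
assert (Hk' : (1 <= k)%nat) by (destruct k; [discriminate Hk|lia]).
eapply Rle_trans.
- assert (ET : exp (ln T) = T) by (apply exp_ln; pose proof (exp_pos L); lra).
  assert (Q := moment_quant sigma delta Cz c k (ln T) Hs Hd HC (conj c0 c1) Hc1 Hc2 L1 He Hk' Hkl (eps / 4) ltac:(lra)).
  rewrite ET in Q. apply Q.
  intros t x v Ht Hv Hx. apply (zeta_region_bound sigma delta Cz T1 T); auto; lra.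
- set (l := ln T) in *.
  assert (E : 2 * (eps / 4) + 9 * / l + (1 + / (eps / 4)) * (81000 * / l) = eps / 2 + B * / l) by (unfold B; field; lra).
  rewrite E.
  assert (B * / l <= eps / 2); [|lra].
  apply (Rmult_le_reg_r l); [lra|]. rewrite Rmult_assoc, Rinv_l, Rmult_1_r by lra.
  apply (Rmult_le_compat_r (eps / 2)) in L3; [|lra].
  replace (2 * B / eps * (eps / 2)) with B in L3 by (field; lra). lra.
Qed.

Theorem theorem1p4 (sigma delta : R) (hs : 1/2 < sigma < 1) (hd : 0 < delta <= sigma) :
  (moment_asymp sigma (fun T => Rpower (ln T) delta) ->
     exists C, 0 < C /\ exists T0, forall T, T0 <= T ->
       LT_le sigma T (C * Rpower (ln T) (1 - delta)))
  /\
  ((exists C, 0 < C /\ exists T0, forall T, T0 <= T ->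
       forall beta, sigma - 1 / ln (ln T) <= beta ->
         LT_le beta T (C * Rpower (ln T) (1 - delta))) ->
     exists c, 0 < c /\
       moment_asymp sigma (fun T => c * Rpower (ln T) delta / ln (ln T))).
Proof.
split.
- apply moment_to_max; assumption.
- apply max_to_moment; assumption.
Qed.
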